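(* Let $D$ be the closed disk of radius $1/2$, and let $R_3$, $R_5$ be the regular Reuleaux triangle and the regular Reuleaux pentagon of width $1$. Let $L_{3,5}^{\mathrm R}$ be the infimum of $\operatorname{area}(U)$ over all compact convex sets $U\subset\mathbb R^2$ that contain a congruent copy of each of $D$, $R_3$, $R_5$. Then $$L_{3,5}^{\mathrm R}\ge 0.834.$$
   Context: Congruent copies are images under Euclidean isometries of $\mathbb R^2$, reflections included; area is two-dimensional Lebesgue measure. For $n\in\{3,5\}$, the regular Reuleaux $n$-gon of width $1$ is the intersection of the closed unit disks centered at the vertices of a regular $n$-gon of diameter $1$. Equivalently, $L_{3,5}^{\mathrm R}=\inf_{g_0,g_3,g_5}\operatorname{area}\operatorname{conv}(g_0D\cup g_3R_3\cup g_5R_5)$ with $g_0,g_3,g_5$ ranging over Euclidean isometries. *)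

(* Defs.v *)
From HB Require Import structures.
From mathcomp Require Import all_boot all_order all_algebra.
From mathcomp Require Import all_classical all_reals all_analysis.
From mathcomp Require Import ring lra.

Set Implicit Arguments.
Unset Strict Implicit.
Unset Printing Implicit Defensive.

Import Order.TTheory GRing.Theory Num.Theory.
Import numFieldNormedType.Exports.

Local Open Scope classical_set_scope.
Local Open Scope ring_scope.

(* [R^o] gives the plane its vector-space structure over [R]. *)
Notation plane R := (R^o * R^o)%type.

(* The norm that the library puts on a product is the sup norm, so the Euclidean
   distance is spelled out. Both induce the same topology, hence the library's
   [compact] is the usual compactness in the plane. *)
Definition edist (R : realType) (x y : plane R) : R :=
  Num.sqrt ((x.1 - y.1) ^+ 2 + (x.2 - y.2) ^+ 2).

Definition closed_disk (R : realType) (c : plane R) (r : R) : set (plane R) :=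
  [set x | edist x c <= r].

(* Includes the orientation-reversing isometries; surjectivity is automatic for
   distance-preserving self-maps of the plane. *)
Definition isometry (R : realType) (g : plane R -> plane R) : Prop :=
  forall x y, edist (g x) (g y) = edist x y.

Definition contains_congruent_copy (R : realType) (U K : set (plane R)) : Prop :=
  exists2 g : plane R -> plane R, isometry g & g @` K `<=` U.

Definition area (R : realType) (U : set (plane R)) : \bar R :=
  (lebesgue_measure \x lebesgue_measure)%E (U : set (R * R)).

Definition diameter (R : realType) (A : set (plane R)) : R :=
  sup [set edist p.1 p.2 | p in A `*` A].

(* [v] lists the vertices of a regular n-gon in counterclockwise order:
   arbitrary center [c], circumradius [r] and rotation angle [t]. *)
Definition regular_ngon (R : realType) (n : nat) (v : 'I_n -> plane R) : Prop :=
  exists c : plane R, exists2 r : R, 0 < r & exists t : R, forall k : 'I_n,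
    v k = (c.1 + r * cos (t + 2 * pi * k%:R / n%:R),
           c.2 + r * sin (t + 2 * pi * k%:R / n%:R)).

(* The diameter of a convex polygon is that of its set of vertices. *)
Definition regular_reuleaux (R : realType) (n : nat) (K : set (plane R)) : Prop :=
  exists v : 'I_n -> plane R,
    [/\ regular_ngon v, diameter (range v) = 1 &
        K = \bigcap_(k in [set: 'I_n]) closed_disk (v k) 1].

(* Regular Reuleaux n-gons exist for every odd n >= 3. *)
Lemma regular_reuleaux_exists (R : realType) (m : nat) :
  exists K : set (plane R), regular_reuleaux m.+1.*2.+1 K.
Proof.
set n := m.+1.*2.+1.
have n0 : (0 : R) < n%:R by rewrite ltr0n.
have nN0 : (n%:R : R) != 0 by rewrite gt_eqF.
have pi0 : (0 : R) < pi := pi_gt0 R.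
pose b : R := pi / (2 * n%:R).
have b0 : 0 < b by rewrite divr_gt0 // mulr_gt0.
have nb : n%:R * b = pi / 2 by rewrite /b; field.
have ltb : b < pi / 2.
  by rewrite -nb ltr_pMl // ltr1n.
have cb0 : 0 < cos b.
  by apply: cos_gt0_pihalf; rewrite ltb andbT (lt_trans _ b0)// oppr_lt0 divr_gt0.
pose r : R := (2 * cos b)^-1.
have r0 : 0 < r by rewrite invr_gt0 mulr_gt0.
have rb : 2 * r * cos b = 1 by rewrite /r; field; rewrite gt_eqF.
pose w (k : nat) : plane R :=
  (0 + r * cos (0 + 2 * pi * k%:R / n%:R), 0 + r * sin (0 + 2 * pi * k%:R / n%:R)).
have wdist i j : edist (w i) (w j) = `|2 * r * sin (pi * (i%:R - j%:R) / n%:R)|.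
  rewrite /edist -sqrtr_sqr; congr Num.sqrt; rewrite /= !add0r.
  set x := 2 * pi * i%:R / n%:R; set y := 2 * pi * j%:R / n%:R.
  set h := pi * (i%:R - j%:R) / n%:R.
  have xy : x - y = h *+ 2 by rewrite mulr2n /x /y /h; field.
  have c2 : 1 - 2 * sin h ^+ 2 = cos x * cos y + sin x * sin y.
    by rewrite -cosB xy mulr2n cosD -!expr2 cos2sin2; ring.
  have sx := cos2Dsin2 x; have sy := cos2Dsin2 y.
  transitivity (r ^+ 2 * ((cos x ^+ 2 + sin x ^+ 2) + (cos y ^+ 2 + sin y ^+ 2)
     - 2 * (cos x * cos y + sin x * sin y))); first by ring.
  by rewrite sx sy -c2 -/h; ring.
have wdistC i j : edist (w i) (w j) = edist (w j) (w i).
  by rewrite !wdist -[in RHS]opprB mulrN mulNr sinN mulrN normrN.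
have nbE : b = pi / (2 * n%:R) by [].
have hcos d : (d <= n)%N ->
    exists2 e : nat, (0 < e <= n)%N & sin (pi * d%:R / n%:R) = cos (e%:R * b).
  move=> dn; case: (ltnP d.*2 n) => h.
    exists (n - d.*2)%N; first by rewrite subn_gt0 h leq_subr.
    rewrite natrB ?(ltnW h)// -cosBpihalf -cosN; congr cos.
    by rewrite nbE -muln2 natrM; field.
  exists (d.*2 - n)%N.
    rewrite subn_gt0 ltn_neqAle h andbT; apply/andP; split.
      by apply/eqP => /(congr1 odd); rewrite /n /= !odd_double.
    by rewrite leq_subLR addnn leq_double.
  rewrite natrB // -cosBpihalf; congr cos.
  by rewrite nbE -muln2 natrM; field.
have wle i j : (j <= i < n)%N -> edist (w i) (w j) <= 1.
  move=> /andP[ji iltn]; rewrite wdist -natrB //.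
  have [|e /andP[e0 en] ->] := hcos (i - j)%N.
    by rewrite (leq_trans (leq_subr _ _))// ltnW.
  have eb : b <= e%:R * b by rewrite ler_peMl ?(ltW b0)// ler1n.
  have ebn : e%:R * b <= pi / 2 by rewrite -nb ler_pM2r// ler_nat.
  have c0 : 0 <= cos (e%:R * b).
    apply: cos_ge0_pihalf; rewrite ebn andbT; apply: (le_trans _ (le_trans (ltW b0) eb)).
    by rewrite oppr_le0 divr_ge0 // ltW.
  have cb : cos (e%:R * b) <= cos b.
    rewrite leNgt; apply/negP; rewrite ltr_cos ?in_itv /= => [||]; last first.
    - by rewrite (ltW b0); lra.
    - by rewrite (le_trans (ltW b0) eb); lra.
    - by rewrite ltNge eb.
  by rewrite ger0_norm ?mulr_ge0 ?(ltW r0)// -[leRHS]rb ler_pM2l // mulr_gt0.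
pose v (k : 'I_n) := w k.
exists (\bigcap_(k in [set: 'I_n]) closed_disk (v k) 1), v; split=> //.
  by exists 0, r => //; exists 0.
have vle i j : edist (v i) (v j) <= 1.
  case: (leqP j i) => h; first by rewrite wle // h ltn_ord.
  by rewrite /v wdistC wle // (ltnW h) ltn_ord.
have m1n : (m.+1 < n)%N by rewrite /n ltnS -addnn leq_addr.
have v1 : edist (v (Ordinal m1n)) (v ord0) = 1.
  rewrite /v wdist /= subr0.
  have -> : sin (pi * m.+1%:R / n%:R) = cos b.
    rewrite -cosBpihalf -cosN; congr cos.
    have -> : (m.+1%:R : R) = (n%:R - 1) / 2.
      by rewrite /n -[in RHS]natr1 -muln2 natrM; field.
    by rewrite nbE; field.
  by rewrite rb normr1.
rewrite /diameter; apply/eqP; rewrite eq_le; apply/andP; split.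
  apply: ge_sup; last first.
    by move=> _ [[_ _] [[i _ <-] [j _ <-]] <-]; exact: vle.
  by exists 1, (v (Ordinal m1n), v ord0).
apply: ub_le_sup; last by exists (v (Ordinal m1n), v ord0).
by exists 1 => _ [[_ _] [[i _ <-] [j _ <-]] <-]; exact: vle.
Qed.

Definition L35 (R : realType) (R3 R5 : set (plane R)) : \bar R :=
  ereal_inf [set area U | U in
    [set U : set (plane R) |
      [/\ compact U,
          convex_set U,
          contains_congruent_copy U (closed_disk 0 2^-1),
          contains_congruent_copy U R3 &
          contains_congruent_copy U R5]]].

(* Main.v *)
Require Import Defs.
From Stdlib Require Import ZArith List.
From mathcomp Require Import all_boot all_order all_algebra.
From mathcomp Require Import all_classical all_reals all_analysis.
From mathcomp Require Import measurable_realfun ring lra zify ssrZ.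

(* Put the centre of the disk at the origin and let x, z be the translations and
   u = (c, s) the relative rotation of the two Reuleaux polygons; the symmetries
   of the polygons bring the angle of u into [-pi/15, pi/15]. A convex set that
   contains a star-shaped polygon has at least its area. If the vertices of such
   a polygon are taken, in a fixed cyclic order, from the disk and from the two
   copies, the area is affine in (x, z, x1 z2 - x2 z1) for fixed u and affine in u
   for fixed x, z. So for u in a short arc a lower bound for the area of every
   cover is certified by finitely many polygons and nonnegative weights whose
   weighted area has almost vanishing linear part: only its values at the two
   ends of the arc matter. Polygons with vertices on the disk and on a single
   copy show beforehand, in a few rounds, that a cover of area less than 0.834
   forces |x| <= 0.06272 and |z| <= 0.06793, so that the chosen cyclic orders are
   really star-shaped. The polygons and weights were found by linear programming;
   the finitely many integer inequalities that remain are checked by computation. *)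

Set Implicit Arguments.
Unset Strict Implicit.
Unset Printing Implicit Defensive.

Import Order.TTheory GRing.Theory Num.Theory.
Import numFieldNormedType.Exports.

Local Open Scope classical_set_scope.
Local Open Scope ring_scope.
Delimit Scope Z_scope with Z.

(** * Measure of triangles *)

Section plane_measure.
Context {R : realType}.
Notation mu := (lebesgue_measure \x lebesgue_measure)%E.

(** Two obstacles shape the argument. The area is affine in [u], but an arc is not its chord: [u] is
    a combination of the two ends with coefficient sum at least 1, so the smaller end value is a
    bound only where the part depending on [u] is nonnegative at both ends. And a polygon may be
    used only if its turns stay positive over a whole region of translations; a large region leaves
    only coarse polygons, hence the rounds, each of which shrinks the region enough to admit finer
    ones. They start from single points: the hull of the disk and a point at distance 0.7 from its
    centre has area about 0.8366, so a cover of area below 0.834 stays within 0.7 of that centre.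
    The range of angles comes from the rotations by 2 pi / 3 and 2 pi / 5, which together generate
    the rotation by 2 pi / 15; mirror symmetry of both polygons turns reflected copies into rotated
    ones. Rounding requires no error analysis: the tabulated points are rational points inside the
    bodies, so every polygon really lies in the cover. *)

Lemma open_plane_measurable (O : set (plane R)) :
  open O -> measurable (O : set (R * R)).
Proof.
move=> oO.
pose box (b : rat * rat * rat * rat) : set (R * R) :=
  [set` `]ratr b.1.1.1, ratr b.1.1.2[%R] `*` [set` `]ratr b.1.2, ratr b.2[%R].
have -> : (O : set (R * R)) =
    \bigcup_b (if `[< box b `<=` O >] then box b else set0).
  apply/seteqP; split => [[x y] Oxy | p [b _]]; last by case: asboolP => // + pb; exact.
  have /nbhs_ballP[e /= e0 eO] := open_nbhs_nbhs (conj oO Oxy).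
  have rt (t : R) : exists q1 q2 : rat, ((t - e < ratr q1 < t) && (t < ratr q2 < t + e)).
    have [|q1 h1] := @rat_in_itvoo R (t - e) t; first by rewrite ltrBlDr ltrDl.
    have [|q2 h2] := @rat_in_itvoo R t (t + e); first by rewrite ltrDl.
    by exists q1, q2; apply/andP; split.
  have [a1 [b1 /andP[/andP[a11 a12] /andP[b11 b12]]]] := rt x.
  have [a2 [b2 /andP[/andP[a21 a22] /andP[b21 b22]]]] := rt y.
  exists (a1, b1, a2, b2) => //; case: asboolP => [_|].
    by split; rewrite /= in_itv /= ?a12 ?b11 ?a22 ?b21.
  case=> -[u v] [/=]; rewrite !in_itv /= => /andP[u1 u2] /andP[v1 v2].
  apply: eO; split; rewrite /ball /= ltr_norml; apply/andP; split; lra.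
apply: countable_bigcupT_measurable => [|b]; first exact: countableP.
by case: asboolP => // _; apply: measurableX; exact: measurable_itv.
Qed.

Lemma compact_plane_measurable (U : set (plane R)) :
  compact U -> measurable (U : set (R * R)).
Proof.
move=> cU; rewrite -[U]setCK; apply: measurableC; apply: open_plane_measurable.
by apply: closed_openC; apply: compact_closed => //; exact: norm_hausdorff.
Qed.

Lemma integral_affine (a b p q : R) : a <= b ->
  (\int[lebesgue_measure]_(x in `[a, b]) (p + q * x)%:E)%E
    = ((b - a) * (p + q * ((a + b) / 2)))%:E.
Proof.
rewrite le_eqVlt => /orP[/eqP <-|ab].
  by rewrite set_itv1 integral_set1 subrr mul0r.
pose F (x : R) : R := p * x + q / 2 * x ^+ 2.
have dF (x : R) : is_derive x (1 : R) F (p + q * x).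
  by rewrite /F; apply: is_derive_eq; rewrite /GRing.scale /=; field.
have cF : continuous F.
  move=> x; apply: differentiable_continuous; apply/derivable1_diffP.
  by have [] := dF x.
rewrite (@continuous_FTC2 _ _ F) //.
- by rewrite -EFinB /F; congr EFin; field.
- apply: continuous_subspaceT => x.
  by apply: cvgD; [exact: cvg_cst|apply: cvgM; [exact: cvg_cst|exact: cvg_id]].
- split.
  + by move=> x _; have [] := dF x.
  + exact: cvg_at_right_filter (cF a).
  + exact: cvg_at_left_filter (cF b).
- by move=> x _; rewrite derive1E; have [_ ->] := dF x.
Qed.

(** Tonelli: the vertical section of [W] over [x] contains an open interval whose length is affine
    in [x], and an affine function integrates to width times midpoint value. *)
Lemma slab_measure (W : set (R * R)) (a b f0 f1 g0 g1 : R) :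
  measurable W -> a <= b ->
  (forall x, a < x < b -> f0 + f1 * x <= g0 + g1 * x) ->
  (forall x y, a < x < b -> f0 + f1 * x < y < g0 + g1 * x -> W (x, y)) ->
  (((b - a) * ((g0 - f0) + (g1 - f1) * ((a + b) / 2)))%:E <=
     mu (W `&` [set p | (a < p.1 < b)%R]))%E.
Proof.
move=> mW ab fg hW.
have mS : measurable (W `&` [set p | (a < p.1 < b)%R]).
  apply: measurableI => //.
  rewrite (_ : [set p | _] = [set` `]a, b[%R] `*` setT); last first.
    by apply/seteqP; split=> -[x y] /=; rewrite in_itv /=; [|case].
  by apply: measurableX => //; exact: measurable_itv.
have maff : measurable_fun setT (fun x : R => (g0 - f0) + (g1 - f1) * x).
  by apply: measurable_funD; [exact: measurable_cst|apply: measurable_funM; [exact: measurable_cst|exact: measurable_id]].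
rewrite -integral_affine// integral_itv_bndoo; last first.
  by apply/measurable_EFinP; exact: measurable_funTS.
rewrite /product_measure1.
have mxs := measurable_fun_xsection (@lebesgue_measure R) mS.
apply: (@le_trans _ _ (\int[lebesgue_measure]_(x in `]a, b[)
   (lebesgue_measure (xsection (W `&` [set p | (a < p.1 < b)%R]) x)))%E); last first.
  by apply: ge0_subset_integral => //; exact: measurable_itv.
apply: ge0_le_integral => //.
- by move=> x; rewrite /= in_itv /= => /fg h; rewrite lee_fin; lra.
- by apply/measurable_EFinP; exact: measurable_funTS.
- exact: measurable_funTS.
move=> x; rewrite /= in_itv /= => axb.
have h := fg _ axb.
apply: (@le_trans _ _ (lebesgue_measure [set` `]f0 + f1 * x, g0 + g1 * x[%R])).
  rewrite lebesgue_measure_itv /= lte_fin; case: ltP => h'; rewrite -?EFinB lee_fin; lra.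
apply: le_measure; rewrite ?inE.
- exact: measurable_itv.
- exact: measurable_xsection.
by move=> y; rewrite /= in_itv /= => hy; rewrite xsectionE /=; split => //; exact: hW.
Qed.

Definition opentri (p q r : R * R) : set (R * R) :=
  [set z | exists al be ga : R, [/\ 0 < al, 0 < be, 0 < ga, al + be + ga = 1 &
    z = (al * p.1 + be * q.1 + ga * r.1, al * p.2 + be * q.2 + ga * r.2)]].

Lemma between_conv (F G y : R) : F < y < G ->
  exists2 t, 0 < t < 1 & y = (1 - t) * F + t * G.
Proof.
move=> /andP[Fy yG]; have d0 : 0 < G - F by lra.
exists ((y - F) / (G - F)); first by rewrite divr_gt0 ?ltr_pdivrMr ?mul1r; lra.
by field; rewrite gt_eqF.
Qed.

Lemma slab_measure_norm (W : set (R * R)) (a b f0 f1 g0 g1 : R) :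
  measurable W -> a <= b ->
  (forall x, a < x < b -> f0 + f1 * x <= g0 + g1 * x) \/
  (forall x, a < x < b -> g0 + g1 * x <= f0 + f1 * x) ->
  (forall x t, a < x < b -> 0 < t < 1 ->
     W (x, (1 - t) * (f0 + f1 * x) + t * (g0 + g1 * x))) ->
  (((b - a) * `|(g0 - f0) + (g1 - f1) * ((a + b) / 2)|)%:E <=
     mu (W `&` [set p | (a < p.1 < b)%R]))%E.
Proof.
move=> mW; rewrite le_eqVlt => /orP[/eqP <- _ _|ab].
  by rewrite subrr mul0r measure_ge0.
have m : a < (a + b) / 2 < b by apply/andP; split; lra.
move=> [h|h] hW; have hm := h _ m.
- rewrite ger0_norm; last by lra.
  apply: slab_measure => //; first exact: ltW.
  move=> x y ax /between_conv[t t01 ->]; exact: hW.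
- rewrite ler0_norm; last by lra.
  have -> : - (g0 - f0 + (g1 - f1) * ((a + b) / 2)) = (f0 - g0) + (f1 - g1) * ((a + b) / 2) by ring.
  apply: slab_measure => //; first exact: ltW.
  move=> x y ax /between_conv[t /andP[t0 t1] ->].
  rewrite addrC -[in X in X * _ + _](subKr 1 t); apply: hW => //; lra.
Qed.

(** The two sides through the apex [(v1, v2)] bound a slab over the strip between the apex and the
    vertical side. Confining the measure to that strip is what allows two such triangles to be
    added. *)
Lemma vertical_triangle_measure (W : set (R * R)) (v1 v2 q1 q2 m2 : R) :
  measurable W -> opentri (v1, v2) (q1, q2) (q1, m2) `<=` W ->
  ((`|q1 - v1| * `|m2 - q2| / 2)%:E <=
     mu (W `&` [set p | (Num.min v1 q1 < p.1 < Num.max v1 q1)%R]))%E.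
Proof.
move=> mW sW; have [->|vq] := eqVneq q1 v1.
  by rewrite subrr normr0 !mul0r measure_ge0.
have d0 : q1 - v1 != 0 by rewrite subr_eq0.
pose k := (q2 - v2) / (q1 - v1); pose l := (m2 - v2) / (q1 - v1).
have kE x : v2 - k * v1 + k * x = v2 + (x - v1) / (q1 - v1) * (q2 - v2).
  by rewrite /k; field.
have lE x : v2 - l * v1 + l * x = v2 + (x - v1) / (q1 - v1) * (m2 - v2).
  by rewrite /l; field.
set a := Num.min v1 q1; set b := Num.max v1 q1.
have ab : a <= b by rewrite /a /b minEle maxEle; case: ifP => // /negbT; rewrite -ltNge => /ltW.
have s01 x : a < x < b -> 0 < (x - v1) / (q1 - v1) < 1.
  have [lt|lt|e] := ltgtP v1 q1; last by rewrite e eqxx in vq.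
    by rewrite /a /b (min_idPl (ltW lt)) (max_idPr (ltW lt)) => /andP[x1 x2];
      rewrite divr_gt0 ?ltr_pdivrMr ?mul1r; lra.
  rewrite /a /b (min_idPr (ltW lt)) (max_idPl (ltW lt)) => /andP[x1 x2].
  have -> : (x - v1) / (q1 - v1) = (v1 - x) / (v1 - q1) by field; lra.
  by rewrite divr_gt0 ?ltr_pdivrMr ?mul1r; lra.
have := @slab_measure_norm W a b (v2 - k * v1) k (v2 - l * v1) l mW ab.
have -> : (b - a) * `|v2 - l * v1 - (v2 - k * v1) + (l - k) * ((a + b) / 2)| =
   `|q1 - v1| * `|m2 - q2| / 2.
  have -> : a + b = v1 + q1 by rewrite /a /b addr_min_max.
  have -> : v2 - l * v1 - (v2 - k * v1) + (l - k) * ((v1 + q1) / 2) = (m2 - q2) / 2.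
    by rewrite /l /k; field.
  have -> : b - a = `|q1 - v1|.
    rewrite /a /b; have [lt|lt|e] := ltgtP v1 q1.
    - by rewrite gtr0_norm // subr_gt0.
    - by rewrite ltr0_norm ?subr_lt0 // opprB.
    - by rewrite e subrr normr0.
  by rewrite normrM (@ger0_norm _ 2^-1) ?mulrA // invr_ge0.
apply.
- have [h|h] := leP q2 m2; [left|right] => x /s01 /andP[s0 s1]; rewrite kE lE; nra.
- move=> x t /s01; set s := _ / _ => /andP[s0 s1] /andP[t0 t1]; apply: sW.
  have xE : x = v1 + s * (q1 - v1) by rewrite /s; field.
  exists (1 - s), ((1 - t) * s), (t * s); split.
  - by rewrite subr_gt0.
  - by rewrite mulr_gt0 ?subr_gt0.
  - by rewrite mulr_gt0.
  - by ring.
  - by rewrite kE lE -/s /=; congr pair; [rewrite [LHS]xE|]; ring.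
Qed.

(** The vertical line through the middle vertex cuts the triangle into two triangles with a common
    vertical side, lying over disjoint strips. *)
Lemma sorted_triangle_measure (W : set (R * R)) (p q r : R * R) :
  measurable W -> opentri p q r `<=` W -> p.1 <= q.1 -> q.1 <= r.1 ->
  ((`|(q.1 - p.1) * (r.2 - p.2) - (q.2 - p.2) * (r.1 - p.1)| / 2)%:E <= mu W)%E.
Proof.
case: p q r => [p1 p2] [q1 q2] [r1 r2] /= mW sW pq qr.
have [e|pr] := eqVneq p1 r1.
  have [e1 e2] : p1 = q1 /\ r1 = q1 by split; lra.
  by rewrite e1 e2 !subrr !(mul0r, mulr0) subrr normr0 mul0r measure_ge0.
have d0 : 0 < r1 - p1 by rewrite subr_gt0 lt_neqAle pr (le_trans pq).
pose la := (q1 - p1) / (r1 - p1).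
have la0 : 0 <= la by apply: divr_ge0; lra.
have la1 : la <= 1 by rewrite ler_pdivrMr // mul1r; lra.
(* [(q1, m2)] is the point of the side from [p] to [r] on the vertical line through [q]. *)
pose m2 := (1 - la) * p2 + la * r2.
have q1E : q1 = (1 - la) * p1 + la * r1 by rewrite /la; field; rewrite gt_eqF.
have A := @vertical_triangle_measure W p1 p2 q1 q2 m2 mW.
have B := @vertical_triangle_measure W r1 r2 q1 q2 m2 mW.
pose L := W `&` [set z | (p1 < z.1 < q1)%R].
pose M := W `&` [set z | (q1 < z.1 < r1)%R].
have mI (a b : R) : measurable (W `&` [set z | (a < z.1 < b)%R]).
  apply: measurableI => //.
  rewrite (_ : [set p | _] = [set` `]a, b[%R] `*` setT); last first.
    by apply/seteqP; split=> -[x y] /=; rewrite in_itv /=; [|case].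
  by apply: measurableX => //; exact: measurable_itv.
have AL : (((q1 - p1) * `|m2 - q2| / 2)%:E <= mu L)%E.
  have [->|nz] := eqVneq p1 q1; first by rewrite subrr !mul0r measure_ge0.
  have la00 : 0 < la by rewrite divr_gt0 // subr_gt0 lt_neqAle nz.
  move: A; rewrite (min_idPl pq) (max_idPr pq) ger0_norm ?subr_ge0 //; apply.
  move=> z [al [be [ga [a0 b0 c0 s1 ->]]]]; apply: sW.
  exists (al + ga * (1 - la)), be, (ga * la); split=> //=.
  - by rewrite ltr_pwDl // mulr_ge0 ?subr_ge0 // ltW.
  - by rewrite mulr_gt0.
  - by rewrite -[RHS]s1; ring.
  - by congr pair; rewrite /m2 ?[in X in ga * X]q1E; ring.
have BM : (((r1 - q1) * `|m2 - q2| / 2)%:E <= mu M)%E.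
  have [->|nz] := eqVneq q1 r1; first by rewrite subrr !mul0r measure_ge0.
  have la00 : 0 < 1 - la.
    rewrite subr_gt0 ltr_pdivrMr // mul1r ltrD2r lt_neqAle qr andbT; exact: nz.
  move: B; rewrite (min_idPr qr) (max_idPl qr) ler0_norm ?subr_le0 // opprB; apply.
  move=> z [al [be [ga [a0 b0 c0 s1 ->]]]]; apply: sW.
  exists (ga * (1 - la)), be, (al + ga * la); split=> //=.
  - by rewrite mulr_gt0.
  - by rewrite ltr_pwDl // mulr_ge0 // ltW.
  - by rewrite -[RHS]s1; ring.
  - by congr pair; rewrite /m2 ?[in X in ga * X]q1E; ring.
have -> : (`|(q1 - p1) * (r2 - p2) - (q2 - p2) * (r1 - p1)| / 2)%:E =
   (((q1 - p1) * `|m2 - q2| / 2)%:E + ((r1 - q1) * `|m2 - q2| / 2)%:E)%E.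
  rewrite -EFinD; congr EFin.
  have -> : (q1 - p1) * (r2 - p2) - (q2 - p2) * (r1 - p1) = (r1 - p1) * (m2 - q2).
    by rewrite /m2 /la; field; rewrite gt_eqF.
  by rewrite normrM gtr0_norm //; field.
apply: (le_trans (leeD AL BM)).
rewrite -measureU //; [|exact: mI|exact: mI|].
  apply: le_measure; rewrite ?inE //; first by apply: measurableU; exact: mI.
  by move=> z [[]|[]].
by apply/seteqP; split => // z [[_ /= /andP[_ h1]] [_ /= /andP[h2 _]]]; lra.
Qed.

Lemma opentriCA (p q r : R * R) : opentri q p r = opentri p q r.
Proof.
by apply/seteqP; split=> z [al [be [ga [? ? ? s ->]]]]; exists be, al, ga;
  split=> //; rewrite -?s 1?(addrC be) // ![be * _ + _]addrC.
Qed.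

Lemma opentriAC (p q r : R * R) : opentri p r q = opentri p q r.
Proof.
by apply/seteqP; split=> z [al [be [ga [? ? ? s ->]]]]; exists al, ga, be;
  split=> //; rewrite -?s 1?addrAC // ![_ + ga * _]addrAC.
Qed.

Lemma triangle_measure (W : set (R * R)) (p q r : R * R) :
  measurable W -> opentri p q r `<=` W ->
  ((`|(q.1 - p.1) * (r.2 - p.2) - (q.2 - p.2) * (r.1 - p.1)| / 2)%:E <= mu W)%E.
Proof.
move=> mW.
pose D (p q r : R * R) := `|(q.1 - p.1) * (r.2 - p.2) - (q.2 - p.2) * (r.1 - p.1)|.
have DCA a b c : D b a c = D a b c by rewrite /D -normrN; congr `|_|; ring.
have DAC a b c : D a c b = D a b c by rewrite /D -normrN; congr `|_|; ring.
rewrite -/(D p q r); have S a b c : opentri a b c `<=` W -> a.1 <= b.1 -> b.1 <= c.1 ->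
  ((D a b c / 2)%:E <= mu W)%E by exact: sorted_triangle_measure.
have [pq|/ltW pq] := leP p.1 q.1; have [qr|/ltW qr] := leP q.1 r.1;
  have [pr|/ltW pr] := leP p.1 r.1 => sW.
- exact: S.
- exact: S.
- by rewrite -DAC; apply: S => //; rewrite opentriAC.
- by rewrite -DAC -DCA; apply: S => //; rewrite opentriCA opentriAC.
- by rewrite -DCA; apply: S => //; rewrite opentriCA.
- by rewrite -DCA -DAC; apply: S => //; rewrite opentriAC opentriCA.
- by rewrite -DCA -DAC -DCA; apply: S => //; rewrite opentriCA opentriAC opentriCA.
- by rewrite -DCA -DAC -DCA; apply: S => //; rewrite opentriCA opentriAC opentriCA.
Qed.
End plane_measure.

(** * Area of star-shaped polygons *)

Definition cross {R : realType} (p q : R * R) : R := p.1 * q.2 - p.2 * q.1.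

(** Each intermediate vertex must also turn positively to the end [b]: the chain then stays inside
    one convex cone, and signs of cross products alone exclude any winding. *)
Fixpoint chain_ok {R : realType} (a : R * R) (l : seq (R * R)) (b : R * R) : Prop :=
  if l is q :: l' then [/\ 0 < cross a q, 0 < cross q b & chain_ok q l' b]
  else 0 < cross a b.

Fixpoint chain_sum {R : realType} (a : R * R) (l : seq (R * R)) (b : R * R) : R :=
  if l is q :: l' then cross a q + chain_sum q l' b else cross a b.

Section polygon.
Context {R : realType}.
Notation mu := (lebesgue_measure \x lebesgue_measure)%E.
Implicit Types (U W : set (R * R)) (o a b c : R * R).

Definition translate o a : R * R := (o.1 + a.1, o.2 + a.2).
Definition diff z o : R * R := (z.1 - o.1, z.2 - o.2).

Definition segment_closed U := forall (p q : R * R) t, 0 <= t <= 1 -> U p -> U q ->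
  U ((1 - t) * p.1 + t * q.1, (1 - t) * p.2 + t * q.2).

(** Closed along [a] and open along [b]: adjacent cones, and likewise the fan triangles below, are
    then disjoint as sets, and their measures add without any discussion of null sets. *)
Definition cone o a b : set (R * R) :=
  [set z | 0 <= cross a (diff z o) /\ 0 < cross (diff z o) b].

Definition fan_triangle o a b : set (R * R) :=
  [set z | [/\ 0 <= cross a (diff z o), 0 < cross (diff z o) b &
     cross a (diff z o) + cross (diff z o) b <= cross a b]].

Lemma affine_measurable (p q r : R) :
  measurable_fun setT (fun z : R * R => p + q * z.1 + r * z.2).
Proof.
apply: measurable_funD; [apply: measurable_funD|]; first exact: measurable_cst.
  by apply: measurable_funM; [exact: measurable_cst|exact: measurable_fst].
by apply: measurable_funM; [exact: measurable_cst|exact: measurable_snd].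
Qed.

Lemma halfplane_measurable (p q r : R) :
  measurable [set z : R * R | 0 <= p + q * z.1 + r * z.2].
Proof.
have := affine_measurable p q r => /(_ measurableT [set` `[0, +oo[%R]).
rewrite setTI => /(_ (measurable_itv _)); congr measurable.
by apply/seteqP; split=> z /=; rewrite in_itv /= andbT.
Qed.

Lemma open_halfplane_measurable (p q r : R) :
  measurable [set z : R * R | 0 < p + q * z.1 + r * z.2].
Proof.
have := affine_measurable p q r => /(_ measurableT [set` `]0, +oo[%R]).
rewrite setTI => /(_ (measurable_itv _)); congr measurable.
by apply/seteqP; split=> z /=; rewrite in_itv /= andbT.
Qed.

Lemma fan_triangle_measurable o a b : measurable (fan_triangle o a b).
Proof.
have -> : fan_triangle o a b =
  ([set z | 0 <= (a.2 * o.1 - a.1 * o.2) + (- a.2) * z.1 + a.1 * z.2] `&`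
   [set z | 0 < (b.1 * o.2 - b.2 * o.1) + b.2 * z.1 + (- b.1) * z.2]) `&`
   [set z | 0 <= (cross a b - (a.2 * o.1 - a.1 * o.2) - (b.1 * o.2 - b.2 * o.1))
      + (a.2 - b.2) * z.1 + (b.1 - a.1) * z.2].
  apply/seteqP; split=> z; rewrite /fan_triangle /= /cross /diff /=.
    by move=> [h1 h2 h3]; repeat split; lra.
  by move=> [[h1 h2] h3]; split; lra.
apply: measurableI; [apply: measurableI|].
- exact: halfplane_measurable.
- exact: open_halfplane_measurable.
- exact: halfplane_measurable.
Qed.

Lemma fan_triangle_sub U o a b : segment_closed U -> 0 < cross a b ->
  U o -> U (translate o a) -> U (translate o b) -> fan_triangle o a b `<=` U.
Proof.
move=> cU ab Uo Ua Ub z [za zb zab].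
set w := diff z o in za zb zab.
pose s := cross w b / cross a b; pose t := cross a w / cross a b.
have s0 : 0 < s by rewrite divr_gt0.
have t0 : 0 <= t by rewrite divr_ge0 // ltW.
have st : s + t <= 1 by rewrite -mulrDl ler_pdivrMr // mul1r addrC.
have zE : z = (o.1 + s * a.1 + t * b.1, o.2 + s * a.2 + t * b.2).
  have nz : cross a b != 0 by rewrite gt_eqF.
  by rewrite [LHS]surjective_pairing; congr pair; rewrite /s /t /w; move: nz;
    rewrite /cross /diff /= => nz; field.
have s1 : s <= 1 by lra.
have [e|ne] := eqVneq (s + t) 0; first by lra.
(* Convexity is used twice: for the point with weight [t / (s + t)] on the far side of the triangle,
   then on the segment from [o] to that point. *)
have := cU _ _ (t / (s + t)) _ Ua Ub; rewrite divr_ge0 /=; [|lra..].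
rewrite ler_pdivrMr ?mul1r; last by lra.
rewrite lerDr ltW // => /(_ isT) Uab.
have := cU _ _ (s + t) _ Uo Uab; rewrite st andbT (addr_ge0 (ltW s0) t0) => /(_ isT).
congr U; rewrite zE; rewrite /translate /=; congr pair; field; exact: ne.
Qed.

Lemma fan_triangle_measure o a b : 0 < cross a b ->
  ((cross a b / 2)%:E <= mu (fan_triangle o a b))%E.
Proof.
move=> ab.
have sub : opentri o (translate o a) (translate o b) `<=` fan_triangle o a b.
  move=> z [al [be [ga [a0 b0 c0 s1 ->]]]].
  have -> : al = 1 - be - ga by rewrite -s1; ring.
  rewrite /fan_triangle /=.
  set w := diff _ _.
  have -> : w = (be * a.1 + ga * b.1, be * a.2 + ga * b.2).
    by rewrite /w /diff /translate /=; congr pair; ring.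
  have -> : cross a (be * a.1 + ga * b.1, be * a.2 + ga * b.2) = ga * cross a b.
    by rewrite /cross /=; ring.
  have -> : cross (be * a.1 + ga * b.1, be * a.2 + ga * b.2) b = be * cross a b.
    by rewrite /cross /=; ring.
  split; [by rewrite mulr_ge0 ?ltW|by rewrite mulr_gt0|].
  by rewrite -mulrDl ger_pMl //; lra.
have := triangle_measure (fan_triangle_measurable o a b) sub; apply: le_trans.
rewrite lee_fin ler_pM2r // (le_trans _ (ler_norm _)) // /cross /translate /= le_eqVlt.
by apply/orP; left; apply/eqP; ring.
Qed.

(** The three-term Plücker relation between [a], [q], [b] and the point writes the missing cross
    product as a nonnegative combination of the known ones. *)
Lemma cone_left o a q b : 0 < cross a q -> 0 < cross q b -> 0 < cross a b ->
  cone o a q `<=` cone o a b.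
Proof.
move=> aq qb ab z [h1 h2]; split=> //; set w := diff z o in h1 h2 *.
rewrite -(pmulr_rgt0 _ aq).
have -> : cross a q * cross w b = cross a b * cross w q + cross a w * cross q b.
  by rewrite /cross; ring.
by rewrite ltr_pwDl ?mulr_gt0 // mulr_ge0 // ltW.
Qed.

Lemma cone_right o a q b : 0 < cross a q -> 0 < cross q b -> 0 < cross a b ->
  cone o q b `<=` cone o a b.
Proof.
move=> aq qb ab z [h1 h2]; split=> //; set w := diff z o in h1 h2 *.
rewrite -(pmulr_lge0 _ qb).
have -> : cross a w * cross q b = cross a q * cross w b + cross a b * cross q w.
  by rewrite /cross; ring.
by rewrite addr_ge0 // mulr_ge0 // ltW.
Qed.

(** A fan of triangles from [o]. The witness [W] is kept inside the cone from [a] to [b] because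
    this makes it disjoint from the triangle that the induction puts in front of it. *)
Lemma chain_measure U o l a b : segment_closed U -> U o -> U (translate o a) ->
  U (translate o b) -> (forall q, List.In q l -> U (translate o q)) ->
  0 < cross a b -> chain_ok a l b ->
  exists W, [/\ measurable W, W `<=` U, W `<=` cone o a b &
    ((chain_sum a l b / 2)%:E <= mu W)%E].
Proof.
move=> cU Uo Ua Ub; elim: l a Ua => [|q l IH] a Ua /= Ul ab.
  move=> _; exists (fan_triangle o a b); split.
  - exact: fan_triangle_measurable.
  - exact: fan_triangle_sub.
  - by move=> z [].
  - exact: fan_triangle_measure.
move=> [aq qb okl]; have Uq : U (translate o q) by apply: Ul; left.
have [|W [mW WU Wc Wm]] := IH q Uq _ qb okl.
  by move=> r rl; apply: Ul; right.
have mT := fan_triangle_measurable o a q.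
exists (fan_triangle o a q `|` W); split.
- exact: measurableU.
- by move=> z [|/WU //]; exact: fan_triangle_sub.
- move=> z [[h1 h2 _]|/Wc]; last exact: cone_right.
  by apply: (cone_left aq qb ab).
- rewrite mulrDl EFinD measureU //; first by apply: leeD => //; exact: fan_triangle_measure.
  apply/seteqP; split=> // z [[_ h1 _] /Wc[h2 _]].
  by move: h1 h2; rewrite /cross; lra.
Qed.

(** A cone with positive cross product spans less than a half turn, so a full turn takes at least
    three; the pivots [a], [b], [c] split the polygon into three chains in disjoint cones. *)
Lemma polygon_measure U o l1 l2 l3 a b c : measurable U ->
  segment_closed U -> U o ->
  (forall q, List.In q (a :: l1 ++ b :: l2 ++ c :: l3) -> U (translate o q)) ->
  0 < cross a b -> 0 < cross b c -> 0 < cross c a ->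
  chain_ok a l1 b -> chain_ok b l2 c -> chain_ok c l3 a ->
  (((chain_sum a l1 b + chain_sum b l2 c + chain_sum c l3 a) / 2)%:E <= mu U)%E.
Proof.
move=> mU cU Uo Ul ab bc ca k1 k2 k3.
have Ul' q : q = a \/ List.In q l1 \/ q = b \/ List.In q l2 \/ q = c \/ List.In q l3 ->
    U (translate o q).
  move=> h; apply: Ul => /=; rewrite List.in_app_iff /= List.in_app_iff /=.
  by move: h; intuition.
have Ua := Ul' a (or_introl erefl).
have Ub : U (translate o b) by apply: Ul'; intuition.
have Uc : U (translate o c) by apply: Ul'; intuition.
have [|W1 [m1 U1 c1 w1]] := chain_measure cU Uo Ua Ub _ ab k1.
  by move=> q ql; apply: Ul'; intuition.
have [|W2 [m2 U2 c2 w2]] := chain_measure cU Uo Ub Uc _ bc k2.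
  by move=> q ql; apply: Ul'; intuition.
have [|W3 [m3 U3 c3 w3]] := chain_measure cU Uo Uc Ua _ ca k3.
  by move=> q ql; apply: Ul'; intuition.
apply: (@le_trans _ _ (mu (W1 `|` W2 `|` W3))).
  rewrite measureU //; [|exact: measurableU|]; last first.
    apply/seteqP; split=> // z [[/c1[h1 h2]|/c2[h1 h2]] /c3[h3 h4]];
      by move: h1 h2 h3 h4; rewrite /cross; lra.
  rewrite measureU //; last first.
    by apply/seteqP; split=> // z [/c1[h1 h2] /c2[h3 h4]]; move: h2 h3; rewrite /cross; lra.
  by rewrite !mulrDl !EFinD; apply: leeD => //; apply: leeD.
apply: le_measure; rewrite ?inE //; first by apply: measurableU => //; exact: measurableU.
by move=> z [[/U1|/U2]|/U3].
Qed.
End polygon.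

(** * Integer certificates *)

Section Zembed.
Context {R : realType}.

(* Sealed, so that unification never unfolds the unary image of a large [Z]. *)
Fact zr_spec : {f : Z -> R | forall z, f z = (int_of_Z z)%:~R}.
Proof. by exists (fun z => (int_of_Z z)%:~R). Qed.

Definition zr : Z -> R := sval zr_spec.

Lemma zrE z : zr z = (int_of_Z z)%:~R.
Proof. exact: svalP zr_spec z. Qed.

Lemma zrD x y : zr (x + y)%Z = zr x + zr y.
Proof. by rewrite !zrE (_ : (x + y)%Z = (x : Z) + y)%R // rmorphD /= rmorphD. Qed.
Lemma zrN x : zr (- x)%Z = - zr x.
Proof. by rewrite !zrE (_ : (- x)%Z = (- (x : Z))%R) // rmorphN /= rmorphN. Qed.
Lemma zrM x y : zr (x * y)%Z = zr x * zr y.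
Proof. by rewrite !zrE (_ : (x * y)%Z = (x : Z) * y)%R // rmorphM /= rmorphM. Qed.
Lemma zrB x y : zr (x - y)%Z = zr x - zr y.
Proof. by rewrite -Z.add_opp_r zrD zrN. Qed.
Lemma zr_le x y : (x <=? y)%Z -> zr x <= zr y.
Proof. by move=> h; rewrite !zrE ler_int; lia. Qed.
Lemma zr_lt x y : (x <? y)%Z -> zr x < zr y.
Proof. by move=> h; rewrite !zrE ltr_int; lia. Qed.
Lemma zr0 : zr 0 = 0. Proof. by rewrite zrE. Qed.
Lemma zr1 : zr 1 = 1. Proof. by rewrite zrE. Qed.
Lemma zr_abs x : zr (Z.abs x) = `|zr x|.
Proof.
have [h|h] := Z.abs_spec x; case: h => h ->.
  by rewrite ger0_norm // -zr0; apply: zr_le; lia.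
by rewrite zrN ltr0_norm // -zr0; apply: zr_lt; lia.
Qed.
Lemma zr_ge0 x : (0 <=? x)%Z -> 0 <= zr x.
Proof. by rewrite -zr0; exact: zr_le. Qed.
Lemma zr_gt0 x : (0 <? x)%Z -> 0 < zr x.
Proof. by rewrite -zr0; exact: zr_lt. Qed.
Lemma zr_le0 x : (x <=? 0)%Z -> zr x <= 0.
Proof. by rewrite -zr0; exact: zr_le. Qed.
Lemma zr2 : zr 2 = 2. Proof. by rewrite zrE. Qed.
Lemma zr2000 : zr 2000 = zr 1000 * 2.
Proof. by rewrite -zr2 -zrM. Qed.
End Zembed.

(* The vertex [b + u m + e3 x + e5 z], where [u m] is [m] rotated by the unit
   vector [u]; a point of the disk, of the triangle or of the pentagon has
   [(m, e3, e5)] equal to [(0, 0, 0)], [(0, 1, 0)], or [b = 0] and [(e3, e5) = (0, 1)]. *)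
Record vertex := Vertex { bx : Z; by_ : Z; mx : Z; my : Z; e3 : Z; e5 : Z }.

(* Coefficients of 1, x1, x2, z1, z2 and of the cross product of [x] and [z]. *)
Record form := Form { k0 : Z; k1 : Z; k2 : Z; k3 : Z; k4 : Z; k5 : Z }.

Record uform := Uform { fpart : form; cpart : form; spart : form }.

Definition fzero := Form 0 0 0 0 0 0.
Definition fadd f g := Form (k0 f + k0 g) (k1 f + k1 g) (k2 f + k2 g)
  (k3 f + k3 g) (k4 f + k4 g) (k5 f + k5 g).
Definition fscale a f := Form (a * k0 f) (a * k1 f) (a * k2 f)
  (a * k3 f) (a * k4 f) (a * k5 f).
Definition uzero := Uform fzero fzero fzero.
Definition uadd f g := Uform (fadd (fpart f) (fpart g)) (fadd (cpart f) (cpart g))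
  (fadd (spart f) (spart g)).
Definition uscale a f := Uform (fscale a (fpart f)) (fscale a (cpart f))
  (fscale a (spart f)).

(* The products of two rotated parts are constant because [u] is a unit vector. *)
Definition vcross (v w : vertex) : uform :=
  Uform
    (Form (bx v * by_ w - by_ v * bx w + (mx v * my w - my v * mx w))
      (e3 v * by_ w - e3 w * by_ v) (e3 w * bx v - e3 v * bx w)
      (e5 v * by_ w - e5 w * by_ v) (e5 w * bx v - e5 v * bx w)
      (e3 v * e5 w - e5 v * e3 w))
    (Form (bx v * my w - by_ v * mx w + (mx v * by_ w - my v * bx w))
      (e3 v * my w - e3 w * my v) (e3 w * mx v - e3 v * mx w)
      (e5 v * my w - e5 w * my v) (e5 w * mx v - e5 v * mx w) 0)
    (Form (bx v * mx w + by_ v * my w - (my v * by_ w + mx v * bx w))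
      (e3 v * mx w - e3 w * mx v) (e3 v * my w - e3 w * my v)
      (e5 v * mx w - e5 w * mx v) (e5 v * my w - e5 w * my v) 0).

(* [|x| <= rad3], [|z| <= rad5] and [u] in the arc from [(uc0, us0)] to [(uc1, us1)]. *)
Record region := Region { rad3 : Z; rad5 : Z; uc0 : Z; us0 : Z; uc1 : Z; us1 : Z }.

(** Worst case of the nonconstant part of a form over the region: Cauchy-Schwarz for the
    coefficients of [x] and of [z], and |x| |z| for the cross product. Rounding the square roots up
    keeps the bound valid in integers. *)
Definition radius_term (r : region) f :=
  rad3 r * Z.sqrt_up (k1 f * k1 f + k2 f * k2 f)
  + rad5 r * Z.sqrt_up (k3 f * k3 f + k4 f * k4 f) + rad3 r * rad5 r * Z.abs (k5 f).
Definition lower r f := k0 f - radius_term r f.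
Definition upper r f := Z.abs (k0 f) + radius_term r f.

Definition upart0 r f := fadd (fscale (uc0 r) (cpart f)) (fscale (us0 r) (spart f)).
Definition upart1 r f := fadd (fscale (uc1 r) (cpart f)) (fscale (us1 r) (spart f)).

(* Points are given in units of 1 / 100000. *)
Definition scale : Z := 100000.

Definition region_ok r :=
  [&& (0 <=? rad3 r)%Z, (0 <=? rad5 r)%Z,
      (uc0 r * uc0 r + us0 r * us0 r <=? scale * scale)%Z,
      (uc1 r * uc1 r + us1 r * us1 r <=? scale * scale)%Z
    & (0 <? uc0 r * us1 r - us0 r * uc1 r)%Z].

(* The first two conditions make the part of [f] that depends on [u] nonnegative
   at the ends of the arc; this is needed to pass from the ends to the arc. *)
Definition at_least r f (m : Z) :=
  [&& (0 <=? lower r (upart0 r f))%Z, (0 <=? lower r (upart1 r f))%Z,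
      (m <=? lower r (fadd (fscale scale (fpart f)) (upart0 r f)))%Z
    & (m <=? lower r (fadd (fscale scale (fpart f)) (upart1 r f)))%Z].

(** The second test is meant for two pentagon vertices: the part of their cross product that depends
    on [u] has constant term 0, so its lower bound is negative for distinct points once [rad5 r] is
    positive, and [at_least] fails. There |c| <= 1 and |s| <= 1 are enough. *)
Definition turn_ok r v w :=
  let f := vcross v w in
  at_least r f 1 ||
  (upper r (cpart f) + upper r (spart f) <? lower r (fpart f))%Z.

Fixpoint vchain_ok r a l b :=
  if l is q :: l' then [&& turn_ok r a q, turn_ok r q b & vchain_ok r q l' b]
  else turn_ok r a b.

Fixpoint vchain_sum a l b :=
  if l is q :: l' then uadd (vcross a q) (vchain_sum q l' b) else vcross a b.

Record polygon := Polygon { pa : vertex; pl1 : list vertex; pb : vertex;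
  pl2 : list vertex; pc : vertex; pl3 : list vertex }.

Definition polygon_ok r p :=
  [&& turn_ok r (pa p) (pb p), turn_ok r (pb p) (pc p), turn_ok r (pc p) (pa p),
      vchain_ok r (pa p) (pl1 p) (pb p), vchain_ok r (pb p) (pl2 p) (pc p)
    & vchain_ok r (pc p) (pl3 p) (pa p)].

Definition polygon_sum p :=
  uadd (vchain_sum (pa p) (pl1 p) (pb p))
    (uadd (vchain_sum (pb p) (pl2 p) (pc p)) (vchain_sum (pc p) (pl3 p) (pa p))).

Definition vertices p := pa p :: pl1 p ++ pb p :: pl2 p ++ pc p :: pl3 p.

Fixpoint weighted (l : list (Z * polygon)) : uform :=
  if l is wp :: l' then uadd (uscale wp.1 (polygon_sum wp.2)) (weighted l') else uzero.
Fixpoint weight (l : list (Z * polygon)) : Z :=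
  if l is wp :: l' then (wp.1 + weight l')%Z else 0%Z.

(* The weighted sum of the doubled areas plus [e0 + e1 x1 + e2 x2] is at least
   2 * 0.834 times the total weight. *)
Definition certificate_ok r (e1 e2 e0 : Z) (l : list (Z * polygon)) :=
  [&& all (fun wp => (0 <=? wp.1)%Z && polygon_ok r wp.2) l
    & at_least r (uscale 1000 (uadd (weighted l) (Uform (Form e0 e1 e2 0 0 0) fzero fzero)))
        (1668 * scale * scale * scale * weight l)].

(* The only facts about the covering set that the certificates use; the
   disk has radius [d] and [A] is the area. *)
Definition good {R : realType} (V : set (R * R)) (A d : R) : Prop :=
  [/\ segment_closed V, (forall q, q.1 ^+ 2 + q.2 ^+ 2 <= d ^+ 2 -> V q) &
    forall a l1 b l2 c l3,
      (forall q, List.In q (a :: l1 ++ b :: l2 ++ c :: l3) -> V q) ->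
      0 < cross a b -> 0 < cross b c -> 0 < cross c a ->
      chain_ok a l1 b -> chain_ok b l2 c -> chain_ok c l3 a ->
      chain_sum a l1 b + chain_sum b l2 c + chain_sum c l3 a <= 2 * A].

(** * Soundness of the certificates *)

Section soundness.
Context {R : realType}.
Variables (x z : R * R) (c s : R) (r : region).
Hypothesis cs1 : c ^+ 2 + s ^+ 2 = 1.
Hypothesis rok : region_ok r.
Hypothesis xr : x.1 ^+ 2 + x.2 ^+ 2 <= zr (rad3 r) ^+ 2.
Hypothesis zr5 : z.1 ^+ 2 + z.2 ^+ 2 <= zr (rad5 r) ^+ 2.
Hypothesis u0 : 0 <= zr (uc0 r) * s - zr (us0 r) * c.
Hypothesis u1 : 0 <= c * zr (us1 r) - s * zr (uc1 r).

Definition vertex_pos (v : vertex) : R * R :=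
  (zr (bx v) + zr (mx v) * c - zr (my v) * s + zr (e3 v) * x.1 + zr (e5 v) * z.1,
   zr (by_ v) + zr (my v) * c + zr (mx v) * s + zr (e3 v) * x.2 + zr (e5 v) * z.2).

Definition form_eval (f : form) : R := zr (k0 f) + zr (k1 f) * x.1 + zr (k2 f) * x.2
  + zr (k3 f) * z.1 + zr (k4 f) * z.2 + zr (k5 f) * cross x z.

Definition uform_eval (f : uform) : R := form_eval (fpart f) + c * form_eval (cpart f) + s * form_eval (spart f).

Lemma evD f g : form_eval (fadd f g) = form_eval f + form_eval g.
Proof. by rewrite /form_eval /= !zrD; ring. Qed.
Lemma evZ a f : form_eval (fscale a f) = zr a * form_eval f.
Proof. by rewrite /form_eval /= !zrM; ring. Qed.
Lemma uevD f g : uform_eval (uadd f g) = uform_eval f + uform_eval g.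
Proof. by rewrite /uform_eval /= !evD; ring. Qed.
Lemma uevZ a f : uform_eval (uscale a f) = zr a * uform_eval f.
Proof. by rewrite /uform_eval /= !evZ; ring. Qed.
Lemma uev0 : uform_eval uzero = 0.
Proof. by rewrite /uform_eval /form_eval /= !zr0; ring. Qed.

Lemma vcrossE v w : cross (vertex_pos v) (vertex_pos w) = uform_eval (vcross v w).
Proof.
rewrite /uform_eval /form_eval /cross /vertex_pos /= !(zrB, zrD, zrM, zr0).
have e : c ^+ 2 = 1 - s ^+ 2 by rewrite -cs1; ring.
ring: e.
Qed.

Lemma sqrt_up_ge (n : Z) : (0 <= n)%Z -> zr n <= (zr (Z.sqrt_up n) : R) ^+ 2.
Proof.
move=> n0; rewrite expr2 -zrM; apply: zr_le; apply/Z.leb_le.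
have [->|np] : n = 0%Z \/ (0 < n)%Z by lia.
  by [].
by have := Z.sqrt_up_spec n np; lia.
Qed.

Lemma cauchy_schwarz (a b t1 t2 rho m : R) : 0 <= rho -> 0 <= m ->
  t1 ^+ 2 + t2 ^+ 2 <= rho ^+ 2 -> a ^+ 2 + b ^+ 2 <= m ^+ 2 ->
  `|a * t1 + b * t2| <= rho * m.
Proof.
move=> rho0 m0 h1 h2.
rewrite -[leRHS]ger0_norm ?mulr_ge0 // -ler_sqr ?nnegrE ?normr_ge0 // !real_normK ?num_real //.
rewrite exprMn; apply: (@le_trans _ _ ((t1 ^+ 2 + t2 ^+ 2) * (a ^+ 2 + b ^+ 2))).
  rewrite -subr_ge0 (_ : _ - _ = (a * t2 - b * t1) ^+ 2) ?sqr_ge0 //; ring.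
by apply: ler_pM => //; rewrite addr_ge0 // sqr_ge0.
Qed.

Lemma ev_radius f : `|form_eval f - zr (k0 f)| <= zr (radius_term r f).
Proof.
have /and5P[r30 r50 _ _ _] := rok.
have p3 : 0 <= zr (rad3 r) :> R by rewrite -zr0; apply: zr_le.
have p5 : 0 <= zr (rad5 r) :> R by rewrite -zr0; apply: zr_le.
have sq (a b : Z) : zr a ^+ 2 + zr b ^+ 2 <= (zr (Z.sqrt_up (a * a + b * b)) : R) ^+ 2.
  apply: le_trans (sqrt_up_ge _); last by nia.
  by rewrite zrD !zrM !expr2.
have sp (a : Z) : 0 <= zr (Z.sqrt_up a) :> R.
  by rewrite -zr0; apply: zr_le; apply/Z.leb_le; exact: Z.sqrt_up_nonneg.
have -> : form_eval f - zr (k0 f) = (zr (k1 f) * x.1 + zr (k2 f) * x.2)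
  + (zr (k3 f) * z.1 + zr (k4 f) * z.2) + zr (k5 f) * cross x z.
  by rewrite /form_eval; ring.
rewrite /radius_term !zrD !zrM zr_abs.
apply: (le_trans (ler_normD _ _)); apply: lerD.
  by apply: (le_trans (ler_normD _ _)); apply: lerD; apply: cauchy_schwarz.
rewrite normrM mulrC; apply: ler_wpM2r => //.
have -> : cross x z = x.1 * z.2 + (- x.2) * z.1 by rewrite /cross; ring.
rewrite [leRHS]mulrC; apply: cauchy_schwarz => //; last by rewrite sqrrN.
by rewrite addrC.
Qed.

Lemma lower_ev f : zr (lower r f) <= form_eval f.
Proof. by rewrite zrB; have := ev_radius f; rewrite ler_norml => /andP[]; lra. Qed.

Lemma upper_ev f : `|form_eval f| <= zr (upper r f).
Proof.
rewrite zrD zr_abs -[form_eval f](subrK (zr (k0 f))) addrC.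
by apply: (le_trans (ler_normD _ _)); apply: lerD => //; exact: ev_radius.
Qed.

(* [(c, s)] is a nonnegative combination of the two arc endpoints, with
   coefficients of sum at least 1 because the endpoints lie in the unit disk. *)
Lemma arc_combination : exists al be : R, [/\ 0 <= al, 0 <= be, 1 <= al + be,
  zr scale * c = al * zr (uc0 r) + be * zr (uc1 r) &
  zr scale * s = al * zr (us0 r) + be * zr (us1 r)].
Proof.
have /and5P[_ _ n0 n1 d0] := rok.
have S0 : 0 < zr scale :> R by rewrite -zr0; apply: zr_lt.
have {}d0 := zr_lt (R := R) d0; rewrite zrB !zrM zr0 in d0.
have {}n0 := zr_le (R := R) n0; rewrite zrD !zrM in n0.
have {}n1 := zr_le (R := R) n1; rewrite zrD !zrM in n1.
move: u0 u1 d0 n0 n1 S0.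
move: (zr (uc0 r)) (zr (us0 r)) (zr (uc1 r)) (zr (us1 r)) (zr scale) => a0 b0 a1 b1 T h0 h1 d0 n0 n1 T0.
pose D := a0 * b1 - b0 * a1.
have Dnz : D != 0 by rewrite gt_eqF.
pose al := T * (c * b1 - s * a1) / D; pose be := T * (a0 * s - b0 * c) / D.
have al0 : 0 <= al by rewrite divr_ge0 ?mulr_ge0 // ltW.
have be0 : 0 <= be by rewrite divr_ge0 ?mulr_ge0 // ltW.
have Ec : T * c = al * a0 + be * a1 by rewrite /al /be /D; field.
have Es : T * s = al * b0 + be * b1 by rewrite /al /be /D; field.
exists al, be; split => //.
(* The ends have norm at most [T]; were [al + be] less than 1, their combination would have norm
   below [T], while its norm is exactly [T]. *)
have TT : T ^+ 2 = (al * a0 + be * a1) ^+ 2 + (al * b0 + be * b1) ^+ 2.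
  by rewrite -Ec -Es !exprMn -mulrDr cs1 mulr1.
have ip : a0 * a1 + b0 * b1 <= T ^+ 2.
  by have := sqr_ge0 (a0 - a1); have := sqr_ge0 (b0 - b1); nra.
rewrite leNgt; apply/negP => lt1.
have : T ^+ 2 <= (al + be) ^+ 2 * T ^+ 2.
  rewrite {1}TT; have := sqr_ge0 al; have := sqr_ge0 be; have := mulr_ge0 al0 be0.
  nra.
rewrite ler_pMl ?exprn_gt0 // => h.
by have : (al + be) ^+ 2 < 1; [rewrite expr_lt1 // addr_ge0|rewrite ltNge h].
Qed.

(** For nonnegative [p] and [q], a combination with coefficient sum at least 1 is no smaller than
    their minimum. This is where the sign conditions of [at_least] enter. *)
Lemma arc_min (al be p q t m : R) : 0 <= al -> 0 <= be -> 1 <= al + be ->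
  0 <= p -> 0 <= q -> m <= t + p -> m <= t + q -> m <= t + (al * p + be * q).
Proof.
move=> al0 be0 ab p0 q0 mp mq; have [pq|/ltW pq] := leP p q.
  apply: (le_trans mp); rewrite lerD2l; apply: (@le_trans _ _ ((al + be) * p)).
    by rewrite ler_peMl.
  by rewrite mulrDl lerD2l ler_wpM2l.
apply: (le_trans mq); rewrite lerD2l; apply: (@le_trans _ _ ((al + be) * q)).
  by rewrite ler_peMl.
by rewrite mulrDl lerD2r ler_wpM2l.
Qed.

Lemma at_least_sound f m : at_least r f m -> zr m <= zr scale * uform_eval f.
Proof.
move=> /and4P[h0 h1 m0 m1].
have [al [be [al0 be0 ab Ec Es]]] := arc_combination.
have -> : zr scale * uform_eval f = zr scale * form_eval (fpart f)
    + (al * form_eval (upart0 r f) + be * form_eval (upart1 r f)).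
  have -> : zr scale * uform_eval f = zr scale * form_eval (fpart f) + (zr scale * c) * form_eval (cpart f)
      + (zr scale * s) * form_eval (spart f) by rewrite /uform_eval; ring.
  by rewrite Ec Es /upart0 /upart1 !evD !evZ; ring.
apply: arc_min => //.
- by apply: le_trans (lower_ev _); rewrite -zr0; apply: zr_le h0.
- by apply: le_trans (lower_ev _); rewrite -zr0; apply: zr_le h1.
- by rewrite -evZ -evD; apply: le_trans (lower_ev _); apply: zr_le m0.
- by rewrite -evZ -evD; apply: le_trans (lower_ev _); apply: zr_le m1.
Qed.

Lemma turn_sound v w : turn_ok r v w -> 0 < cross (vertex_pos v) (vertex_pos w).
Proof.
have S0 : 0 < zr scale :> R by rewrite -zr0; apply: zr_lt.
rewrite /turn_ok vcrossE; move: (vcross v w) => f /orP[/at_least_sound h|].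
  by rewrite -(pmulr_rgt0 _ S0); apply: lt_le_trans h; rewrite zr1.
move=> /(zr_lt (R := R)); rewrite zrD => h.
have hc : `|c * form_eval (cpart f)| <= zr (upper r (cpart f)).
  rewrite normrM; apply: le_trans (upper_ev _); rewrite ler_piMl //.
  by rewrite -(@expr_le1 _ 2) ?normr_ge0 // real_normK ?num_real // -cs1 lerDl sqr_ge0.
have hs : `|s * form_eval (spart f)| <= zr (upper r (spart f)).
  rewrite normrM; apply: le_trans (upper_ev _); rewrite ler_piMl //.
  by rewrite -(@expr_le1 _ 2) ?normr_ge0 // real_normK ?num_real // -cs1 lerDr sqr_ge0.
have hf := lower_ev (fpart f).
move: hc hs; rewrite !ler_norml => /andP[hc _] /andP[hs _].
by rewrite /uform_eval; lra.
Qed.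

Lemma vchain_sound a l b : vchain_ok r a l b -> chain_ok (vertex_pos a) (map vertex_pos l) (vertex_pos b).
Proof.
elim: l a => [|q l IH] a /=; first exact: turn_sound.
by move=> /and3P[h1 h2 /IH h3]; split => //; exact: turn_sound.
Qed.

Lemma vchain_sumE a l b : chain_sum (vertex_pos a) (map vertex_pos l) (vertex_pos b) = uform_eval (vchain_sum a l b).
Proof.
elim: l a => [|q l IH] a /=; first exact: vcrossE.
by rewrite uevD IH vcrossE.
Qed.

Variables (V : set (R * R)) (A d : R).
Hypothesis gV : good V A d.

Lemma polygon_sound p : polygon_ok r p ->
  (forall v, List.In v (vertices p) -> V (vertex_pos v)) -> uform_eval (polygon_sum p) <= 2 * A.
Proof.
move=> /and5P[t1 t2 t3 c1 /andP[c2 c3]] hV; have [_ _ h] := gV.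
rewrite /polygon_sum !uevD -!vchain_sumE addrA; apply: h; last 3 first.
- exact: vchain_sound.
- exact: vchain_sound.
- exact: vchain_sound.
- move=> q hq; suff [v [<- hv]] : exists v, vertex_pos v = q /\ List.In v (vertices p) by exact: hV.
  by apply/List.in_map_iff; rewrite /vertices /= !(List.map_app, map_cat) /= !(List.map_app, map_cat).
- exact: turn_sound.
- exact: turn_sound.
- exact: turn_sound.
Qed.

Lemma weighted_sound (l : list (Z * polygon)) :
  all (fun wp => (0 <=? wp.1)%Z && polygon_ok r wp.2) l ->
  (forall wp, List.In wp l -> forall v, List.In v (vertices wp.2) -> V (vertex_pos v)) ->
  uform_eval (weighted l) <= zr (weight l) * (2 * A).
Proof.
elim: l => [|wp l IH] /=; first by rewrite uev0 zr0 mul0r.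
move=> /andP[/andP[w0 pok] lok] hV; rewrite uevD uevZ zrD mulrDl; apply: lerD.
  apply: ler_wpM2l; first by rewrite -zr0; apply: zr_le.
  by apply: polygon_sound => //; apply: hV; left.
by apply: IH => // wp' h; apply: hV; right.
Qed.

(** Weak duality of the linear program: each polygon contributes at most its weight times [2 * A],
    while the weighted sum together with the correction term was checked to be large on the whole
    region. *)
Lemma certificate_sound e1 e2 e0 (l : list (Z * polygon)) : certificate_ok r e1 e2 e0 l ->
  (forall wp, List.In wp l -> forall v, List.In v (vertices wp.2) -> V (vertex_pos v)) ->
  zr 1668 * zr scale ^+ 2 * zr (weight l) <=
    zr 1000 * (zr (weight l) * (2 * A) + (zr e0 + zr e1 * x.1 + zr e2 * x.2)).
Proof.
move=> /andP[lok /at_least_sound h] hV.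
have S0 : 0 < zr scale :> R by rewrite -zr0; apply: zr_lt.
rewrite -(ler_pM2l S0).
apply: (@le_trans _ _ (zr scale * (zr 1000 *
    (uform_eval (weighted l) + (zr e0 + zr e1 * x.1 + zr e2 * x.2))))); last first.
  apply: ler_wpM2l; first exact: ltW.
  apply: ler_wpM2l; first by rewrite -zr0; apply: zr_le.
  by rewrite lerD2r; exact: weighted_sound lok hV.
have -> : zr e0 + zr e1 * x.1 + zr e2 * x.2 = uform_eval (Uform (Form e0 e1 e2 0 0 0) fzero fzero).
  by rewrite /uform_eval /form_eval /= !zr0; ring.
rewrite -uevD -uevZ; apply: le_trans h; rewrite !zrM.
by rewrite le_eqVlt; apply/orP; left; apply/eqP; ring.
Qed.
End soundness.

(** * Boundary points of the bodies and the polygons of the certificates *)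

Definition disk_table : list (Z * Z) :=
  [:: (50000, 0); (49969, 1745); (49878, 3488); (49726, 5226); (49513, 6959); (49240, 8682); (48907,
  10396); (48514, 12096); (48063, 13782); (47552, 15451); (46984, 17101); (46359, 18730); (45677,
  20337); (44939, 21918); (44147, 23474); (43301, 25000); (42402, 26496); (41452, 27959); (40451,
  29389); (39400, 30783); (38302, 32139); (37157, 33456); (35966, 34732); (34732, 35966); (33456,
  37157); (32139, 38302); (30783, 39400); (29389, 40451); (27959, 41452); (26496, 42402); (25000,
  43301); (23474, 44147); (21918, 44939); (20337, 45677); (18730, 46359); (17101, 46984); (15451,
  47552); (13782, 48063); (12096, 48514); (10396, 48907); (8682, 49240); (6959, 49513); (5226, 49726);
  (3488, 49878); (1745, 49969); (0, 50000); (-1745, 49969); (-3488, 49878); (-5226, 49726); (-6959,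
  49513); (-8682, 49240); (-10396, 48907); (-12096, 48514); (-13782, 48063); (-15451, 47552); (-17101,
  46984); (-18730, 46359); (-20337, 45677); (-21918, 44939); (-23474, 44147); (-25000, 43301);
  (-26496, 42402); (-27959, 41452); (-29389, 40451); (-30783, 39400); (-32139, 38302); (-33456,
  37157); (-34732, 35966); (-35966, 34732); (-37157, 33456); (-38302, 32139); (-39400, 30783);
  (-40451, 29389); (-41452, 27959); (-42402, 26496); (-43301, 25000); (-44147, 23474); (-44939,
  21918); (-45677, 20337); (-46359, 18730); (-46984, 17101); (-47552, 15451); (-48063, 13782);
  (-48514, 12096); (-48907, 10396); (-49240, 8682); (-49513, 6959); (-49726, 5226); (-49878, 3488);
  (-49969, 1745); (-50000, 0); (-49969, -1745); (-49878, -3488); (-49726, -5226); (-49513, -6959);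
  (-49240, -8682); (-48907, -10396); (-48514, -12096); (-48063, -13782); (-47552, -15451); (-46984,
  -17101); (-46359, -18730); (-45677, -20337); (-44939, -21918); (-44147, -23474); (-43301, -25000);
  (-42402, -26496); (-41452, -27959); (-40451, -29389); (-39400, -30783); (-38302, -32139); (-37157,
  -33456); (-35966, -34732); (-34732, -35966); (-33456, -37157); (-32139, -38302); (-30783, -39400);
  (-29389, -40451); (-27959, -41452); (-26496, -42402); (-25000, -43301); (-23474, -44147); (-21918,
  -44939); (-20337, -45677); (-18730, -46359); (-17101, -46984); (-15451, -47552); (-13782, -48063);
  (-12096, -48514); (-10396, -48907); (-8682, -49240); (-6959, -49513); (-5226, -49726); (-3488,
  -49878); (-1745, -49969); (0, -50000); (1745, -49969); (3488, -49878); (5226, -49726); (6959,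
  -49513); (8682, -49240); (10396, -48907); (12096, -48514); (13782, -48063); (15451, -47552); (17101,
  -46984); (18730, -46359); (20337, -45677); (21918, -44939); (23474, -44147); (25000, -43301);
  (26496, -42402); (27959, -41452); (29389, -40451); (30783, -39400); (32139, -38302); (33456,
  -37157); (34732, -35966); (35966, -34732); (37157, -33456); (38302, -32139); (39400, -30783);
  (40451, -29389); (41452, -27959); (42402, -26496); (43301, -25000); (44147, -23474); (44939,
  -21918); (45677, -20337); (46359, -18730); (46984, -17101); (47552, -15451); (48063, -13782);
  (48514, -12096); (48907, -10396); (49240, -8682); (49513, -6959); (49726, -5226); (49878, -3488);
  (49969, -1745)]%Z.

(** Like the points of the disk, these follow each other at steps of 2 degrees, measured on each arc
    from the corner at its centre, and are rounded inwards. An arc of the triangle spans 60 degrees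
    and an arc of the pentagon 36, so the corners have indices 0, 30, 60 here and 0, 18, 36, 54, 72
    in the next table. *)
Definition triangle_table : list (Z * Z) :=
  [:: (57734, 0); (55936, 2992); (54035, 5919); (52034, 8778); (49933, 11566); (47736, 14279); (45446,
  16913); (43066, 19465); (40597, 21933); (38045, 24314); (35411, 26604); (32698, 28801); (29911,
  30901); (27052, 32903); (24124, 34804); (21132, 36602); (18079, 38294); (14969, 39879); (11806,
  41354); (8593, 42718); (5334, 43969); (2034, 45105); (-1304, 46126); (-4675, 47029); (-8076, 47814);
  (-11503, 48480); (-14950, 49026); (-18415, 49452); (-21892, 49756); (-25378, 49939); (-28867,
  49999); (-30559, 46946); (-32143, 43836); (-33619, 40672); (-34982, 37460); (-36233, 34201);
  (-37369, 30901); (-38390, 27563); (-39293, 24192); (-40078, 20791); (-40744, 17364); (-41290,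
  13917); (-41716, 10453); (-42020, 6975); (-42203, 3490); (-42264, 0); (-42203, -3490); (-42020,
  -6975); (-41716, -10453); (-41290, -13917); (-40744, -17364); (-40078, -20791); (-39293, -24192);
  (-38390, -27563); (-37369, -30901); (-36233, -34201); (-34982, -37460); (-33619, -40672); (-32143,
  -43836); (-30559, -46946); (-28867, -49999); (-25378, -49939); (-21892, -49756); (-18415, -49452);
  (-14950, -49026); (-11503, -48480); (-8076, -47814); (-4675, -47029); (-1304, -46126); (2034,
  -45105); (5334, -43969); (8593, -42718); (11806, -41354); (14969, -39879); (18079, -38294); (21132,
  -36602); (24124, -34804); (27052, -32903); (29911, -30901); (32698, -28801); (35411, -26604);
  (38045, -24314); (40597, -21933); (43066, -19465); (45446, -16913); (47736, -14279); (49933,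
  -11566); (52034, -8778); (54035, -5919); (55936, -2992)]%Z.

Definition pentagon_table : list (Z * Z) :=
  [:: (52572, 0); (51436, 3300); (50185, 6559); (48821, 9772); (47346, 12935); (45761, 16045); (44069,
  19098); (42271, 22090); (40370, 25017); (38369, 27876); (36268, 30664); (34071, 33377); (31781,
  36011); (29401, 38563); (26933, 41031); (24380, 43412); (21746, 45702); (19033, 47899); (16246,
  49999); (12756, 49939); (9270, 49756); (5793, 49452); (2329, 49026); (-1119, 48480); (-4545, 47814);
  (-7946, 47029); (-11318, 46126); (-14656, 45105); (-17956, 43969); (-21215, 42718); (-24428, 41354);
  (-27591, 39879); (-30701, 38294); (-33754, 36602); (-36746, 34804); (-39673, 32903); (-42531,
  30901); (-43552, 27563); (-44455, 24192); (-45240, 20791); (-45906, 17364); (-46452, 13917);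
  (-46878, 10453); (-47182, 6976); (-47365, 3490); (-47426, 0); (-47365, -3490); (-47182, -6976);
  (-46878, -10453); (-46452, -13917); (-45906, -17364); (-45240, -20791); (-44455, -24192); (-43552,
  -27563); (-42531, -30901); (-39673, -32903); (-36746, -34804); (-33754, -36602); (-30701, -38294);
  (-27591, -39879); (-24428, -41354); (-21215, -42718); (-17956, -43969); (-14656, -45105); (-11318,
  -46126); (-7946, -47029); (-4545, -47814); (-1119, -48480); (2329, -49026); (5793, -49452); (9270,
  -49756); (12756, -49939); (16246, -49999); (19033, -47899); (21746, -45702); (24380, -43412);
  (26933, -41031); (29401, -38563); (31781, -36011); (34071, -33377); (36268, -30664); (38369,
  -27876); (40370, -25017); (42271, -22090); (44069, -19098); (45761, -16045); (47346, -12935);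
  (48821, -9772); (50185, -6559); (51436, -3300)]%Z.

(** A single polygon: the circle points from 38 to 322 degrees, closed up by one point on the
    positive first axis, entry 0 of a one-element table. *)
Definition point_certificate : list (Z * (list Z * list Z * list Z)) :=
  [:: (1, ([:: 19041], [:: 60060], [:: 120042; 1000001]))]%Z.

(** A round consists of eight certificates, in the order in which [round_ok] lists its directions:
    the four along the axes, then the four diagonal ones. *)
Definition triangle_round1 : list (list (Z * (list Z * list Z * list Z))) :=
  [:: [:: (23094, ([:: 1000001; 30030], [:: 60060], [:: 120031]))]; [:: (4114, ([:: 39; 1030001], [:: 82001; 1054006],
  [:: 1060009; 165015])); (39431, ([:: 22014; 1029004], [:: 89001; 1057004], [:: 142017; 1000001]))]; [:: (6118,
  ([:: 38001; 1030001], [:: 82017; 1060001], [:: 142014; 1089008])); (16411, ([:: 22001; 1024006], [:: 1030009;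
  105015], [:: 120039; 1000001]))]; [:: (32752, ([:: 22017; 1030001], [:: 82014; 1059008], [:: 158001; 1000001]));
  (5910, ([:: 60], [:: 60031], [:: 1060001; 150030]))]; [:: (54785, ([:: 38001; 1030001], [:: 82017; 1060001], [:: 142014;
  1089008])); (2962, ([:: 22001; 1024006], [:: 1030009; 105015], [:: 120039; 1000001]))]; [:: (17495, ([:: 1003006;
  45019], [:: 64035; 1060001], [:: 142001; 1084009])); (26172, ([:: 22017; 1030001], [:: 82014; 1059008], [:: 158001;
  1000001]))]; [:: (22594, ([:: 22014; 1029004], [:: 89001; 1057004], [:: 142017; 1000001])); (24552, ([:: 31],
  [:: 1030001; 90030], [:: 120060]))]; [:: (16940, ([:: 39; 1030001], [:: 82001; 1054006], [:: 1060009; 165015]));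
  (11473, ([:: 60], [:: 60031], [:: 1060001; 150030]))]]%Z.

Definition triangle_round2 : list (list (Z * (list Z * list Z * list Z))) :=
  [:: [:: (33564, ([:: 22024; 1030001], [:: 71039; 1060001], [:: 135024; 1085011]))]; [:: (14650, ([:: 11035; 1030006],
  [:: 82016; 1055006], [:: 135035; 1000001])); (14650, ([:: 11035; 1030006], [:: 83016; 1055006], [:: 135035;
  1000001]))]; [:: (22735, ([:: 18019; 1024010], [:: 79030; 1060001], [:: 131039; 1000004])); (7654, ([:: 18019;
  1024011], [:: 79030; 1060001], [:: 131039; 1000004]))]; [:: (22735, ([:: 11039; 1030001], [:: 72030; 1057010],
  [:: 144019; 1087004])); (7654, ([:: 11039; 1030001], [:: 72030; 1056011], [:: 144019; 1087004]))]; [:: (34638,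
  ([:: 24018; 1026005], [:: 73037; 1060001], [:: 131033; 1088009])); (7267, ([:: 24016; 1026005], [:: 74036;
  1060001], [:: 131034; 1089008]))]; [:: (34638, ([:: 17033; 1030001], [:: 71037; 1060005], [:: 139018; 1084009]));
  (7267, ([:: 16034; 1030001], [:: 71036; 1060005], [:: 141016; 1084008]))]; [:: (16643, ([:: 13029; 1026010],
  [:: 83021; 1058003], [:: 131039; 1000001])); (33500, ([:: 14027; 1026010], [:: 82023; 1059002], [:: 131039;
  1000001]))]; [:: (16643, ([:: 11039; 1030003], [:: 77021; 1055010], [:: 139029; 1000001])); (33500, ([:: 11039;
  1030002], [:: 76023; 1055010], [:: 140027; 1000001]))]]%Z.

Definition pentagon_round1 : list (list (Z * (list Z * list Z * list Z))) :=
  [:: [:: (22652, ([:: 31033], [:: 64060], [:: 124026; 1000001]))]; [:: (14000, ([:: 60], [:: 60018; 1054001], [:: 139041]));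
  (14000, ([:: 41], [:: 41001; 1036001; 103017], [:: 120060]))]; [:: (19269, ([:: 6; 1018001], [:: 67053], [:: 120060]));
  (7360, ([:: 41], [:: 41001; 1036001; 103017], [:: 120060]))]; [:: (19269, ([:: 60], [:: 60053], [:: 113001; 1072001;
  175005])); (7360, ([:: 60], [:: 60018; 1054001], [:: 139041]))]; [:: (15292, ([:: 31033], [:: 64060], [:: 124026;
  1000001])); (23817, ([:: 6; 1018001], [:: 67053], [:: 120060]))]; [:: (15292, ([:: 31033], [:: 64060], [:: 124026;
  1000001])); (23817, ([:: 60], [:: 60053], [:: 113001; 1072001; 175005]))]; [:: (30012, ([:: 41], [:: 41001; 1036001;
  103017], [:: 120060])); (5269, ([:: 6; 1018001], [:: 67053], [:: 120060]))]; [:: (30012, ([:: 60], [:: 60018; 1054001],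
  [:: 139041])); (5269, ([:: 60], [:: 60053], [:: 113001; 1072001; 175005]))]]%Z.

Definition pentagon_round2 : list (list (Z * (list Z * list Z * list Z))) :=
  [:: [:: (10111, ([:: 1000019; 51009], [:: 60060], [:: 120010; 1072018]))]; [:: (6249, ([:: 57], [:: 57001; 1036024],
  [:: 1060013; 159021])); (6249, ([:: 22; 1018012], [:: 1030025], [:: 123057]))]; [:: (8618, ([:: 1010029], [:: 92048],
  [:: 140026; 1000010])); (2746, ([:: 15; 1015015], [:: 1030025], [:: 123057]))]; [:: (8618, ([:: 15049], [:: 64025;
  1052010], [:: 1062029])); (2746, ([:: 57], [:: 57001; 1036024], [:: 1060016; 166014]))]; [:: (5925, ([:: 1000019;
  51009], [:: 60060], [:: 120010; 1072018])); (11065, ([:: 1008029], [:: 87049], [:: 136025; 1088010]))]; [:: (5925,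
  ([:: 1000019; 51009], [:: 60060], [:: 120010; 1072018])); (11065, ([:: 20048], [:: 68026; 1054010], [:: 1064029]))];
  [:: (14172, ([:: 15; 1015015], [:: 1030025], [:: 123057])); (725, ([:: 1010029], [:: 92048], [:: 140026; 1000010]))];
  [:: (14172, ([:: 57], [:: 57001; 1036024], [:: 1060016; 166014])); (725, ([:: 15049], [:: 64025; 1052010],
  [:: 1062029]))]]%Z.

Definition pentagon_round3 : list (list (Z * (list Z * list Z * list Z))) :=
  [:: [:: (10000, ([:: 1000019; 45015], [:: 60060], [:: 120016; 1072018]))]; [:: (12123, ([:: 32; 1018001; 45010], [:: 55001;
  1030031], [:: 125011; 1072001; 149031]))]; [:: (2735, ([:: 1012028], [:: 84060], [:: 144031; 1000012])); (8512,
  ([:: 12004; 1010032], [:: 87016; 1054001; 113011], [:: 124052; 1000004]))]; [:: (2735, ([:: 8060], [:: 68029;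
  1051013], [:: 1064027; 6002])); (8512, ([:: 5059], [:: 64004; 1036001; 78016; 1049013], [:: 1062019; 165004;
  1087004]))]; [:: (8966, ([:: 165001; 1085031; 55005], [:: 60003; 1035002; 77043], [:: 120020; 1072001;
  152013])); (7872, ([:: 165001; 1085032; 57003], [:: 60002; 1034003; 77043], [:: 120020; 1072001; 151014]))];
  [:: (8966, ([:: 15014; 1018001; 41019], [:: 60044; 1054002; 118002], [:: 120006; 1065031])); (7872, ([:: 15015;
  1018001; 41019], [:: 60044; 1054003; 119001], [:: 120004; 1064032]))]; [:: (13646, ([:: 23; 1014016], [:: 1030025;
  113007], [:: 120060])); (594, ([:: 175001; 1000001; 6016; 1013017], [:: 1030015; 93004; 1051004; 113007],
  [:: 120055]))]; [:: (13646, ([:: 60], [:: 60008; 1036024], [:: 1060017; 158022])); (594, ([:: 5055], [:: 60008; 1036004;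
  84004; 1046014], [:: 1060018; 159016; 1000001]))]]%Z.

(** Each entry holds the end of an arc, which is also the start of the next one. The twenty arcs of
    about 1.2 degrees run from -12.02 to 12.02 degrees and thus slightly overshoot pi / 15, which is
    12 degrees. *)
Definition arcs : list ((Z * Z) * list (Z * (list Z * list Z * list Z))) :=
  [:: ((98222, -18769), [:: (4317, ([:: 166001; 1000002; 16002; 2014009; 43002; 1029002], [:: 75021], [:: 96001;
  2054001; 1060001; 2072001; 145021])); (1414, ([:: 166001; 1000002; 16002; 2014009; 43002; 1029002],
  [:: 75022; 2054001; 1060001], [:: 134001; 2072001; 145021])); (622, ([:: 16002; 2014007; 42002; 1028004],
  [:: 76023; 2054001; 1060001; 2072001], [:: 147018; 2088001; 1000002])); (1036, ([:: 16002; 2014009; 43002;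
  1029002], [:: 75022; 2054001; 1060001; 2072001], [:: 145021; 1000002])); (1018, ([:: 16003; 2015008; 43002;
  1029002; 2037001], [:: 76020; 2054001], [:: 107001; 1060001; 2072001; 144022; 1000002])); (1592, ([:: 16001;
  2013010; 43002; 1029002], [:: 75023; 2054001; 1060001; 2072001], [:: 145021; 1000002]))]); ((98595,
  -16704), [:: (808, ([:: 16004; 2015007; 43001; 1028003], [:: 76021; 2054001; 1060001], [:: 133001; 2072001;
  145022; 1000002])); (3112, ([:: 15004; 2014009; 44001; 1029002], [:: 76021; 2054001; 1060001; 2072001],
  [:: 145022; 1000001])); (289, ([:: 164001; 1089004; 17003; 2015009], [:: 45001; 1030001; 2037003; 79016;
  2054001; 1060001], [:: 134001; 2072001; 143021])); (338, ([:: 16004; 2015007; 43001; 1028003], [:: 76021;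
  2054001; 107001; 1060001], [:: 133001; 2072001; 145022; 1000002])); (808, ([:: 17002; 2014008; 43001;
  1028003], [:: 75024; 2054001; 107001; 1060001; 2072001], [:: 147019; 1000003])); (4646, ([:: 16002; 2014009;
  44001; 1029002], [:: 75024; 2054001; 1060001; 2072001], [:: 146020; 1000002]))]); ((98923, -14632),
  [:: (1684, ([:: 16003; 2014008; 43001; 1028003], [:: 75024; 2054001; 1060001], [:: 133002; 2072001; 147019;
  1000002])); (1528, ([:: 15004; 2014010; 46001; 1030001; 2037001], [:: 78019; 2054001; 1060002; 2072001],
  [:: 144021; 1089002])); (3234, ([:: 167001; 1000002; 16003; 2014007; 43001; 1028004], [:: 76023], [:: 99001;
  2054001; 1060001; 2072001; 149018])); (2377, ([:: 15003; 2013009; 44001; 1029002], [:: 75025; 2054001;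
  1060001; 2072001], [:: 147019; 1000001])); (511, ([:: 166001; 1000002; 16003; 2014008; 44001; 1029002],
  [:: 75024; 2054001; 1060001], [:: 133002; 2072001; 147019])); (667, ([:: 167001; 1000002; 16003; 2014007;
  43001; 1028004], [:: 76030], [:: 106001; 1060001; 2072001; 149018]))]); ((99208, -12554), [:: (547, ([:: 16004;
  2014008; 44001; 1029002; 2036001], [:: 76031; 1060001], [:: 134001; 2072001; 148019; 1000002])); (4364,
  ([:: 16003; 2013008; 43001; 1029003], [:: 76025; 2054001; 1060001; 2072001], [:: 149017; 1000001])); (1466,
  ([:: 15004; 2013008; 43002; 1029003], [:: 76025; 2054001; 1060001; 2072001], [:: 149017; 1000001])); (851,
  ([:: 15004; 2013008; 43001; 1029003], [:: 76025; 2054001; 1060001; 2072001], [:: 149017; 1000001])); (2225,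
  ([:: 16004; 2014008; 44001; 1029002; 2036001], [:: 76024; 2054001; 1060001], [:: 134001; 2072001; 148019;
  1000002])); (547, ([:: 16004; 2014007; 43001; 1028004], [:: 76025; 2054001; 1060001], [:: 133002; 2072001;
  149018; 1000002]))]); ((99450, -10470), [:: (1891, ([:: 168001; 1000002; 16005; 2014006; 43001; 1028004],
  [:: 76024], [:: 100001; 2054001; 1060001; 2072002; 151017])); (1336, ([:: 16005; 2014006; 43001; 1028004],
  [:: 76025; 2054001; 1060001; 2072002], [:: 151015; 2087001; 1000002])); (1099, ([:: 15005; 2014007; 1029003],
  [:: 76025; 2054001; 1060001], [:: 133002; 2072001; 150017; 1000001])); (1194, ([:: 15005; 2014007; 44001;
  1029003], [:: 76025; 2054001; 1060001], [:: 133002; 2072001; 150017; 1000001])); (979, ([:: 14005; 2013009],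
  [:: 45001; 1030001; 2036001; 76029], [:: 105001; 1060001; 2072001; 149018; 1000001])); (2769, ([:: 14005;
  2013009; 45001; 1030001; 2036001], [:: 76025; 2054001; 1060001; 2072001], [:: 149018; 1000001])); (732,
  ([:: 16005; 2014006; 43001; 1028003; 2036001], [:: 76025; 2054001; 1060001], [:: 133002; 2072001; 150017;
  1000002]))]); ((99648, -8382), [:: (670, ([:: 14006; 2013009; 45001; 1030002; 2036001], [:: 77028; 1059002],
  [:: 135001; 2072001; 150017; 1000001])); (507, ([:: 15006; 2014007; 44001; 1029003], [:: 76030; 1060001;
  2072001], [:: 151016; 1000001])); (5479, ([:: 15006; 2014007; 44001; 1029003], [:: 76026; 2054001; 1060001;
  2072001], [:: 151016; 1000001])); (782, ([:: 16005; 2014006; 1029002; 2036001], [:: 77025; 2054001; 1060001],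
  [:: 133003; 2072001; 151016; 1000002])); (2132, ([:: 166001; 1000002; 16005; 2014006], [:: 44001; 1029002;
  2036001; 77025; 2054001; 1060001], [:: 133003; 2072001; 151015])); (396, ([:: 15005; 2013008; 44001;
  1029003], [:: 76026; 2054001; 1060001; 2072002], [:: 151015; 2087001; 1000001])); (34, ([:: 15006; 2014007;
  44001; 1029003], [:: 76030; 1060001], [:: 134001; 2072001; 151016; 1000001]))]); ((99801, -6290), [:: (2105,
  ([:: 166001; 1000002; 16006; 2014006], [:: 44001; 1029002; 2036001; 77025; 2054001; 1060001], [:: 133003;
  2072001; 151015])); (12, ([:: 167001; 1000001; 15007; 2014006; 1029004], [:: 76030; 1060001], [:: 134001;
  2072002; 151016])); (4595, ([:: 167001; 1000001; 14008; 2014005; 43002], [:: 45001; 1030002; 76025],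
  [:: 101001; 2054001; 1060001; 2072004; 154013])); (459, ([:: 15007; 2014006; 1029004], [:: 76030; 1060001],
  [:: 134001; 2072002; 151016; 1000001])); (1650, ([:: 13009; 2014007; 45001; 1030002; 2036001], [:: 78027;
  1059002], [:: 135001; 2072001; 150018; 1000001])); (63, ([:: 167001; 1000001; 15007; 2014006; 44001;
  1029004], [:: 76026; 2054001; 1060001], [:: 134001; 2072002; 151016])); (1116, ([:: 16006; 2014006; 1029002;
  2036001], [:: 77025; 2054001; 1060001], [:: 133003; 2072001; 151016; 1000002]))]); ((99911, -4195), [:: (404,
  ([:: 16007; 2014005; 1029002; 2036001], [:: 78025; 2054001; 1060001], [:: 133004; 2072001; 152015;
  1000002])); (2870, ([:: 166001; 1000002; 16007; 2014005], [:: 44001; 1029002; 2036001; 78025; 2054001;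
  1060001], [:: 133004; 2072001; 152014])); (3260, ([:: 14008; 2014006; 45001; 1030002], [:: 76027; 2054001;
  1060001; 2072002], [:: 153014; 1000001])); (1409, ([:: 14008; 2014006], [:: 45001; 1030002; 76029], [:: 105001;
  1060001; 2072002; 153014; 1000001])); (49, ([:: 15012; 2018001; 44002; 1030001; 2036001], [:: 80019;
  2054001; 1060001; 2072001], [:: 152014; 1000001])); (740, ([:: 13009; 2014007; 45002; 1030002; 2036001],
  [:: 78026; 1058004; 2072001], [:: 152016; 1000001])); (1267, ([:: 14010; 2015004; 1029004], [:: 77025; 2054001;
  1060001], [:: 134001; 2072002; 153015; 1000001]))]); ((99977, -2098), [:: (1877, ([:: 14010; 2015004;
  1030003; 2036001], [:: 77026; 2054001; 1059002], [:: 135001; 2072003; 154014; 1000001])); (244, ([:: 14010;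
  2015004; 1029004], [:: 77026; 2054001; 1060001], [:: 134001; 2072003; 154013; 2086001; 1000001])); (19,
  ([:: 14010; 2015004; 1029004], [:: 77026; 2054001; 1060001], [:: 134001; 2072004; 155013; 1000001])); (2103,
  ([:: 167001; 1000001; 14009; 2014005; 44001], [:: 45001; 1030002; 76027], [:: 103001; 2054001; 1060001;
  2072004; 155012])); (22, ([:: 14010; 2015004; 1029004], [:: 77026; 2054001; 1060001], [:: 134001; 2072004;
  155012; 2086001; 1000001])); (3462, ([:: 15008; 2014006; 45001; 1030001; 2036001], [:: 76028; 2054001;
  1060001; 2072003], [:: 154012; 1000001])); (374, ([:: 14010; 2015004; 44001; 1029004], [:: 77026; 2054001;
  1060001], [:: 134001; 2072004; 155012; 2086001; 1000001])); (1899, ([:: 14010; 2015004; 1030003; 2036001],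
  [:: 77028; 1059002], [:: 135001; 2072003; 154014; 1000001]))]); ((100000, 0), [:: (112, ([:: 168001; 1000001;
  13013; 2016003], [:: 45001; 1030003; 2036001; 78023], [:: 101001; 2054001; 1059002; 2072003; 154014]));
  (348, ([:: 15009; 2015004; 45001; 1030001; 2036001], [:: 76028; 2054001; 1060001; 2072004], [:: 155011;
  1000001])); (2110, ([:: 14010; 2015004; 44002; 1030002], [:: 76028; 2054001; 1059002; 2072004], [:: 156011;
  1000001])); (2858, ([:: 14010; 2015004; 1030002; 2036001], [:: 77027; 2054001; 1059002], [:: 135001; 2072003;
  155012; 1000001])); (190, ([:: 14010; 2015004; 44002; 1030002], [:: 76028; 2054001; 1059002; 2072004],
  [:: 156010; 2085002; 1000001])); (1811, ([:: 14010; 2015004; 1030002; 2036001], [:: 76028; 2054001; 1060001],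
  [:: 135001; 2072004; 155012; 1000001])); (2200, ([:: 14011; 2015004; 45001; 1030002; 2036001], [:: 76029;
  1059002; 2072004], [:: 156011; 1000001])); (371, ([:: 14010; 2015004; 45001; 1030002; 2036001], [:: 76028;
  2054001; 1060001], [:: 135001; 2072004; 155012; 1000001]))]); ((99977, 2098), [:: (2110, ([:: 14011; 2015004;
  1030002; 2036001], [:: 77028; 1059002], [:: 135002; 2072004; 157010; 1000001])); (190, ([:: 15010; 2015004;
  1030002; 2036001], [:: 77028; 1059002], [:: 135002; 2072004; 157010; 1000001; 2004002])); (2858, ([:: 14012;
  2016003; 45001; 1030002; 2036001], [:: 77027; 2054001; 1059002; 2072004], [:: 157010; 1000001])); (371,
  ([:: 14012; 2015004; 45001; 1030001; 2036001], [:: 77028; 2054001; 1059002], [:: 135001; 2072004; 157010;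
  1000001])); (2200, ([:: 14011; 2015004; 1030002], [:: 76029; 2054001; 1059002], [:: 135001; 2072004; 156011;
  1000001])); (348, ([:: 15011; 2015004; 1030001; 2036001], [:: 77028; 2054001; 1060001], [:: 135001; 2072004;
  157009; 1000001])); (112, ([:: 12015; 2016003; 1030002; 2036001], [:: 79024; 2054001; 1058003], [:: 135001;
  2072003; 155013; 1000001])); (1811, ([:: 14012; 2015004; 45001; 1030001; 2036001], [:: 77028; 2054001;
  1059002; 2072004], [:: 157010; 1000001]))]); ((99911, 4195), [:: (3462, ([:: 15012; 2016003; 1030001;
  2036001], [:: 77028; 2054001; 1060001], [:: 135001; 2071006; 158008; 1000001])); (244, ([:: 14013; 2016003;
  46001; 1030001; 2036001], [:: 78026; 1058004; 2072004], [:: 157010; 1000001; 2004001])); (1877, ([:: 13014;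
  2016003; 45001; 1030002; 2036001], [:: 78026; 2054001; 1058003; 2072004], [:: 157010; 1000001])); (374,
  ([:: 14012; 2015004; 46001; 1030001; 2036001], [:: 78026; 1058004], [:: 136001; 2072004; 157010; 1000001;
  2004001])); (19, ([:: 13013; 2015004; 46001; 1030001; 2036001], [:: 78026; 1058004; 2072004], [:: 157010;
  1000001])); (22, ([:: 14012; 2015004; 46001; 1030001; 2036001], [:: 78026; 1058004; 2072004], [:: 157010;
  1000001; 2004001])); (2103, ([:: 13013; 2015004; 1030001; 2036001], [:: 77028; 1059002], [:: 135002; 2072005;
  158009; 1000001])); (1899, ([:: 13014; 2016003; 45001; 1030002], [:: 76028; 2054001; 1058003; 2072004],
  [:: 157010; 1000001]))]); ((99801, 6290), [:: (1409, ([:: 14014; 2017002; 1030001], [:: 75030; 1059002],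
  [:: 135001; 2071006; 159008; 1000001])); (1267, ([:: 13015; 2017002; 46001; 1030001; 2036001], [:: 79025;
  1058004], [:: 136001; 2072004; 157010; 1000001])); (1671, ([:: 14015; 2018001; 44004; 1030001; 2036001],
  [:: 78025; 2054001; 1060002; 2072005], [:: 158007; 1089002])); (1603, ([:: 14015; 2018001; 44003], [:: 47001;
  1030001; 2036001; 78025; 2054001; 1060002], [:: 136001; 2072005; 158007; 1089002])); (740, ([:: 13016;
  2018001; 1029004], [:: 77026; 2054001; 1059002], [:: 134002; 2070007; 159009; 1000001])); (3260, ([:: 14014;
  2017002; 1030001; 2036001], [:: 78027; 1059002], [:: 135001; 2071006; 159008; 1000001])); (49, ([:: 15014;
  2018001; 1030001; 2036001], [:: 82019; 2054001; 1060001], [:: 135002; 2072001; 154012; 1000001]))]);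
  ((99648, 8382), [:: (4125, ([:: 13014; 2015004; 1030001; 2036001], [:: 79026; 1059002], [:: 135003; 2072005;
  159008; 1000001])); (459, ([:: 14016; 2017002; 46001; 1030001; 2036001], [:: 79026; 1058004; 2071006],
  [:: 159007; 1000001])); (2168, ([:: 14016; 2018001; 45002], [:: 47001; 1030001; 2036001; 79025; 2054001;
  1060002], [:: 136001; 2071006; 159006; 1089002])); (470, ([:: 13014; 2015004; 1030001], [:: 75030; 1059002],
  [:: 135003; 2072005; 159008; 1000001])); (1650, ([:: 13018; 2018001; 45001; 1030002], [:: 76027; 2054001;
  1059002], [:: 135001; 2070007; 159009; 1000001])); (75, ([:: 13017; 2017002], [:: 46001; 1030001; 2036001;
  79025], [:: 104001; 1058004; 2071006; 159007; 1000001])); (1053, ([:: 14016; 2018001; 45003; 1030001;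
  2036001], [:: 79025; 2054001; 1060002; 2071006], [:: 159006; 1089002]))]); ((99450, 10470), [:: (782,
  ([:: 14016; 2018001; 45003; 1030001; 2036001], [:: 79025; 2054001; 1060002; 2071006], [:: 160005; 1089002]));
  (2132, ([:: 14016; 2018001; 45002], [:: 47001; 1030001; 2036001; 79025; 2054001; 1060002], [:: 136001;
  2071006; 160005; 1089002])); (5479, ([:: 14016; 2018001; 1030001; 2036001], [:: 79026; 1059003], [:: 136001;
  2070007; 160006; 1000001])); (396, ([:: 15015; 2017002; 1030001; 2036001], [:: 79026; 1059003], [:: 136001;
  2070008; 161005; 1000001; 2003001])); (34, ([:: 14016; 2018001; 46001; 1030001], [:: 75030; 1059003],
  [:: 136001; 2070007; 160006; 1000001])); (507, ([:: 14016; 2018001; 1030001], [:: 75030; 1059003], [:: 136001;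
  2070007; 160006; 1000001])); (670, ([:: 14017; 2018001; 45001; 1030002], [:: 76028; 2054001; 1059002],
  [:: 135001; 2069009; 161006; 1000001]))]); ((99208, 12554), [:: (1336, ([:: 15015; 2017002; 1030001;
  2036001], [:: 80025; 1059004], [:: 137001; 2071006; 160005; 1089002; 2003001])); (732, ([:: 14017; 2018001;
  46002; 1030001; 2036001], [:: 80025; 2054001; 1060003], [:: 137001; 2071006; 160005; 1089002])); (1099,
  ([:: 16015; 2018001; 46002; 1030001; 2036001], [:: 80025; 1059003; 2070007], [:: 161005; 1000001; 14002]));
  (2769, ([:: 14018; 2018001; 1030001; 2036001], [:: 80025; 2054001; 1060001], [:: 135001; 2069009; 162005;
  1000001])); (1194, ([:: 14017; 2018001; 46002; 1030001; 2036001], [:: 80025; 1059003], [:: 136001; 2070007;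
  161005; 1000001])); (1891, ([:: 12018; 2017002; 1030001; 2036001], [:: 80024], [:: 104001; 1059004; 137001;
  2071006; 160005; 1089002])); (979, ([:: 14018; 2018001; 1030001], [:: 75030; 2054001; 1060001], [:: 135001;
  2069009; 162005; 1000001]))]); ((98923, 14632), [:: (4364, ([:: 15017; 2018001; 1030001; 2036001], [:: 80025;
  1059003], [:: 137001; 2070008; 162003; 1000001])); (1466, ([:: 15017; 2018001; 1030001; 2036001], [:: 80025;
  1059003], [:: 136002; 2070008; 162004; 1000001])); (851, ([:: 15017; 2018001; 1030001; 2036001], [:: 80025;
  1059003], [:: 137001; 2070008; 162004; 1000001])); (547, ([:: 14019; 2018001; 46001; 1030001], [:: 74031;
  2054001; 1060002], [:: 136001; 2069008; 161004; 1089002])); (2225, ([:: 14019; 2018001; 46001; 1030001;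
  2036001], [:: 81024; 2054001; 1060002], [:: 136001; 2069008; 161004; 1089002])); (547, ([:: 14018; 2018001;
  46002; 1030001; 2036001], [:: 80025; 1059004], [:: 137001; 2070007; 161004; 1089002]))]); ((98595, 16704),
  [:: (2377, ([:: 15019; 2018001; 1030001; 2036001], [:: 81025; 1060002], [:: 136001; 2069009; 163003; 1000001]));
  (667, ([:: 13019; 2018001; 1030001], [:: 74030], [:: 104001; 1059004; 137001; 2070007; 162003; 1089002]));
  (511, ([:: 14020; 2018001; 46001], [:: 47001; 1030001; 2036001; 82023], [:: 105001; 1060002; 136001; 2069008;
  162003; 1089002])); (1528, ([:: 16021; 2018001; 1029002; 2036001], [:: 84019; 2053001; 1060001], [:: 134001;
  2067010; 162004; 1000002])); (3234, ([:: 13019; 2018001; 1030001; 2036001], [:: 81023], [:: 104001; 1059004;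
  137001; 2070007; 162003; 1089002])); (1684, ([:: 15019; 2018001; 46002; 1030001; 2036001], [:: 82024;
  1060003], [:: 137001; 2069008; 162003; 1089002]))]); ((98222, 18769), [:: (1989, ([:: 16019; 2018001;
  1030001; 2036001], [:: 83023; 1060001], [:: 135003; 2069008; 162003; 1089003])); (938, ([:: 14022; 2018001;
  46001; 1030001; 2036001], [:: 84021; 1060002], [:: 136001; 2068009; 162004; 1000001])); (3396, ([:: 12021;
  2018001; 1030001; 2036001], [:: 82022], [:: 104001; 1059004; 137002; 2070007; 162003; 1089002])); (1065,
  ([:: 14022; 2018001; 46001; 1030001; 2036001], [:: 84021; 1060002], [:: 136001; 2068008; 162003; 1000001]));
  (2003, ([:: 16019; 2018001; 1030001], [:: 73001; 2036001; 83023; 1060001], [:: 135003; 2069008; 162003;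
  1089003])); (610, ([:: 16030], [:: 46001; 1030001; 2036001; 86016; 2051003; 1060001], [:: 135001; 2067009;
  161003; 1088004]))]); ((97807, 20825), [:: (1592, ([:: 15021; 2018001; 1030001; 2036001], [:: 83023;
  1060002], [:: 136002; 2068010; 164001; 1089002])); (379, ([:: 14022; 2018001], [:: 46001; 1030001; 2036001;
  84021], [:: 105001; 1060002; 136002; 2068009; 163002; 1089002])); (5353, ([:: 14022; 2018001; 1030001;
  2036001], [:: 84021], [:: 105001; 1060002; 136002; 2068009; 163002; 1089002])); (1018, ([:: 15022; 2018001;
  1030001], [:: 73001; 2036001; 85020; 2053001; 1060002], [:: 136002; 2068008; 162003; 1089002])); (622,
  ([:: 16018; 2018001; 1030001; 2036001], [:: 82023; 1059004], [:: 137002; 2070007; 163002; 1089002;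
  2002001])); (1036, ([:: 15021; 2018001; 46001; 1030001; 2036001], [:: 84022; 1060002], [:: 136002; 2068009;
  163002; 1089002]))])]%Z.

Definition origin := Vertex 0 0 0 0 0 0.
Definition disk_vertex (p : Z * Z) := Vertex p.1 p.2 0 0 0 0.
Definition triangle_vertex (p : Z * Z) := Vertex p.1 p.2 0 0 1 0.
Definition pentagon_vertex (p : Z * Z) := Vertex 0 0 p.1 p.2 0 1.

(* A run of [n] consecutive entries, starting at [i], of the [k]-th table is
   coded as [(1000 * k + i) * 1000 + n]; the tables are read cyclically. *)
Definition decode_run (t p : list (Z * Z)) (code : Z) : list vertex :=
  let slice l := List.firstn (Z.to_nat (code mod 1000))
    (List.skipn (Z.to_nat (code / 1000 mod 1000)) (List.app l l)) in
  let k := (code / 1000000)%Z in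
  if (k =? 0)%Z then List.map disk_vertex (slice disk_table)
  else if (k =? 1)%Z then List.map triangle_vertex (slice t)
  else List.map pentagon_vertex (slice p).

Definition decode_polygon t p (q : list Z * list Z * list Z) : polygon :=
  let chain c := List.flat_map (decode_run t p) c in
  let c1 := chain q.1.1 in let c2 := chain q.1.2 in let c3 := chain q.2 in
  Polygon (List.hd origin c1) (List.tl c1) (List.hd origin c2) (List.tl c2)
    (List.hd origin c3) (List.tl c3).

Definition decode_certificate t p (l : list (Z * (list Z * list Z * list Z))) : list (Z * polygon) :=
  List.map (fun wq => (wq.1, decode_polygon t p wq.2)) l.

Definition disk_table_ok :=
  List.forallb (fun q : Z * Z => (4 * (q.1 * q.1 + q.2 * q.2) <=? scale * scale)%Z) disk_table.

Lemma disk_table_okP : disk_table_ok.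
Proof. by vm_compute. Qed.

Section decoding.
Context {R : realType}.
Variables (x z : R * R) (c s : R) (V : set (R * R)) (A : R) (t p : list (Z * Z)).
Hypothesis gV : good V A (zr scale / 2).
Hypothesis ht : forall q, List.In q t -> V (zr q.1 + x.1, zr q.2 + x.2).
Hypothesis hp : forall q, List.In q p ->
  V (zr q.1 * c - zr q.2 * s + z.1, zr q.2 * c + zr q.1 * s + z.2).

(** [origin] is the default head in [decode_polygon]; since it lies in the disk, decoded vertices
    belong to [V] even if a code yields an empty chain. *)
Lemma origin_in : V (vertex_pos x z c s origin).
Proof.
have [_ h _] := gV; apply: h; rewrite /vertex_pos /= !zr0 !mul0r !addr0 subr0 expr0n /= addr0.
exact: sqr_ge0.
Qed.

Lemma decode_run_in code v : List.In v (decode_run t p code) -> V (vertex_pos x z c s v).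
Proof.
have sl (l : list (Z * Z)) n i q : List.In q (List.firstn n (List.skipn i (List.app l l))) ->
    List.In q l.
  move=> h; suff : List.In q (List.app l l) by rewrite List.in_app_iff => -[].
  rewrite -(List.firstn_skipn i (List.app l l)) List.in_app_iff; right.
  by rewrite -(List.firstn_skipn n (List.skipn i _)) List.in_app_iff; left.
rewrite /decode_run; case: ifP => _; [|case: ifP => _] => /List.in_map_iff[q [<- /sl qin]].
- have [_ h _] := gV; apply: h; rewrite /vertex_pos /= !zr0 !mul0r !addr0 subr0.
  have /List.forallb_forall h' := disk_table_okP; move: (h' q qin) => /(zr_le (R := R)).
  rewrite !zrM zrD !zrM.
  have -> : zr 4 = 4 :> R by rewrite zrE.
  lra.
- by rewrite /vertex_pos /= !zr0 zr1 !mul0r !mul1r !addr0 !subr0; exact: ht.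
- by rewrite /vertex_pos /= !zr0 zr1 !mul0r !mul1r !add0r !addr0; exact: hp.
Qed.

Lemma decode_in l wp : List.In wp (decode_certificate t p l) ->
  forall v, List.In v (vertices wp.2) -> V (vertex_pos x z c s v).
Proof.
move=> /List.in_map_iff[wq [<- _]] v; move: wq => [w [[c1 c2] c3]].
have ch cc v' : List.In v' (List.flat_map (decode_run t p) cc) -> V (vertex_pos x z c s v').
  by move=> /List.in_flat_map[code [_]]; exact: decode_run_in.
have hd_in cc : V (vertex_pos x z c s (List.hd origin (List.flat_map (decode_run t p) cc))).
  case E : (List.flat_map _ _) => [|v' l'] /=; first exact: origin_in.
  by apply: (ch cc); rewrite E; left.
have tl_in cc v' : List.In v' (List.tl (List.flat_map (decode_run t p) cc)) ->
    V (vertex_pos x z c s v').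
  by move=> h; apply: (ch cc); move: h; case: (List.flat_map _ _) => //= ? ? ?; right.
have inE (l1 l2 : list vertex) v' :
    List.In v' (l1 ++ l2)%SEQ -> List.In v' l1 \/ List.In v' l2.
  by move=> h; apply/List.in_app_iff.
rewrite /vertices /decode_polygon /= => -[<-|/inE]; first exact: hd_in.
move=> [/tl_in //|[<-|/inE]]; first exact: hd_in.
by move=> [/tl_in //|[<-|/tl_in //]]; exact: hd_in.
Qed.
End decoding.

(* With [e = slope * (b - (d1 x1 + d2 x2))] a certificate bounds [x] in direction
   [(d1, d2)] for every cover of area less than 0.834. *)
Definition slope : Z := 2000000000.

Definition direction_ok t rho (d1 d2 b : Z) cert :=
  certificate_ok (Region rho 0 99000 (-10000) 99000 10000)
    (- (slope * d1)) (- (slope * d2)) (slope * b) (decode_certificate t [::] cert).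

(** The eight half-planes cut out the octagon |x1| <= a, |x2| <= a, |x1| + |x2| <= b. Its corner
    [(a, b - a)] and the images of it under symmetry have norm at most [rho'], the radius handed to
    the next round. *)
Definition round_ok t rho a b rho' (certs : list (list (Z * (list Z * list Z * list Z)))) :=
  let cert i := List.nth i certs [::] in
  [&& region_ok (Region rho 0 99000 (-10000) 99000 10000), (a <=? b)%Z,
      (a * a + (b - a) * (b - a) <=? rho' * rho')%Z,
      direction_ok t rho 1 0 a (cert 0%N) && direction_ok t rho (-1) 0 a (cert 1%N),
      direction_ok t rho 0 1 a (cert 2%N) && direction_ok t rho 0 (-1) a (cert 3%N),
      direction_ok t rho 1 1 b (cert 4%N) && direction_ok t rho 1 (-1) b (cert 5%N)
    & direction_ok t rho (-1) 1 b (cert 6%N) && direction_ok t rho (-1) (-1) b (cert 7%N)].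

(** [u] is the start of the first remaining arc. A positive total weight is required because weight
    0 would make the certified inequality empty. *)
Fixpoint arcs_ok ra rb (u : Z * Z) (l : list ((Z * Z) * list (Z * (list Z * list Z * list Z)))) :=
  if l is (v, cert) :: l' then
    let r := Region ra rb u.1 u.2 v.1 v.2 in
    let d := decode_certificate triangle_table pentagon_table cert in
    [&& region_ok r, (0 <? weight d)%Z, certificate_ok r 0 0 0 d & arcs_ok ra rb v l']
  else true.

(* Rounded towards the centre so that they sum to 0 exactly. *)
Definition triangle_vertices : list (Z * Z) :=
  [:: (57732, 0); (-28866, 49998); (-28866, -49998)]%Z.
Definition pentagon_vertices : list (Z * Z) :=
  [:: (52570, 0); (16245, 49997); (-42530, 30898); (-42530, -30898); (16245, -49997)]%Z.

Lemma point_certificate_ok :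
  certificate_ok (Region 0 0 99000 (-10000) 99000 10000) 0 0 0
    (decode_certificate [:: (70000, 0)%Z] [::] point_certificate).
Proof. by vm_compute. Qed.
Lemma triangle_round1_ok : round_ok triangle_table 39700 20090 27711 21487 triangle_round1.
Proof. by vm_compute. Qed.
Lemma triangle_round2_ok : round_ok triangle_table 21487 5831 8139 6272 triangle_round2.
Proof. by vm_compute. Qed.
Lemma pentagon_round1_ok : round_ok pentagon_table 46300 24406 34089 26257 pentagon_round1.
Proof. by vm_compute. Qed.
Lemma pentagon_round2_ok : round_ok pentagon_table 26257 7381 10276 7929 pentagon_round2.
Proof. by vm_compute. Qed.
Lemma pentagon_round3_ok : round_ok pentagon_table 7929 6287 8857 6793 pentagon_round3.
Proof. by vm_compute. Qed.
Lemma arcs_okP : arcs_ok 6272 6793 (97807, -20825)%Z arcs.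
Proof. by vm_compute. Qed.

(** * Invariance under rotations of the frame *)

Section rotation.
Context {R : realType}.

Definition plane_rot (c s : R) (q : R * R) : R * R := (c * q.1 - s * q.2, s * q.1 + c * q.2).

Variables (c s : R).
Hypothesis cs1 : c ^+ 2 + s ^+ 2 = 1.

Lemma cross_rot p q : cross (plane_rot c s p) (plane_rot c s q) = cross p q.
Proof.
rewrite /cross /plane_rot /=.
by rewrite -[RHS]mul1r -cs1; ring.
Qed.

Lemma norm_rot q : (plane_rot c s q).1 ^+ 2 + (plane_rot c s q).2 ^+ 2 = q.1 ^+ 2 + q.2 ^+ 2.
Proof. by rewrite /plane_rot /= -[RHS]mul1r -cs1; ring. Qed.

Lemma chain_ok_rot a l b :
  chain_ok (plane_rot c s a) (map (plane_rot c s) l) (plane_rot c s b) <-> chain_ok a l b.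
Proof.
by elim: l a => [|q l IH] a /=; rewrite !cross_rot //; split=> -[? ? /IH ?].
Qed.

Lemma chain_sum_rot a l b :
  chain_sum (plane_rot c s a) (map (plane_rot c s) l) (plane_rot c s b) = chain_sum a l b.
Proof. by elim: l a => [|q l IH] a /=; rewrite ?IH !cross_rot. Qed.

(** Allows the frame to be turned at will: a distant point onto the first axis, the pentagon into
    standard position for its own rounds, the triangle of a given cover to angle 0. *)
Lemma good_rot (V : set (R * R)) (A d : R) :
  good V A d -> good (fun q => V (plane_rot c s q)) A d.
Proof.
move=> [cV dV hV]; split.
- move=> p q t t01 Vp Vq; have := cV _ _ t t01 Vp Vq; congr V.
  by rewrite /plane_rot /=; congr pair; ring.
- by move=> q qd; apply: dV; rewrite norm_rot.
- move=> a l1 b l2 c' l3 Vl ab bc ca k1 k2 k3.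
  rewrite -(chain_sum_rot a) -(chain_sum_rot b) -(chain_sum_rot c'); apply: hV; rewrite ?cross_rot ?chain_ok_rot //.
  have mapP' l q : List.In q (map (plane_rot c s) l) -> exists2 q', List.In q' l & q = plane_rot c s q'.
    elim: l => //= q' l IH [<-|/IH[q'' ? ->]]; first by exists q' => //; left.
    by exists q'' => //; right.
  move=> q; have -> : plane_rot c s a :: map (plane_rot c s) l1 ++ plane_rot c s b :: map (plane_rot c s) l2 ++
      plane_rot c s c' :: map (plane_rot c s) l3 = map (plane_rot c s) (a :: l1 ++ b :: l2 ++ c' :: l3).
    by rewrite /= !(map_cat, map_cons).
  by move=> /mapP'[q' /Vl ? ->].
Qed.
End rotation.

(** One body and the disk, treated as the two-body case with [z = 0], [u = (1, 0)] and no points in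
    the second table. The arc around [(1, 0)] is a dummy that only has to satisfy [region_ok]. *)
Lemma body_certificate {R : realType} (V : set (R * R)) (A : R) t rho e1 e2 e0 cert (x : R * R) :
  good V A (zr scale / 2) ->
  region_ok (Region rho 0 99000 (-10000) 99000 10000) ->
  certificate_ok (Region rho 0 99000 (-10000) 99000 10000) e1 e2 e0
    (decode_certificate t [::] cert) ->
  (forall q, List.In q t -> V (zr q.1 + x.1, zr q.2 + x.2)) ->
  x.1 ^+ 2 + x.2 ^+ 2 <= zr rho ^+ 2 ->
  zr 1668 * zr scale ^+ 2 * zr (weight (decode_certificate t [::] cert)) <=
    zr 1000 * (zr (weight (decode_certificate t [::] cert)) * (2 * A) + (zr e0 + zr e1 * x.1 + zr e2 * x.2)).
Proof.
move=> gV rok cok ht xr.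
have cs1 : (1 : R) ^+ 2 + 0 ^+ 2 = 1 by rewrite expr1n expr0n addr0.
have z0 : ((0, 0) : R * R).1 ^+ 2 + ((0, 0) : R * R).2 ^+ 2 <= zr 0 ^+ 2 :> R.
  by rewrite /= expr0n addr0 zr0 expr0n.
have h0 (p q : R) : q <= 0 -> 0 <= p * 0 - q * 1 by lra.
have h1 (p q : R) : 0 <= p -> 0 <= 1 * p - 0 * q by lra.
have hp q : List.In q ([::] : list (Z * Z)) ->
  V (zr q.1 * 1 - zr q.2 * 0 + ((0, 0) : R * R).1, zr q.2 * 1 + zr q.1 * 0 + ((0, 0) : R * R).2).
  by [].
have n0 : zr (-10000) <= 0 :> R by exact: zr_le0.
have n1 : 0 <= zr 10000 :> R by exact: zr_ge0.
apply: (certificate_sound cs1 rok xr z0 (h0 _ _ n0) (h1 _ _ n1) gV cok) => wp.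
exact: (decode_in gV ht hp).
Qed.

(** * Confining the translations of a small cover *)

Section bounds.
Context {R : realType}.
Variables (V : set (R * R)) (A : R).
Hypothesis gV : good V A (zr scale / 2).
Hypothesis small : zr 2000 * A < zr 1668 * zr scale ^+ 2.

Lemma weight_ge0 r e1 e2 e0 l : certificate_ok r e1 e2 e0 l -> 0 <= zr (weight l) :> R.
Proof.
move=> /andP[h _]; elim: l h => [|wp l IH] /=; first by rewrite zr0.
by move=> /andP[/andP[w0 _] /IH h]; rewrite zrD addr_ge0 // zr_ge0.
Qed.

(** Turns a lower bound for the area into a constraint on the position: if the area is below 0.834,
    the polygons cannot account for the certified value, so the correction term [E] has to be
    nonnegative. *)
Lemma slack (W E : R) : 0 <= W ->
  zr 1668 * zr scale ^+ 2 * W <= zr 1000 * (W * (2 * A) + E) -> 0 <= E.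
Proof.
move=> W0 h; have k : 0 < zr 1000 :> R by exact: zr_gt0.
rewrite -(pmulr_rge0 _ k).
have : zr 2000 * A * W <= zr 1668 * zr scale ^+ 2 * W by rewrite ler_wpM2r // ltW.
by rewrite zr2000; lra.
Qed.

(** On the slanted edge the squared norm [(b - q) ^+ 2 + q ^+ 2] is convex in [q], so it is largest
    at the two corners, [q = a] and [q = b - a]. *)
Lemma octagon (a b p q : R) : a <= b -> `|p| <= a -> `|q| <= a ->
  `|p| + `|q| <= b -> p ^+ 2 + q ^+ 2 <= a ^+ 2 + (b - a) ^+ 2.
Proof.
move=> ab pa qa pqb; rewrite -(real_normK (num_real p)) -(real_normK (num_real q)).
move: (normr_ge0 p) (normr_ge0 q); move: `|p| `|q| pa qa pqb => {}p {}q pa qa pqb p0 q0.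
have [h|h] := leP q (b - a); first by apply: lerD; rewrite ler_sqr ?nnegrE; lra.
apply: (@le_trans _ _ ((b - q) ^+ 2 + q ^+ 2)).
  by rewrite lerD2r ler_sqr ?nnegrE; lra.
rewrite -subr_ge0 (_ : _ - _ = 2 * ((a - q) * (q - (b - a)))); last by ring.
by rewrite !mulr_ge0 // subr_ge0 // ltW.
Qed.

Lemma round_sound t rho a b rho' certs (x : R * R) :
  round_ok t rho a b rho' certs ->
  (forall q, List.In q t -> V (zr q.1 + x.1, zr q.2 + x.2)) ->
  x.1 ^+ 2 + x.2 ^+ 2 <= zr rho ^+ 2 -> x.1 ^+ 2 + x.2 ^+ 2 <= zr rho' ^+ 2.
Proof.
move=> + ht xr.
have dir d1 d2 bd cert : region_ok (Region rho 0 99000 (-10000) 99000 10000) ->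
   direction_ok t rho d1 d2 bd cert -> zr d1 * x.1 + zr d2 * x.2 <= zr bd.
  move=> rok dok; have := slack (weight_ge0 dok) (body_certificate gV rok dok ht xr).
  have sl : 0 < zr slope :> R by exact: zr_gt0.
  rewrite !zrN !zrM -[in X in _ -> X]subr_ge0 -[in X in _ -> X](pmulr_rge0 _ sl).
  by move: (zr slope) => M h; apply: le_trans h _; rewrite le_eqVlt;
    apply/orP; left; apply/eqP; ring.
move=> /and5P[rok ab abr /andP[h0 h1] /and3P[/andP[h2 h3] /andP[h4 h5] /andP[h6 h7]]].
have {h0} := dir _ _ _ _ rok h0; have {h1} := dir _ _ _ _ rok h1.
have {h2} := dir _ _ _ _ rok h2; have {h3} := dir _ _ _ _ rok h3.
have {h4} := dir _ _ _ _ rok h4; have {h5} := dir _ _ _ _ rok h5.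
have {h6} := dir _ _ _ _ rok h6; have {h7} := dir _ _ _ _ rok h7.
have -> : zr (-1) = -1 :> R by rewrite zrE.
rewrite zr0 zr1 !mul1r !mul0r !addr0 !add0r !mulN1r => k7 k6 k5 k4 k3 k2 k1 k0.
move: ab abr => /(zr_le (R := R)) ab /(zr_le (R := R)); rewrite zrD !zrM zrB.
rewrite -!expr2; apply: le_trans; apply: octagon => //.
- by rewrite ler_norml; lra.
- by rewrite ler_norml; lra.
- by case: (ger0P x.1) => _; case: (ger0P x.2) => _; lra.
Qed.

(** A point farther away than 0.7 can be turned onto the first axis and pulled back along its
    segment to distance exactly 0.7, where one certificate for the hull with the disk contradicts
    [small]. *)
Lemma point_bound q : V q -> q.1 ^+ 2 + q.2 ^+ 2 <= zr 70000 ^+ 2.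
Proof.
move=> Vq; rewrite leNgt; apply/negP => lt.
have P0 : 0 < zr 70000 :> R by exact: zr_gt0.
pose n := Num.sqrt (q.1 ^+ 2 + q.2 ^+ 2).
have nn : n ^+ 2 = q.1 ^+ 2 + q.2 ^+ 2 by rewrite sqr_sqrtr // addr_ge0 // sqr_ge0.
have nP : zr 70000 < n.
  by rewrite -ltr_sqr ?nnegrE ?sqrtr_ge0 ?nn // ltW.
have n0 : 0 < n by exact: lt_trans nP.
have u1 : (q.1 / n) ^+ 2 + (q.2 / n) ^+ 2 = 1.
  by rewrite !expr_div_n -mulrDl -nn divff // expf_neq0 // gt_eqF.
have gV' := good_rot u1 gV.
have [cV' dV' _] := gV'.
have Vp : V (plane_rot (q.1 / n) (q.2 / n) (zr 70000, 0)).
  have V0 : V (plane_rot (q.1 / n) (q.2 / n) (0, 0)).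
    by apply: (dV' (0, 0)); rewrite /= expr0n addr0 sqr_ge0.
  have Vn : V (plane_rot (q.1 / n) (q.2 / n) (n, 0)).
    rewrite /plane_rot /= !mulr0 subr0 addr0 !divfK ?gt_eqF //.
    by move: Vq; rewrite {1}[q]surjective_pairing.
  have := cV' (0, 0) (n, 0) (zr 70000 / n) _ V0 Vn.
  rewrite divr_ge0 ?ler_pdivrMr ?mul1r ?(ltW nP) ?ltW // => /(_ isT).
  by rewrite /= !mulr0 !add0r divfK ?gt_eqF // addr0.
have ht q' : List.In q' [:: (70000, 0)%Z] ->
    V (plane_rot (q.1 / n) (q.2 / n) (zr q'.1 + (0 : R), zr q'.2 + (0 : R))).
  by move=> [<-|//]; rewrite /= zr0 !addr0.
have xr : ((0, 0) : R * R).1 ^+ 2 + ((0, 0) : R * R).2 ^+ 2 <= zr 0 ^+ 2 :> R.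
  by rewrite /= expr0n addr0 zr0 expr0n.
have := @body_certificate R _ A [:: (70000, 0)%Z] 0 0 0 0 point_certificate (0, 0) gV' isT
  point_certificate_ok ht xr.
rewrite zr0 !mul0r !addr0.
set W := zr (weight _) => H.
have W0 : 0 < W by exact: zr_gt0.
move: small; apply/negP; rewrite -leNgt -(ler_pM2r W0) zr2000.
by move: H; move: (zr 1000) (zr 1668) (zr scale) => a b d; lra.
Qed.
End bounds.

(** * Exclusion of all relative rotations *)

Section covering.
Context {R : realType}.
Variables (V : set (R * R)) (A : R) (x z : R * R) (c s : R).
Hypothesis gV : good V A (zr scale / 2).
Hypothesis small : zr 2000 * A < zr 1668 * zr scale ^+ 2.
Hypothesis cs1 : c ^+ 2 + s ^+ 2 = 1.

(** Sweep over the arcs: a unit vector beyond the start of an arc is either beyond its end as well,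
    and the induction goes on, or on the arc, where the certificate contradicts [small]. What
    survives lies beyond the last end. *)
Lemma arcs_sound ra rb u l :
  (forall q, List.In q triangle_table -> V (zr q.1 + x.1, zr q.2 + x.2)) ->
  (forall q, List.In q pentagon_table ->
    V (zr q.1 * c - zr q.2 * s + z.1, zr q.2 * c + zr q.1 * s + z.2)) ->
  x.1 ^+ 2 + x.2 ^+ 2 <= zr ra ^+ 2 -> z.1 ^+ 2 + z.2 ^+ 2 <= zr rb ^+ 2 ->
  arcs_ok ra rb u l -> 0 <= zr u.1 * s - zr u.2 * c ->
  0 <= zr (last u (map fst l)).1 * s - zr (last u (map fst l)).2 * c.
Proof.
move=> ht hp xr zr'; elim: l u => [//|[v cert] l IH] u /= /and4P[rok W0 cok lok] h.
have [h'|h'] := leP 0 (zr v.1 * s - zr v.2 * c).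
  exact: IH.
exfalso; have h1 : 0 <= c * zr v.2 - s * zr v.1 by lra.
have := certificate_sound cs1 rok xr zr' h h1 gV cok
  (fun wp wpin => decode_in gV ht hp wpin).
rewrite zr0 !mul0r !addr0 => H; move: small; apply/negP; rewrite -leNgt.
have {}W0 := zr_lt (R := R) W0; rewrite zr0 in W0.
rewrite -(ler_pM2r W0); apply: (le_trans H).
by rewrite zr2000 le_eqVlt; apply/orP; left; apply/eqP; ring.
Qed.

(* Summing over the vertices, whose sum is 0, controls the translation. *)
Lemma triangle_ball :
  (forall q, List.In q triangle_vertices -> V (zr q.1 + x.1, zr q.2 + x.2)) ->
  x.1 ^+ 2 + x.2 ^+ 2 <= zr 39700 ^+ 2.
Proof.
move=> h; have b q qin := point_bound gV small (h q qin).
have := b _ (or_introl erefl); have := b _ (or_intror (or_introl erefl)).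
have := b _ (or_intror (or_intror (or_introl erefl))).
have K : zr (3 * (70000 * 70000)) <= zr (3 * (39700 * 39700) +
  (57732 * 57732 + 2 * (28866 * 28866 + 49998 * 49998))) :> R by exact: zr_le.
rewrite !(zrD, zrM) in K; rewrite /= zr0.
have -> : zr (-28866) = - zr 28866 :> R by rewrite -zrN.
have -> : zr (-49998) = - zr 49998 :> R by rewrite -zrN.
have e : zr 57732 = zr 28866 + zr 28866 :> R by rewrite -zrD.
have e2 : zr 2 = 2 :> R by rewrite zrE.
have e3 : zr 3 = 3 :> R by rewrite zrE.
rewrite e2 e3 in K.
move: e K; move: (zr 57732) (zr 28866) (zr 49998) (zr 70000) (zr 39700).
move=> v1 v2 v3 P rho -> K h1 h2 h3.
by lra.
Qed.

(** The vertices sum to 0, so the mean of |v + x|^2 is |x|^2 plus the mean of |v|^2; it is at most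
    0.7^2, and 0.463 is the resulting radius rounded up. *)
Lemma pentagon_ball :
  (forall q, List.In q pentagon_vertices -> V (zr q.1 + x.1, zr q.2 + x.2)) ->
  x.1 ^+ 2 + x.2 ^+ 2 <= zr 46300 ^+ 2.
Proof.
move=> h; have b q qin := point_bound gV small (h q qin).
have := b _ (or_introl erefl); have := b _ (or_intror (or_introl erefl)).
have := b _ (or_intror (or_intror (or_introl erefl))).
have := b _ (or_intror (or_intror (or_intror (or_introl erefl)))).
have := b _ (or_intror (or_intror (or_intror (or_intror (or_introl erefl))))).
have K : zr (5 * (70000 * 70000)) <= zr (5 * (46300 * 46300) +
  (52570 * 52570 + 2 * (16245 * 16245 + 49997 * 49997) +
   2 * (42530 * 42530 + 30898 * 30898))) :> R by exact: zr_le.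
rewrite !(zrD, zrM) in K; rewrite /= zr0.
have -> : zr (-42530) = - zr 42530 :> R by rewrite -zrN.
have -> : zr (-30898) = - zr 30898 :> R by rewrite -zrN.
have -> : zr (-49997) = - zr 49997 :> R by rewrite -zrN.
have e : zr 52570 = (zr 42530 + zr 42530) - (zr 16245 + zr 16245) :> R.
  have := zrB (R := R) (42530 + 42530) (16245 + 16245); rewrite !zrD; apply.
have e2 : zr 2 = 2 :> R by rewrite zrE.
have e5 : zr 5 = 5 :> R by rewrite zrE.
rewrite e2 e5 in K.
move: e K; move: (zr 52570) (zr 16245) (zr 49997) (zr 42530) (zr 30898) (zr 70000) (zr 46300).
move=> v1 v2 v3 v4 v5 P rho -> K h1 h2 h3 h4 h5.
by lra.
Qed.
End covering.

Theorem covering_bound {R : realType} (V : set (R * R)) (A c s : R) (x z : R * R) :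
  good V A (zr scale / 2) -> c ^+ 2 + s ^+ 2 = 1 ->
  (forall q, List.In q (List.app triangle_vertices triangle_table) ->
    V (zr q.1 + x.1, zr q.2 + x.2)) ->
  (forall q, List.In q (List.app pentagon_vertices pentagon_table) ->
    V (zr q.1 * c - zr q.2 * s + z.1, zr q.2 * c + zr q.1 * s + z.2)) ->
  0 <= zr 97807 * s + zr 20825 * c -> zr 97807 * s - zr 20825 * c < 0 ->
  zr 1668 * zr scale ^+ 2 <= zr 2000 * A.
Proof.
move=> gV cs1 hx hz h0 h1; rewrite leNgt; apply/negP => small.
have ht q : List.In q triangle_table -> V (zr q.1 + x.1, zr q.2 + x.2).
  by move=> h; apply: hx; apply/List.in_app_iff; right.
have xr : x.1 ^+ 2 + x.2 ^+ 2 <= zr 6272 ^+ 2.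
  apply: (round_sound gV small triangle_round2_ok ht).
  apply: (round_sound gV small triangle_round1_ok ht).
  by apply: (triangle_ball gV small) => q h; apply: hx; apply/List.in_app_iff; left.
have gV' := good_rot cs1 gV.
(* In the frame turned by [(c, s)] the pentagon is unrotated with translation [y], so the one-body
   rounds apply to it; [y] and [z] have the same norm. *)
pose y := plane_rot c (- s) z.
have cs1' : c ^+ 2 + (- s) ^+ 2 = 1 by rewrite sqrrN.
have hy q : List.In q (List.app pentagon_vertices pentagon_table) ->
    V (plane_rot c s (zr q.1 + y.1, zr q.2 + y.2)).
  move=> h; have := hz q h; congr V; rewrite /y /plane_rot /=; congr pair.
    by rewrite -[z.1 in LHS]mul1r -cs1; ring.
  by rewrite -[z.2 in LHS]mul1r -cs1; ring.
have zr5 : z.1 ^+ 2 + z.2 ^+ 2 <= zr 6793 ^+ 2.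
  have hyt q : List.In q pentagon_table -> V (plane_rot c s (zr q.1 + y.1, zr q.2 + y.2)).
    by move=> h; apply: hy; apply/List.in_app_iff; right.
  rewrite -(norm_rot cs1') -/y.
  apply: (round_sound gV' small pentagon_round3_ok hyt).
  apply: (round_sound gV' small pentagon_round2_ok hyt).
  apply: (round_sound gV' small pentagon_round1_ok hyt).
  by apply: (pentagon_ball gV' small) => q h; apply: hy; apply/List.in_app_iff; left.
have hp q : List.In q pentagon_table ->
    V (zr q.1 * c - zr q.2 * s + z.1, zr q.2 * c + zr q.1 * s + z.2).
  by move=> h; apply: hz; apply/List.in_app_iff; right.
have := arcs_sound gV small cs1 ht hp xr zr5 arcs_okP.
have -> : last (97807, -20825)%Z (map fst arcs) = (97807, 20825)%Z by vm_compute.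
rewrite /= (_ : zr (-20825) = - zr 20825 :> R); last by rewrite -zrN.
by rewrite mulNr opprK => /(_ h0); rewrite leNgt h1.
Qed.

(** * Congruent copies of Reuleaux polygons *)

Section isometries.
Context {R : realType}.

Lemma edist_sqr (p q : plane R) : Defs.edist p q ^+ 2 = (p.1 - q.1) ^+ 2 + (p.2 - q.2) ^+ 2.
Proof. by rewrite sqr_sqrtr // addr_ge0 // sqr_ge0. Qed.

Lemma sqr_sum_eq0 (p q : R) : p ^+ 2 + q ^+ 2 = 0 -> p = 0 /\ q = 0.
Proof.
by move=> /eqP; rewrite paddr_eq0 ?sqr_ge0 // !sqrf_eq0 => /andP[/eqP-> /eqP->].
Qed.

(** The sign [e] is the determinant of the two vectors: 1 for a rotation, -1 for a reflection. *)
Lemma orthonormal_sign (a1 a2 b1 b2 : R) : a1 ^+ 2 + a2 ^+ 2 = 1 ->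
  b1 ^+ 2 + b2 ^+ 2 = 1 -> a1 * b1 + a2 * b2 = 0 ->
  exists2 e, e = 1 \/ e = -1 & b1 = - (e * a2) /\ b2 = e * a1.
Proof.
move=> aa bb ab; pose e := a1 * b2 - a2 * b1.
have b1E : b1 = - (e * a2).
  transitivity ((a1 ^+ 2 + a2 ^+ 2) * b1 - a1 * (a1 * b1 + a2 * b2)); last by rewrite /e; ring.
  by rewrite aa ab mulr0 subr0 mul1r.
have b2E : b2 = e * a1.
  transitivity ((a1 ^+ 2 + a2 ^+ 2) * b2 - a2 * (a1 * b1 + a2 * b2)); last by rewrite /e; ring.
  by rewrite aa ab mulr0 subr0 mul1r.
exists e => //; have : (e - 1) * (e + 1) = 0.
  transitivity (e ^+ 2 * (a1 ^+ 2 + a2 ^+ 2) - 1); first by rewrite aa; ring.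
  by rewrite -bb (_ : b1 ^+ 2 + b2 ^+ 2 = e ^+ 2 * (a1 ^+ 2 + a2 ^+ 2)) ?subrr // {1}b1E {1}b2E; ring.
by move=> /eqP; rewrite mulf_eq0 subr_eq0 addr_eq0 => /orP[]/eqP ->; [left|right].
Qed.

(** Linearity is derived by polarisation: the distances of [g q] to the images of the origin and of
    the two unit vectors give its inner products with an orthonormal basis, which determine it. *)
Lemma isometry_affine (g : plane R -> plane R) : Defs.isometry g ->
  exists c s e : R, [/\ c ^+ 2 + s ^+ 2 = 1, e = 1 \/ e = -1 &
    forall q, g q = ((g (0, 0)).1 + (c * q.1 - e * s * q.2),
                     (g (0, 0)).2 + (s * q.1 + e * c * q.2))].
Proof.
move=> ig; have D p q : ((g p).1 - (g q).1) ^+ 2 + ((g p).2 - (g q).2) ^+ 2 =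
    (p.1 - q.1) ^+ 2 + (p.2 - q.2) ^+ 2 by rewrite -!edist_sqr ig.
pose o := g (0, 0).
pose a1 := (g (1, 0)).1 - o.1; pose a2 := (g (1, 0)).2 - o.2.
pose b1 := (g (0, 1)).1 - o.1; pose b2 := (g (0, 1)).2 - o.2.
have aa : a1 ^+ 2 + a2 ^+ 2 = 1.
  by have := D (1, 0) (0, 0); rewrite /= !subr0 expr1n expr0n addr0.
have bb : b1 ^+ 2 + b2 ^+ 2 = 1.
  by have := D (0, 1) (0, 0); rewrite /= !subr0 expr1n expr0n add0r.
have ab : a1 * b1 + a2 * b2 = 0.
  by have := D (1, 0) (0, 1); rewrite /= /a1 /a2 /b1 /b2 in aa bb *; nra.
have gE q : g q = (o.1 + (a1 * q.1 + b1 * q.2), o.2 + (a2 * q.1 + b2 * q.2)).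
  have h0 := D q (0, 0); have h1 := D q (1, 0); have h2 := D q (0, 1).
  pose w1 := (g q).1 - o.1; pose w2 := (g q).2 - o.2.
  have k0 : w1 ^+ 2 + w2 ^+ 2 = q.1 ^+ 2 + q.2 ^+ 2 by rewrite h0 /= !subr0.
  have k1 : (w1 - a1) ^+ 2 + (w2 - a2) ^+ 2 = (q.1 - 1) ^+ 2 + q.2 ^+ 2.
    by move: h1; rewrite /= subr0 => <-; rewrite /w1 /a1 /w2 /a2; ring.
  have k2 : (w1 - b1) ^+ 2 + (w2 - b2) ^+ 2 = q.1 ^+ 2 + (q.2 - 1) ^+ 2.
    by move: h2; rewrite /= subr0 => <-; rewrite /w1 /b1 /w2 /b2; ring.
  have wa : w1 * a1 + w2 * a2 = q.1 by lra.
  have wb : w1 * b1 + w2 * b2 = q.2 by lra.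
  have [] : w1 - (a1 * q.1 + b1 * q.2) = 0 /\ w2 - (a2 * q.1 + b2 * q.2) = 0.
    apply: sqr_sum_eq0.
    have -> : (w1 - (a1 * q.1 + b1 * q.2)) ^+ 2 + (w2 - (a2 * q.1 + b2 * q.2)) ^+ 2 =
      (w1 ^+ 2 + w2 ^+ 2) + (a1 ^+ 2 + a2 ^+ 2) * q.1 ^+ 2 + (b1 ^+ 2 + b2 ^+ 2) * q.2 ^+ 2
      - 2 * q.1 * (w1 * a1 + w2 * a2) - 2 * q.2 * (w1 * b1 + w2 * b2)
      + 2 * q.1 * q.2 * (a1 * b1 + a2 * b2) by ring.
    by rewrite k0 aa bb wa wb ab; ring.
  move=> e1 e2; rewrite [LHS]surjective_pairing; congr pair.
    by move: e1; rewrite /w1; lra.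
  by move: e2; rewrite /w2; lra.
have [e e1 [b1E b2E]] := orthonormal_sign aa bb ab.
exists a1, a2, e; split => // q; rewrite gE b1E b2E; congr pair; ring.
Qed.

Lemma unit_angle (c s : R) : c ^+ 2 + s ^+ 2 = 1 -> exists t, c = cos t /\ s = sin t.
Proof.
move=> cs; have c1 : -1 <= c <= 1.
  by rewrite -ler_norml -(@expr_le1 _ 2) ?normr_ge0 // real_normK ?num_real // -cs lerDl sqr_ge0.
have sE : sin (acos c) = `|s|.
  by rewrite sin_acos // (_ : 1 - c ^+ 2 = s ^+ 2) ?sqrtr_sqr // -cs; ring.
have [s0|s0] := leP 0 s.
  by exists (acos c); rewrite sE acosK ?ger0_norm // in_itv.
exists (- acos c); rewrite sinN cosN sE acosK ?ltr0_norm ?opprK //.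
Qed.
End isometries.

Section reuleaux.
Context {R : realType}.
Implicit Types (n : nat) (U : set (R * R)).

Definition vertex_angle n (k : int) : R := 2 * pi * k%:~R / n%:R.

(** Letting [k] run over all integers instead of one period makes the symmetries immediate: a
    rotation by a vertex angle shifts [k], the reflection in the first axis negates it. *)
Definition in_reuleaux n (r : R) (w : R * R) : Prop := forall k : int,
  (w.1 - r * cos (vertex_angle n k)) ^+ 2 + (w.2 - r * sin (vertex_angle n k)) ^+ 2 <= 1.

Definition placed U n r (y : R * R) (t : R) : Prop := forall w, in_reuleaux n r w ->
  U (translate y (plane_rot (cos t) (sin t) w)).

Lemma rotated_vertex_dist (r a b : R) (w : R * R) :
  ((plane_rot (cos a) (sin a) w).1 - r * cos b) ^+ 2 +
  ((plane_rot (cos a) (sin a) w).2 - r * sin b) ^+ 2 =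
  (w.1 - r * cos (b - a)) ^+ 2 + (w.2 - r * sin (b - a)) ^+ 2.
Proof.
rewrite /plane_rot /= cosB sinB.
have ha := cos2Dsin2 a; have hb := cos2Dsin2 b.
transitivity ((cos a ^+ 2 + sin a ^+ 2) * (w.1 ^+ 2 + w.2 ^+ 2)
  + r ^+ 2 * (cos b ^+ 2 + sin b ^+ 2)
  - 2 * r * (w.1 * (cos b * cos a + sin b * sin a) + w.2 * (sin b * cos a - cos b * sin a))).
  by ring.
transitivity ((w.1 ^+ 2 + w.2 ^+ 2)
  + r ^+ 2 * ((cos a ^+ 2 + sin a ^+ 2) * (cos b ^+ 2 + sin b ^+ 2))
  - 2 * r * (w.1 * (cos b * cos a + sin b * sin a) + w.2 * (sin b * cos a - cos b * sin a))).
  by rewrite ha hb; ring.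
by ring.
Qed.

Lemma plane_rotD (a b : R) w : plane_rot (cos a) (sin a) (plane_rot (cos b) (sin b) w) =
  plane_rot (cos (a + b)) (sin (a + b)) w.
Proof. by rewrite /plane_rot /= cosD sinD; congr pair; ring. Qed.

Lemma placed_shift U n r y t (m : int) :
  placed U n r y t -> placed U n r y (t + vertex_angle n m).
Proof.
move=> h w hw; rewrite -plane_rotD; apply: h => k.
rewrite rotated_vertex_dist.
have -> : vertex_angle n k - vertex_angle n m = vertex_angle n (k - m); last exact: hw.
by rewrite /vertex_angle rmorphB /=; ring.
Qed.

(** Every congruent copy, reflected or not, is a rotated copy of the standard polygon: a reflection
    is a rotation after the mirror map of the first axis, which preserves the polygon and reverses
    the angle [t]. *)
Lemma placed_reuleaux n (K : set (plane R)) (v : 'I_n -> plane R) (cn : R * R) (r t : R)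
    (g : plane R -> plane R) U :
  (forall k : 'I_n, v k = (cn.1 + r * cos (t + 2 * pi * k%:R / n%:R),
                           cn.2 + r * sin (t + 2 * pi * k%:R / n%:R))) ->
  K = \bigcap_(k in [set: 'I_n]) closed_disk (v k) 1 ->
  Defs.isometry g -> g @` K `<=` U ->
  exists (y : R * R) (t' : R), placed U n r y t'.
Proof.
move=> vE KE ig gK.
have inK w : in_reuleaux n r w -> K (translate cn (plane_rot (cos t) (sin t) w)).
  move=> hw; rewrite KE => k _; rewrite /closed_disk /= -(@expr_le1 _ 2) ?sqrtr_ge0 //.
  rewrite edist_sqr vE /translate /=.
  have := hw (k%:Z); set b := t + _.
  have -> : vertex_angle n k%:Z = b - t by rewrite /b /vertex_angle addrAC subrr add0r.
  rewrite -rotated_vertex_dist; apply: le_trans.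
  by rewrite le_eqVlt; apply/orP; left; apply/eqP; rewrite /plane_rot /=; ring.
have [c [s [e [cs [->|->] gE]]]] := isometry_affine ig;
  have [u [cE sE]] := unit_angle cs; rewrite cE sE in gE.
- exists (g cn), (u + t) => w /inK Kw.
  have : U (g (translate cn (plane_rot (cos t) (sin t) w))) by apply: gK; exists (translate cn (plane_rot (cos t) (sin t) w)).
  rewrite -plane_rotD (gE (translate _ _)) (gE cn); congr U; rewrite /translate /plane_rot; congr pair => /=; ring.
- exists (g cn), (u - t) => w hw.
  (* The mirror image of [w]: the reflection contained in [g] undoes this one and leaves the
     rotation by [u - t]. *)
  have /inK Kw : in_reuleaux n r (w.1, - w.2).
    move=> k; have := hw (- k); rewrite /vertex_angle /= rmorphN mulrN mulNr cosN sinN.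
    by apply: le_trans; rewrite le_eqVlt; apply/orP; left; apply/eqP; ring.
  have : U (g (translate cn (plane_rot (cos t) (sin t) (w.1, - w.2)))).
    by apply: gK; exists (translate cn (plane_rot (cos t) (sin t) (w.1, - w.2))).
  rewrite -plane_rotD cosN sinN (gE (translate _ _)) (gE cn); congr U; rewrite /translate /plane_rot; congr pair => /=; ring.
Qed.
End reuleaux.

(** * Trigonometric values and circumradii *)

Section pentagon_values.
Context {R : realType}.

Lemma cosD2pi_int (a : R) (m : int) : cos (a + 2 * pi * m%:~R) = cos a.
Proof.
have N (b : R) (k : nat) : cos (b + 2 * pi * k%:R) = cos b.
  have -> : 2 * pi * k%:R = pi *+ 2 *+ k :> R by rewrite -[RHS]mulr_natr -[pi *+ 2]mulr_natl.
  by rewrite (periodicn (@cosD2pi R)).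
case: m => k; first exact: N.
by rewrite NegzE rmorphN /= -[LHS](N _ k.+1); congr cos; ring.
Qed.

Lemma sinD2pi_int (a : R) (m : int) : sin (a + 2 * pi * m%:~R) = sin a.
Proof. by rewrite -!cosBpihalf addrAC cosD2pi_int. Qed.

Lemma vertex_angle_mod n (k : int) : (0 < n)%N ->
  cos (vertex_angle n k) = cos (vertex_angle n (modz k n)) :> R /\
  sin (vertex_angle n k) = sin (vertex_angle n (modz k n)) :> R.
Proof.
move=> n0; have nz : (n%:R : R) != 0 by rewrite pnatr_eq0 -lt0n.
have -> : vertex_angle n k = vertex_angle n (modz k n) + 2 * pi * (divz k n)%:~R :> R.
  rewrite {1}(divz_eq k n) /vertex_angle rmorphD rmorphM /=.
  by rewrite (_ : (n%:Z)%:~R = n%:R) //; field.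
by rewrite cosD2pi_int sinD2pi_int.
Qed.

Lemma cos_triple (a : R) : cos (a + (a + a)) = 4 * cos a ^+ 3 - 3 * cos a.
Proof.
rewrite cosD cosD sinD; have := sin2cos2 a; rewrite expr2 => e.
transitivity (cos a * (cos a * cos a - sin a * sin a) - 2 * cos a * (sin a * sin a)); first by ring.
by rewrite e; ring.
Qed.

Lemma pi5_bounds : 0 < 2 * (pi : R) / 5 < pi / 2.
Proof. by have := pi_gt0 R; lra. Qed.

(** For a = 2 pi / 5 the angles 3 a and 2 a add up to 2 pi, so cos (3 a) = cos (2 a); dividing this
    cubic equation for cos a by cos a - 1 leaves the quadratic. *)
Lemma cos_2pi5 : 0 < cos (2 * (pi : R) / 5) /\ 4 * cos (2 * pi / 5) ^+ 2 + 2 * cos (2 * pi / 5) = 1 :> R.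
Proof.
have [a0 a1] := andP pi5_bounds; set a := 2 * pi / 5 in a0 a1 *.
have c0 : 0 < cos a by apply: cos_gt0_pihalf; rewrite a1 andbT; have := pi_gt0 R; lra.
split=> //; have s0 : 0 < sin a by apply: sin_gt0_pihalf; rewrite a0.
have c1 : cos a < 1.
  rewrite lt_neqAle cos_le1 andbT; apply/eqP => c1.
  by have := cos2Dsin2 a; rewrite c1; have := exprn_gt0 2 s0; lra.
have e : cos (a + (a + a)) = cos (a + a).
  by rewrite -[RHS]cosN -[RHS](cosD2pi_int _ 1); congr cos; rewrite /a; field.
rewrite cos_triple cosD -expr2 -[sin a * _]expr2 sin2cos2 in e.
have : (cos a - 1) * (4 * cos a ^+ 2 + 2 * cos a - 1) = 0.
  transitivity (4 * cos a ^+ 3 - 3 * cos a - (cos a ^+ 2 - (1 - cos a ^+ 2))); first by ring.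
  by rewrite e subrr.
by move/eqP; rewrite mulf_eq0 => /orP[/eqP|/eqP]; lra.
Qed.

Lemma sin_2pi5_gt0 : 0 < sin (2 * (pi : R) / 5).
Proof. by apply: sin_gt0_pihalf; exact: pi5_bounds. Qed.

Lemma cos_2pi3 : cos (2 * pi / 3) = - 2^-1 :> R.
Proof.
set a := 2 * pi / 3.
have p0 := pi_gt0 R.
have c1 : cos a < 1.
  rewrite lt_neqAle cos_le1 andbT; apply/eqP => c1.
  have s0 : 0 < sin a by apply: sin_gt0_pi; rewrite /a; apply/andP; split; lra.
  by have := cos2Dsin2 a; rewrite c1; have := exprn_gt0 2 s0; lra.
have e : cos (a + a) = cos a.
  by rewrite -[RHS]cosN -[RHS](cosD2pi_int _ 1); congr cos; rewrite /a; field.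
rewrite cosD -expr2 -[sin a * _]expr2 sin2cos2 in e.
have : (cos a - 1) * (2 * cos a + 1) = 0.
  transitivity (cos a ^+ 2 - (1 - cos a ^+ 2) - cos a); first by ring.
  by rewrite e subrr.
by move/eqP; rewrite mulf_eq0 => /orP[/eqP|/eqP]; lra.
Qed.

Lemma sin_2pi3_gt0 : 0 < sin (2 * (pi : R) / 3).
Proof. by move: (pi_gt0 R) => p0; apply: sin_gt0_pi; apply/andP; split; lra. Qed.

Lemma diameterE n (v : 'I_n -> plane R) (d : R) :
  (forall i j, Defs.edist (v i) (v j) <= d) -> (exists i j, Defs.edist (v i) (v j) = d) ->
  Defs.diameter (range v) = d.
Proof.
move=> ub [i [j ij]]; rewrite /Defs.diameter; apply/eqP; rewrite eq_le; apply/andP; split.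
  apply: ge_sup; first by exists d, (v i, v j).
  by move=> _ [[_ _] [[k _ <-] [l _ <-]] <-]; exact: ub.
apply: ub_le_sup; last by exists (v i, v j).
by exists d => _ [[_ _] [[k _ <-] [l _ <-]] <-]; exact: ub.
Qed.

Lemma ngon_edist n (v : 'I_n -> plane R) (cn : R * R) (r t : R) :
  (forall k : 'I_n, v k = (cn.1 + r * cos (t + 2 * pi * k%:R / n%:R),
                           cn.2 + r * sin (t + 2 * pi * k%:R / n%:R))) ->
  forall i j, Defs.edist (v i) (v j) ^+ 2 =
    2 * r ^+ 2 * (1 - cos (vertex_angle n (i%:Z - j%:Z))).
Proof.
move=> vE i j; rewrite edist_sqr !vE /=.
set a := t + _; set b := t + 2 * pi * j%:R / n%:R.
have -> : vertex_angle n (i%:Z - j%:Z) = a - b.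
  by rewrite /vertex_angle rmorphB /= /a /b; ring.
rewrite cosB.
transitivity (r ^+ 2 * ((cos a ^+ 2 + sin a ^+ 2) + (cos b ^+ 2 + sin b ^+ 2)
  - 2 * (cos a * cos b + sin a * sin b))); first by ring.
by rewrite !cos2Dsin2; ring.
Qed.

(** Diameter 1 fixes the circumradius: the squared chord over an angle is 2 r^2 (1 - cos), so the
    longest chord belongs to the least cosine [m], attained by the pair [i0], [j0]. *)
Lemma ngon_radius n (v : 'I_n -> plane R) (cn : R * R) (r t m : R) (i0 j0 : 'I_n) :
  (forall k : 'I_n, v k = (cn.1 + r * cos (t + 2 * pi * k%:R / n%:R),
                           cn.2 + r * sin (t + 2 * pi * k%:R / n%:R))) ->
  Defs.diameter (range v) = 1 ->
  (forall k : int, m <= cos (vertex_angle n k)) ->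
  cos (vertex_angle n (i0%:Z - j0%:Z)) = m ->
  2 * r ^+ 2 * (1 - m) = 1.
Proof.
move=> vE d1 hm e0; have E := ngon_edist vE.
have s0 i j : 0 <= Defs.edist (v i) (v j) by exact: sqrtr_ge0.
rewrite -e0 -E; have -> : Defs.edist (v i0) (v j0) = 1; last by rewrite expr1n.
rewrite -d1; apply/esym; apply: diameterE; last by exists i0, j0.
move=> i j; rewrite -ler_sqr ?nnegrE // !E e0.
apply: ler_wpM2l; first by rewrite mulr_ge0 // sqr_ge0.
by rewrite lerD2l lerN2.
Qed.
End pentagon_values.

(* Each box [(x0, x1, y0, y1)] contains a vertex of the polygon centred at 0. *)
Definition triangle_boxes : list (Z * Z * Z * Z) :=
  [:: (57735, 57736, 0, 0); (-28868, -28867, 50000, 50000); (-28868, -28867, -50000, -50000)]%Z.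

Definition pentagon_boxes : list (Z * Z * Z * Z) :=
  [:: (52573, 52574, 0, 0); (16245, 16246, 50000, 50000); (16245, 16246, -50000, -50000);
   (-42533, -42532, 30901, 30902); (-42533, -42532, -30902, -30901)]%Z.

(** [m] and [n] are the largest coordinate offsets from [p] to a point of the box, so the test
    bounds the distance to every point of the box, in particular to the irrational vertex in it. *)
Definition in_unit_disk (p : Z * Z) (b : Z * Z * Z * Z) : bool :=
  let x0 := b.1.1.1 in let x1 := b.1.1.2 in let y0 := b.1.2 in let y1 := b.2 in
  let m := Z.max (p.1 - x0) (x1 - p.1) in let n := Z.max (p.2 - y0) (y1 - p.2) in
  [&& (x0 <=? x1)%Z, (y0 <=? y1)%Z & (m * m + n * n <=? scale * scale)%Z].

Lemma triangle_points_ok :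
  List.forallb (fun p => List.forallb (in_unit_disk p) triangle_boxes)
    (List.app triangle_vertices triangle_table).
Proof. by vm_compute. Qed.

Lemma pentagon_points_ok :
  List.forallb (fun p => List.forallb (in_unit_disk p) pentagon_boxes)
    (List.app pentagon_vertices pentagon_table).
Proof. by vm_compute. Qed.

(** * Rational points inside the Reuleaux polygons *)

Section membership.
Context {R : realType}.
Notation T := (zr scale : R).

Lemma scale_gt0 : 0 < T. Proof. exact: zr_gt0. Qed.

Lemma scale_neq0 : T != 0.
Proof. exact: lt0r_neq0 scale_gt0. Qed.

Lemma scaled_square (D u v : R) : D != 0 -> (u / D - v) ^+ 2 * D ^+ 2 = (u - D * v) ^+ 2.
Proof. by move=> D0; field. Qed.

Lemma square_bound (l h m u v : R) : l <= v -> v <= h -> 0 <= m -> u - l <= m -> h - u <= m ->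
  (u - v) ^+ 2 <= m ^+ 2.
Proof.
move=> lv vh m0 ul hu; rewrite -[leLHS]real_normK ?num_real // ler_sqr ?nnegrE // ler_norml.
by apply/andP; split; lra.
Qed.

Lemma in_unit_disk_sound p b (vx vy : R) : in_unit_disk p b ->
  zr b.1.1.1 <= T * vx <= zr b.1.1.2 -> zr b.1.2 <= T * vy <= zr b.2 ->
  (zr p.1 / T - vx) ^+ 2 + (zr p.2 / T - vy) ^+ 2 <= 1.
Proof.
have T0 := scale_gt0; move=> /and3P[hx hy /(zr_le (R := R))].
set m := Z.max _ _; set n := Z.max (p.2 - _) _ => mn vxb vyb.
have key (q a b' : Z) (v : R) : (a <=? b')%Z -> zr a <= T * v <= zr b' ->
    (zr q / T - v) ^+ 2 * T ^+ 2 <= zr (Z.max (q - a) (b' - q)) ^+ 2.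
  move=> ab /andP[h0 h1].
  have k0 : zr (q - a) <= zr (Z.max (q - a) (b' - q)) :> R.
    by apply: zr_le; apply/Z.leb_le; exact: Z.le_max_l.
  have k1 : zr (b' - q) <= zr (Z.max (q - a) (b' - q)) :> R.
    by apply: zr_le; apply/Z.leb_le; exact: Z.le_max_r.
  rewrite (scaled_square _ _ scale_neq0).
  have m0 : 0 <= zr (Z.max (q - a) (b' - q)) :> R by apply: zr_ge0; clear - ab; lia.
  by apply: (square_bound h0 h1) => //; rewrite -zrB.
rewrite -(ler_pM2r (exprn_gt0 2 T0)) mul1r mulrDl.
rewrite zrD !zrM in mn; rewrite [leRHS]expr2; apply: le_trans mn.
by rewrite -!expr2; apply: lerD; apply: key.
Qed.
End membership.

Section vertices.
Context {R : realType}.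
Notation T := (zr scale : R).
Notation c5 := (cos (2 * (pi : R) / 5)).
Notation s5 := (sin (2 * (pi : R) / 5)).
Notation s3 := (sin (2 * (pi : R) / 3)).

Lemma vertex3 (k : int) (P : R -> R -> Prop) :
  P 1 0 -> P (- 2^-1) s3 -> P (- 2^-1) (- s3) ->
  P (cos (vertex_angle 3 k)) (sin (vertex_angle 3 k)).
Proof.
move=> h0 h1 h2; have [-> ->] := @vertex_angle_mod R 3 k isT.
have : 0 <= modz k 3 < 3 by rewrite modz_ge0 // ltz_pmod.
case: (modz k 3) => [[|[|[|//]]]|//] _; rewrite /vertex_angle.
- by rewrite mulr0 mul0r cos0 sin0.
- by rewrite mulr1 cos_2pi3.
- have -> : 2 * pi * (Posz 2)%:~R / 3%:R = - (2 * pi / 3) + 2 * pi * (Posz 1)%:~R :> R.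
    by field.
  by rewrite cosD2pi_int sinD2pi_int cosN sinN cos_2pi3.
Qed.

Lemma vertex5 (k : int) (P : R -> R -> Prop) :
  P 1 0 -> P c5 s5 -> P c5 (- s5) -> P (2 * c5 ^+ 2 - 1) (2 * c5 * s5) ->
  P (2 * c5 ^+ 2 - 1) (- (2 * c5 * s5)) ->
  P (cos (vertex_angle 5 k)) (sin (vertex_angle 5 k)).
Proof.
move=> h0 h1 h2 h3 h4; have [-> ->] := @vertex_angle_mod R 5 k isT.
have cd : cos (2 * pi / 5 + 2 * pi / 5) = 2 * c5 ^+ 2 - 1.
  by rewrite cosD; have := sin2cos2 (2 * (pi : R) / 5); lra.
have sd : sin (2 * pi / 5 + 2 * pi / 5) = 2 * c5 * s5 by rewrite sinD; ring.
have : 0 <= modz k 5 < 5 by rewrite modz_ge0 // ltz_pmod.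
case: (modz k 5) => [[|[|[|[|[|//]]]]]|//] _; rewrite /vertex_angle.
- by rewrite mulr0 mul0r cos0 sin0.
- by rewrite mulr1.
- have -> : 2 * pi * (Posz 2)%:~R / 5%:R = 2 * pi / 5 + 2 * pi / 5 :> R by field.
  by rewrite cd sd.
- have -> : 2 * pi * (Posz 3)%:~R / 5%:R =
     - (2 * pi / 5 + 2 * pi / 5) + 2 * pi * (Posz 1)%:~R :> R by field.
  by rewrite cosD2pi_int sinD2pi_int cosN sinN cd sd.
- have -> : 2 * pi * (Posz 4)%:~R / 5%:R = - (2 * pi / 5) + 2 * pi * (Posz 1)%:~R :> R.
    by field.
  by rewrite cosD2pi_int sinD2pi_int cosN sinN.
Qed.

Lemma root_bounds (l h w : R) : 0 <= w -> 0 <= l -> 0 <= h ->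
  l ^+ 2 <= w ^+ 2 -> w ^+ 2 <= h ^+ 2 -> l <= w <= h.
Proof. by move=> w0 l0 h0; rewrite !ler_sqr ?nnegrE // => -> ->. Qed.

(** The quadratic says (4 c + 1)^2 = 5, so enclosing [N * c] reduces to comparing squares with
    [5 * N ^+ 2]. *)
Lemma golden_bounds (N l h c : R) : 0 < c -> 4 * c ^+ 2 + 2 * c = 1 -> 0 < N ->
  0 <= l -> 0 <= h -> (4 * l + N) ^+ 2 <= 5 * N ^+ 2 -> 5 * N ^+ 2 <= (4 * h + N) ^+ 2 ->
  l <= N * c <= h.
Proof.
move=> c0 ce N0 l0 h0 hl hh.
have e : 5 * N ^+ 2 = (4 * (N * c) + N) ^+ 2.
  transitivity (N ^+ 2 * (4 * (4 * c ^+ 2 + 2 * c) + 1)); first by rewrite ce; ring.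
  by ring.
have Nc := mulr_gt0 N0 c0.
have sq (a b : R) : 0 <= a -> 0 <= b -> a ^+ 2 <= b ^+ 2 -> a <= b.
  by move=> a0 b0; rewrite ler_sqr ?nnegrE.
have k1 : 4 * l + N <= 4 * (N * c) + N by apply: sq; rewrite -?e //; lra.
have k2 : 4 * (N * c) + N <= 4 * h + N by apply: sq; rewrite -?e //; lra.
by apply/andP; split; lra.
Qed.

(** The side of the triangle is 1, so [r * s] is exactly one half; only [r] is irrational, and it is
    enclosed by comparing squares. *)
Lemma triangle_scaled (D r s l h l2 h2 e : R) : 0 < D -> 0 < r -> 0 < s ->
  3 * r ^+ 2 = 1 -> s ^+ 2 = 1 - 2^-1 ^+ 2 -> 0 <= l -> 0 <= h ->
  3 * l ^+ 2 <= D ^+ 2 -> D ^+ 2 <= 3 * h ^+ 2 -> 2 * l2 <= l -> h <= 2 * h2 -> D = 2 * e ->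
  [/\ l <= D * (r * 1) <= h, - h2 <= D * (r * - 2^-1) <= - l2 & D * (r * s) = e].
Proof.
move=> D0 r0 s0 re se l0 h0 hl hh l2l h2h De.
have Dr : (D * r) ^+ 2 * 3 = D ^+ 2 by rewrite exprMn -mulrA [r ^+ 2 * 3]mulrC re mulr1.
have /andP[b0 b1] : l <= D * r <= h.
  by apply: root_bounds => //; [rewrite ltW // mulr_gt0|lra|lra].
have rs : r * s = 2^-1.
  have rs0 : 0 < r * s by rewrite mulr_gt0.
  have : (r * s) ^+ 2 = 2^-1 ^+ 2 by rewrite exprMn se; nra.
  by move=> /eqP; rewrite eqf_sqr => /orP[/eqP//|/eqP]; lra.
split; [by rewrite mulr1 b0|by apply/andP; split; lra|].
by rewrite rs De mulrC mulrA mulVf ?mul1r.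
Qed.

(** Two vertices of the pentagon at angles 2 pi / 5 and -2 pi / 5 span a diagonal of length 1,
    whence [r * s] is one half. The quadratic for [c] brings the remaining squares to degree one in
    [c], so that an enclosure of [c] encloses all coordinates. *)
Lemma pentagon_relations (c s r : R) : 0 < c -> 0 < s -> 0 < r ->
  4 * c ^+ 2 + 2 * c = 1 -> s ^+ 2 = 1 - c ^+ 2 -> 2 * r ^+ 2 * (1 - (2 * c ^+ 2 - 1)) = 1 ->
  [/\ r * s = 2^-1, 5 * r ^+ 2 = 2 - 2 * c, 20 * (r * c) ^+ 2 = 3 - 8 * c,
      20 * (r * (2 * c ^+ 2 - 1)) ^+ 2 = 3 + 2 * c & r * (2 * c * s) = c].
Proof.
move=> c0 s0 r0 ce se re.
have c2 : c ^+ 2 = (1 - 2 * c) / 4 by lra.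
have r2 : r ^+ 2 * (3 + 2 * c) = 1.
  transitivity (2 * r ^+ 2 * (1 - (2 * c ^+ 2 - 1))); last exact: re.
  by rewrite c2; field.
have r5 : 5 * r ^+ 2 = 2 - 2 * c.
  have -> : 5 = (3 + 2 * c) * (2 - 2 * c).
    transitivity (6 - 2 * c - 4 * c ^+ 2); last by ring.
    by rewrite c2; field.
  transitivity ((r ^+ 2 * (3 + 2 * c)) * (2 - 2 * c)); first by ring.
  by rewrite r2 mul1r.
have rs : r * s = 2^-1.
  have rs0 : 0 < r * s by rewrite mulr_gt0.
  have : (r * s) ^+ 2 = 2^-1 ^+ 2.
    by rewrite exprMn se c2 expr2; move: r2; lra.
  by move=> /eqP; rewrite eqf_sqr => /orP[/eqP//|/eqP]; lra.
have c3 : c * (4 * c ^+ 2 + 2 * c) = c by rewrite ce mulr1.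
split=> //.
- transitivity (4 * (5 * r ^+ 2) * c ^+ 2); first by ring.
  by rewrite r5; lra.
- transitivity ((5 * r ^+ 2) * (2 * (2 * c ^+ 2 - 1)) ^+ 2); first by ring.
  rewrite r5 (_ : 2 * (2 * c ^+ 2 - 1) = - 1 - 2 * c); last by rewrite c2; field.
  by lra.
- transitivity (2 * c * (r * s)); first by ring.
  by rewrite rs; field.
Qed.
End vertices.

Section tables.
Context {R : realType}.
Notation T := (zr scale : R).
Notation c5 := (cos (2 * (pi : R) / 5)).
Notation s5 := (sin (2 * (pi : R) / 5)).
Notation s3 := (sin (2 * (pi : R) / 3)).

Lemma pentagon_scaled (D r c s P0 P1 a a' b b' g g' d d' e : R) :
  0 < c -> 0 < s -> 0 < r -> 0 < D -> 4 * c ^+ 2 + 2 * c = 1 ->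
  s ^+ 2 = 1 - c ^+ 2 -> 2 * r ^+ 2 * (1 - (2 * c ^+ 2 - 1)) = 1 ->
  P0 <= D ^+ 2 * c <= P1 ->
  [/\ 0 <= a, 0 <= a', 0 <= b & 0 <= b'] -> 0 <= g -> 0 <= g' ->
  5 * a ^+ 2 <= 2 * D ^+ 2 - 2 * P1 -> 2 * D ^+ 2 - 2 * P0 <= 5 * a' ^+ 2 ->
  20 * b ^+ 2 <= 3 * D ^+ 2 - 8 * P1 -> 3 * D ^+ 2 - 8 * P0 <= 20 * b' ^+ 2 ->
  20 * g ^+ 2 <= 3 * D ^+ 2 + 2 * P0 -> 3 * D ^+ 2 + 2 * P1 <= 20 * g' ^+ 2 ->
  D * d <= P0 -> P1 <= D * d' -> D = 2 * e ->
  [/\ a <= D * (r * 1) <= a', b <= D * (r * c) <= b',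
      - g' <= D * (r * (2 * c ^+ 2 - 1)) <= - g, d <= D * (r * (2 * c * s)) <= d'
    & D * (r * s) = e].
Proof.
move=> c0 s0 r0 D0 ce se re /andP[p0 p1] [a0 a0' b0 b0'] g0 g0' ha ha' hb hb' hg hg' hd hd' De.
have D1 := ltW D0; have r1 := ltW r0; have c1 := ltW c0.
have [rs r5 rc rn r2] := pentagon_relations c0 s0 r0 ce se re.
split.
- apply: root_bounds; rewrite ?mulr1 ?mulr_ge0 //;
    have -> : (D * r) ^+ 2 = D ^+ 2 * (5 * r ^+ 2) / 5 by field.
    by rewrite r5; lra.
  by rewrite r5; lra.
- apply: root_bounds; rewrite ?mulr_ge0 //;
    have -> : (D * (r * c)) ^+ 2 = D ^+ 2 * (20 * (r * c) ^+ 2) / 20 by field.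
    by rewrite rc; lra.
  by rewrite rc; lra.
- have neg : 0 <= - (2 * c ^+ 2 - 1) by lra.
  suff : g <= D * (r * - (2 * c ^+ 2 - 1)) <= g' by rewrite !mulrN => /andP[h1 h2]; apply/andP; split; lra.
  apply: root_bounds; rewrite ?mulr_ge0 //;
    have -> : (D * (r * - (2 * c ^+ 2 - 1))) ^+ 2 =
      D ^+ 2 * (20 * (r * (2 * c ^+ 2 - 1)) ^+ 2) / 20 by field.
    by rewrite rn; lra.
  by rewrite rn; lra.
- rewrite r2 -(ler_pM2l D0) -[in X in _ && X](ler_pM2l D0) mulrA -expr2; apply/andP; split; lra.
- by rewrite rs De mulrAC mulfV ?mul1r.
Qed.

Lemma scale_half : T = 2 * zr 50000.
Proof. by rewrite -zr2 -zrM. Qed.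

Lemma triangle_in_reuleaux (r : R) p : 0 < r -> 3 * r ^+ 2 = 1 ->
  List.In p (List.app triangle_vertices triangle_table) ->
  in_reuleaux 3 r (zr p.1 / T, zr p.2 / T).
Proof.
move=> r0 re pin.
have z3 : zr 3 = 3 :> R by rewrite zrE.
have zsq (a b : Z) (m : Z) : (m * (a * a) <=? b * b)%Z -> zr m * (zr a : R) ^+ 2 <= zr b ^+ 2.
  by move=> /(zr_le (R := R)); rewrite !zrM !expr2.
have zsq' (a b : Z) (m : Z) : (b * b <=? m * (a * a))%Z -> (zr b : R) ^+ 2 <= zr m * zr a ^+ 2.
  by move=> /(zr_le (R := R)); rewrite !zrM !expr2.
have se : s3 ^+ 2 = 1 - 2^-1 ^+ 2 by rewrite sin2cos2 cos_2pi3 sqrrN.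
have [h1 h2 h3] : [/\ zr 57735 <= T * (r * 1) <= zr 57736,
    - zr 28868 <= T * (r * - 2^-1) <= - zr 28867 & T * (r * s3) = zr 50000].
  apply: triangle_scaled => //.
  - exact: scale_gt0.
  - exact: sin_2pi3_gt0.
  - exact: zr_ge0.
  - exact: zr_ge0.
  - by rewrite -z3; exact: zsq.
  - by rewrite -z3; exact: zsq'.
  - by rewrite -zr2 -zrM; exact: zr_le.
  - by rewrite -zr2 -zrM; exact: zr_le.
  - exact: scale_half.
have := triangle_points_ok => /List.forallb_forall /(_ p pin) /List.forallb_forall hb.
have n1 : zr (-28868) = - zr 28868 :> R by rewrite -zrN.
have n2 : zr (-28867) = - zr 28867 :> R by rewrite -zrN.
have n3 : zr (-50000) = - zr 50000 :> R by rewrite -zrN.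
move=> k; apply: (@vertex3 R k (fun vc vs =>
  (zr p.1 / T - r * vc) ^+ 2 + (zr p.2 / T - r * vs) ^+ 2 <= 1)).
- apply: (in_unit_disk_sound (hb (57735, 57736, 0, 0)%Z _)); first by left.
    exact: h1.
  by rewrite /= zr0 !mulr0 lexx.
- apply: (in_unit_disk_sound (hb (-28868, -28867, 50000, 50000)%Z _)); first by right; left.
    by rewrite [_.1.1.1]/= [_.1.1.2]/= n1 n2.
  by rewrite [_.1.2]/= [_.2]/= h3 lexx.
- apply: (in_unit_disk_sound (hb (-28868, -28867, -50000, -50000)%Z _)); first by right; right; left.
    by rewrite [_.1.1.1]/= [_.1.1.2]/= n1 n2.
  by rewrite [_.1.2]/= [_.2]/= !mulrN h3 n3 lexx.
Qed.

Lemma pentagon_in_reuleaux (r : R) p : 0 < r ->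
  2 * r ^+ 2 * (1 - (2 * c5 ^+ 2 - 1)) = 1 ->
  List.In p (List.app pentagon_vertices pentagon_table) ->
  in_reuleaux 5 r (zr p.1 / T, zr p.2 / T).
Proof.
move=> r0 re pin; have T0 : 0 < T by exact: zr_gt0.
have [c0 ce] := @cos_2pi5 R.
have z5 : zr 5 = 5 :> R by rewrite zrE.
have z3 : zr 3 = 3 :> R by rewrite zrE.
have z4 : zr 4 = 4 :> R by rewrite zrE.
have z8 : zr 8 = 8 :> R by rewrite zrE.
have z20 : zr 20 = 20 :> R by rewrite zrE.
have le (a b : Z) : (a <=? b)%Z -> zr a <= zr b :> R by exact: zr_le.
(* Ten decimals of (sqrt 5 - 1) / 4, since the scale squared is 10^10. *)
have P01 : zr 3090169943 <= T ^+ 2 * c5 <= zr 3090169944.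
  apply: golden_bounds => //; first exact: exprn_gt0.
  - exact: zr_ge0.
  - exact: zr_ge0.
  - have := le ((4 * 3090169943 + scale * scale) * (4 * 3090169943 + scale * scale))%Z
      (5 * ((scale * scale) * (scale * scale)))%Z isT.
    by rewrite !(zrD, zrM) z4 z5 !expr2.
  - have := le (5 * ((scale * scale) * (scale * scale)))%Z
      ((4 * 3090169944 + scale * scale) * (4 * 3090169944 + scale * scale))%Z isT.
    by rewrite !(zrD, zrM) z4 z5 !expr2.
have [h1 h2 h3 h4 h5] : [/\ zr 52573 <= T * (r * 1) <= zr 52574,
    zr 16245 <= T * (r * c5) <= zr 16246,
    - zr 42533 <= T * (r * (2 * c5 ^+ 2 - 1)) <= - zr 42532,
    zr 30901 <= T * (r * (2 * c5 * s5)) <= zr 30902 & T * (r * s5) = zr 50000].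
  apply: pentagon_scaled P01 _ _ _ _ _ _ _ _ _ _ _ _ => //.
  - exact: sin_2pi5_gt0.
  - exact: sin2cos2.
  - by split; exact: zr_ge0.
  - exact: zr_ge0.
  - exact: zr_ge0.
  - have := le (5 * (52573 * 52573))%Z (2 * (scale * scale) - 2 * 3090169944)%Z isT.
    by rewrite !(zrB, zrM) z5 zr2 !expr2.
  - have := le (2 * (scale * scale) - 2 * 3090169943)%Z (5 * (52574 * 52574))%Z isT.
    by rewrite !(zrB, zrM) z5 zr2 !expr2.
  - have := le (20 * (16245 * 16245))%Z (3 * (scale * scale) - 8 * 3090169944)%Z isT.
    by rewrite !(zrB, zrM) z20 z8 z3 !expr2.
  - have := le (3 * (scale * scale) - 8 * 3090169943)%Z (20 * (16246 * 16246))%Z isT.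
    by rewrite !(zrB, zrM) z20 z8 z3 !expr2.
  - have := le (20 * (42532 * 42532))%Z (3 * (scale * scale) + 2 * 3090169943)%Z isT.
    by rewrite !(zrD, zrM) z20 zr2 z3 !expr2.
  - have := le (3 * (scale * scale) + 2 * 3090169944)%Z (20 * (42533 * 42533))%Z isT.
    by rewrite !(zrD, zrM) z20 zr2 z3 !expr2.
  - by have := le (scale * 30901)%Z 3090169943%Z isT; rewrite zrM.
  - by have := le 3090169944%Z (scale * 30902)%Z isT; rewrite zrM.
  - exact: scale_half.
have := pentagon_points_ok => /List.forallb_forall /(_ p pin) /List.forallb_forall hb.
have n1 : zr (-42533) = - zr 42533 :> R by rewrite -zrN.
have n2 : zr (-42532) = - zr 42532 :> R by rewrite -zrN.
have n3 : zr (-50000) = - zr 50000 :> R by rewrite -zrN.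
have n4 : zr (-30901) = - zr 30901 :> R by rewrite -zrN.
have n5 : zr (-30902) = - zr 30902 :> R by rewrite -zrN.
move=> k; apply: (@vertex5 R k (fun vc vs =>
  (zr p.1 / T - r * vc) ^+ 2 + (zr p.2 / T - r * vs) ^+ 2 <= 1)).
- apply: (in_unit_disk_sound (hb (52573, 52574, 0, 0)%Z _)); first by left.
    exact: h1.
  by rewrite /= zr0 !mulr0 lexx.
- apply: (in_unit_disk_sound (hb (16245, 16246, 50000, 50000)%Z _)); first by right; left.
    exact: h2.
  by rewrite [_.1.2]/= [_.2]/= h5 lexx.
- apply: (in_unit_disk_sound (hb (16245, 16246, -50000, -50000)%Z _)).
  + by do 2 right; left.
  + exact: h2.
  + by rewrite [_.1.2]/= [_.2]/= !mulrN h5 n3 lexx.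
- apply: (in_unit_disk_sound (hb (-42533, -42532, 30901, 30902)%Z _)).
  + by do 3 right; left.
  + by rewrite [_.1.1.1]/= [_.1.1.2]/= n1 n2.
  + exact: h4.
- apply: (in_unit_disk_sound (hb (-42533, -42532, -30902, -30901)%Z _)).
  + by do 4 right; left.
  + by rewrite [_.1.1.1]/= [_.1.1.2]/= n1 n2.
  + by rewrite [_.1.2]/= [_.2]/= !mulrN n4 n5 !lerN2 andbC.
Qed.

Lemma triangle_radius (v : 'I_3 -> plane R) (cn : R * R) (r t : R) :
  (forall k : 'I_3, v k = (cn.1 + r * cos (t + 2 * pi * k%:R / 3%:R),
                           cn.2 + r * sin (t + 2 * pi * k%:R / 3%:R))) ->
  Defs.diameter (range v) = 1 -> 3 * r ^+ 2 = 1.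
Proof.
move=> vE d1; suff : 2 * r ^+ 2 * (1 - - 2^-1) = 1 by lra.
apply: (ngon_radius (i0 := inord 1) (j0 := ord0) vE d1).
- by move=> k; apply: (@vertex3 R k (fun vc _ => - 2^-1 <= vc)); lra.
- by rewrite inordK // subr0 /vertex_angle mulr1 cos_2pi3.
Qed.

Lemma pentagon_radius (v : 'I_5 -> plane R) (cn : R * R) (r t : R) :
  (forall k : 'I_5, v k = (cn.1 + r * cos (t + 2 * pi * k%:R / 5%:R),
                           cn.2 + r * sin (t + 2 * pi * k%:R / 5%:R))) ->
  Defs.diameter (range v) = 1 -> 2 * r ^+ 2 * (1 - (2 * c5 ^+ 2 - 1)) = 1.
Proof.
move=> vE d1; have [c0 ce] := @cos_2pi5 R.
(* The diameter is a diagonal, not a side: vertices 0 and 2, with cos (4 pi / 5) as the least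
   cosine. *)
apply: (ngon_radius (i0 := inord 2) (j0 := ord0) vE d1).
- by move=> k; apply: (@vertex5 R k (fun vc _ => 2 * c5 ^+ 2 - 1 <= vc)); lra.
- rewrite inordK // subr0 /vertex_angle.
  have -> : 2 * pi * (Posz 2)%:~R / 5%:R = 2 * pi / 5 + 2 * pi / 5 :> R by field.
  by rewrite cosD; have := sin2cos2 (2 * (pi : R) / 5); lra.
Qed.
End tables.

(** * Covers *)

Section covers.
Context {R : realType}.
Notation T := (zr scale : R).

Lemma convex_segment_closed (U : set (plane R)) : convex_set U -> segment_closed U.
Proof.
move=> cU p q t /andP[t0 t1] Up Uq.
have := cU q p (Itv01 t0 t1); rewrite !inE => /(_ Uq Up); congr U.
by rewrite /conv /=; congr pair; rewrite addrC.
Qed.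

(** Change of coordinates to the centre of the disk and the integer unit; cross products, and with
    them the area, are multiplied by [T ^+ 2]. *)
Lemma good_cover (U : set (plane R)) (o : R * R) (A : R) :
  compact U -> convex_set U ->
  (forall p : R * R, p.1 ^+ 2 + p.2 ^+ 2 <= 2^-1 ^+ 2 -> U (translate o p)) ->
  Defs.area U = A%:E ->
  good (fun q => U (translate o (q.1 / T, q.2 / T))) (A * T ^+ 2) (T / 2).
Proof.
move=> cptU cU diskU aU; have T0 : 0 < T by exact: zr_gt0.
move: (T) T0 => D D0; have Dn : D != 0 by rewrite gt_eqF.
have scU := convex_segment_closed cU.
pose sc (q : R * R) := (q.1 / D, q.2 / D).
have crossE p q : cross (sc p) (sc q) = cross p q / D ^+ 2 by rewrite /cross /=; field.
have okE a l b : chain_ok a l b -> chain_ok (sc a) (map sc l) (sc b).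
  have pos p q : 0 < cross p q -> 0 < cross (sc p) (sc q).
    by move=> h; rewrite crossE divr_gt0 // exprn_gt0.
  elim: l a => [|q l IH] a /=; first exact: pos.
  by move=> [h1 h2 /IH h3]; split; [exact: pos|exact: pos|exact: h3].
have sumE a l b : chain_sum (sc a) (map sc l) (sc b) = chain_sum a l b / D ^+ 2.
  by elim: l a => [|q l IH] a /=; rewrite ?IH crossE ?mulrDl.
split.
- move=> p q t t01 Up Uq; have := scU _ _ t t01 Up Uq; congr U.
  by rewrite /translate; congr pair => /=; field.
- move=> q hq; apply: diskU; rewrite /= !expr_div_n -mulrDl ler_pdivrMr ?exprn_gt0 //.
  by apply: (le_trans hq); rewrite expr_div_n mulrC exprVn.
- move=> a l1 b l2 c l3 Ul ab bc ca k1 k2 k3.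
  have pos p q : 0 < cross p q -> 0 < cross (sc p) (sc q).
    by move=> h; rewrite crossE divr_gt0 // exprn_gt0.
  have inmap q l : List.In q (map sc l) -> exists2 q', List.In q' l & q = sc q'.
    elim: l => //= q' l IH [<-|/IH[q'' ? ->]]; first by exists q' => //; left.
    by exists q'' => //; right.
  have Uo : U o.
    have : U (translate o (0, 0)) by apply: diskU; rewrite /= expr0n addr0 sqr_ge0.
    by congr U; rewrite [RHS]surjective_pairing /translate; congr pair => /=; rewrite addr0.
  have := @polygon_measure R U o (map sc l1) (map sc l2) (map sc l3) (sc a) (sc b) (sc c)
    (compact_plane_measurable cptU) scU Uo.
  have E : sc a :: map sc l1 ++ sc b :: map sc l2 ++ sc c :: map sc l3 =
      map sc (a :: l1 ++ b :: l2 ++ c :: l3) by rewrite /= !(map_cat, map_cons).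
  rewrite E => /(_ _ (pos _ _ ab) (pos _ _ bc) (pos _ _ ca)).
  move=> /(_ _ (okE _ _ _ k1) (okE _ _ _ k2) (okE _ _ _ k3)) H.
  have {}H : (((chain_sum (sc a) (map sc l1) (sc b) + chain_sum (sc b) (map sc l2) (sc c) +
     chain_sum (sc c) (map sc l3) (sc a)) / 2)%:E <= Defs.area U)%E.
    by apply: H => q /inmap[q' /Ul ? ->].
  move: H; rewrite aU lee_fin !sumE -!mulrDl ler_pdivrMr // ler_pdivrMr ?exprn_gt0 //.
  by rewrite mulrAC mulrC.
Qed.

Lemma disk_copy (U : set (plane R)) : contains_congruent_copy U (closed_disk 0 2^-1) ->
  exists o : R * R, forall p : R * R, p.1 ^+ 2 + p.2 ^+ 2 <= 2^-1 ^+ 2 -> U (translate o p).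
Proof.
move=> [g ig gU]; have [c [s [e [cs he gE]]]] := isometry_affine ig.
have ee : e ^+ 2 = 1 by case: he => ->; rewrite ?sqrrN expr1n.
exists (g (0, 0)) => p hp.
(* The transpose, hence inverse, of the linear part of [g] applied to [p]; it preserves the norm, so
   [q] stays in the disk. *)
pose q : R * R := (c * p.1 + s * p.2, e * (- s * p.1 + c * p.2)).
have qE : q.1 ^+ 2 + q.2 ^+ 2 = p.1 ^+ 2 + p.2 ^+ 2.
  rewrite /q /= exprMn ee mul1r.
  transitivity ((c ^+ 2 + s ^+ 2) * (p.1 ^+ 2 + p.2 ^+ 2)); first by ring.
  by rewrite cs mul1r.
have : U (g q).
  apply: gU; exists q => //; rewrite /closed_disk /= -ler_sqr ?nnegrE ?sqrtr_ge0 //.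
  by rewrite edist_sqr /= !subr0 qE.
rewrite gE; congr U; rewrite /translate /q; congr pair => /=; congr +%R.
  transitivity ((c ^+ 2 + s ^+ 2 * e ^+ 2) * p.1 + (1 - e ^+ 2) * c * s * p.2); first by ring.
  by rewrite ee mulr1 cs; ring.
transitivity ((s ^+ 2 + c ^+ 2 * e ^+ 2) * p.2 + (1 - e ^+ 2) * c * s * p.1); first by ring.
by rewrite ee mulr1 [s ^+ 2 + _]addrC cs; ring.
Qed.
End covers.

(** * Reduction of the relative angle *)

Section angles.
Context {R : realType}.
Notation c5 := (cos (2 * (pi : R) / 5)).
Notation s5 := (sin (2 * (pi : R) / 5)).
Notation s3 := (sin (2 * (pi : R) / 3)).

(* pi / 15 = 2 pi / 5 - pi / 3 *)
Lemma pi15_bounds : 10 * (47 * sin ((pi : R) / 15)) < 100 * cos ((pi : R) / 15).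
Proof.
have [c0 ce] := @cos_2pi5 R; have s0 := @sin_2pi5_gt0 R; have t0 := @sin_2pi3_gt0 R.
have se := sin2cos2 (2 * (pi : R) / 5).
have te : s3 ^+ 2 = 3 / 4 by rewrite sin2cos2 cos_2pi3; field.
have aE : (pi : R) / 15 = 2 * pi / 5 - (pi - 2 * pi / 3) by field.
have pc : cos (pi - 2 * pi / 3) = 2^-1 :> R.
  by rewrite cosB cospi sinpi cos_2pi3; field.
have ps : sin (pi - 2 * pi / 3) = s3 by rewrite sinB cospi sinpi; ring.
rewrite aE; move: (pi - 2 * pi / 3) pc ps => b pc ps; rewrite sinB cosB pc ps.
move: c5 s5 s3 c0 ce s0 t0 se te => c s t c0 ce s0 t0 se te.
(* The margin is thin, tan (pi / 15) being about 0.21256 and 10 / 47 about 0.21277; the fractions 55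
   / 178, 84 / 97 and 292 / 307 bound cos (2 pi / 5), sin (2 pi / 3) and sin (2 pi / 5) closely
   enough. *)
have /andP[c1 _] : 55 <= 178 * c <= 56 by apply: (golden_bounds c0 ce); lra.
have sq (p q : R) : 0 < p -> 0 < q -> p ^+ 2 < q ^+ 2 -> p < q.
  by move=> p0 q0; rewrite ltr_sqr ?nnegrE ?(ltW p0) ?(ltW q0).
have t1 : 84 < 97 * t by apply: sq; [lra|lra|rewrite exprMn te; lra].
have cc : 55 ^+ 2 <= 178 ^+ 2 * c ^+ 2.
  by rewrite -exprMn ler_sqr ?nnegrE ?mulr_ge0 ?(ltW c0).
have s1 : 307 * s < 292 by apply: sq; [lra|lra|rewrite exprMn se; lra].
have ct : 55 * 84 <= (178 * c) * (97 * t) by apply: ler_pM => //; lra.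
have st : 307 * s * (47 - 20 * t) <= 292 * (47 - 20 * t).
  have t2 : t < 2 by apply: sq; [lra|lra|rewrite te; lra].
  by rewrite ler_wpM2r //; lra.
lra.
Qed.

Lemma small_angle (d : R) : `|d| <= pi / 15 ->
  sin d <= sin (pi / 15) /\ cos (pi / 15) <= cos d.
Proof.
move=> dp; have p0 := pi_gt0 R; have [d1 d2] : - (pi / 15) <= d /\ d <= pi / 15.
  by move: dp; rewrite ler_norml => /andP[].
split.
  rewrite leNgt; apply/negP; rewrite ltr_sin ?in_itv /=; [lra|apply/andP; split; lra..].
rewrite -[cos d]cos_norm leNgt; apply/negP.
by rewrite ltr_cos ?in_itv /=; [lra|apply/andP; split=> //; lra..].
Qed.

Lemma nearest_multiple (t h : R) : 0 < h -> exists m : int, `|t - m%:~R * h| <= h / 2.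
Proof.
move=> h0; exists (Num.floor (t / h + 2^-1)).
have /andP[] := real_floor_itv (num_real (t / h + 2^-1)).
set m := (Num.floor _)%:~R; rewrite rmorphD /= => h1 h2.
have e : t = t / h * h by rewrite divfK ?gt_eqF.
rewrite ler_norml; apply/andP; split.
  by rewrite e -mulrBl -[- (h / 2)]/(- (h * 2^-1)) -mulNr [- h * _]mulrC mulrN -mulNr ler_pM2r //; lra.
by rewrite e -mulrBl [h / 2]mulrC ler_pM2r //; lra.
Qed.
End angles.

Lemma cover_area {R : realType} (U : set (plane R)) (A a b r3 r5 : R) (o y z : R * R) :
  compact U -> convex_set U -> Defs.area U = A%:E ->
  (forall p : R * R, p.1 ^+ 2 + p.2 ^+ 2 <= 2^-1 ^+ 2 -> U (translate o p)) ->
  0 < r3 -> 3 * r3 ^+ 2 = 1 -> 0 < r5 ->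
  2 * r5 ^+ 2 * (1 - (2 * cos (2 * (pi : R) / 5) ^+ 2 - 1)) = 1 ->
  placed U 3 r3 y a -> placed U 5 r5 z b -> `|b - a| <= pi / 15 ->
  834 / 1000 <= A.
Proof.
move=> cptU cU aU dU r30 r3e r50 r5e hy hz small.
pose d := b - a.
have [sd cd] := small_angle small.
have small' : `|- d| <= pi / 15 by rewrite normrN.
have [sd' _] := small_angle small'; rewrite sinN in sd'.
have gV := good_rot (cos2Dsin2 a) (good_cover cptU cU dU aU).
have T0 : 0 < zr scale :> R by exact: zr_gt0.
(* Coordinates in the frame of the triangle: origin at the centre of the disk, turned by [- a], in
   integer units. There the relative rotation of the pentagon is [d]. *)
pose toV (p : R * R) := plane_rot (cos a) (- sin a)
  (zr scale * (p.1 - o.1), zr scale * (p.2 - o.2)).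
have := @covering_bound R _ _ (cos d) (sin d) (toV y) (toV z) gV (cos2Dsin2 d).
have cs := cos2Dsin2 a.
have bE : b = a + d by rewrite /d addrC subrK.
have hx q : List.In q (List.app triangle_vertices triangle_table) ->
    U (translate y (plane_rot (cos a) (sin a) (zr q.1 / zr scale, zr q.2 / zr scale))).
  by move=> qin; apply: hy; exact: triangle_in_reuleaux.
have hp q : List.In q (List.app pentagon_vertices pentagon_table) ->
    U (translate z (plane_rot (cos b) (sin b) (zr q.1 / zr scale, zr q.2 / zr scale))).
  by move=> qin; apply: hz; exact: pentagon_in_reuleaux.
(* The slope 10 / 47 separates tan (pi / 15) from the slope 20825 / 97807 of the outermost arc end,
   so the arcs cover every angle [d] in the reduced range. *)
have K : zr 10 * zr 97807 <= zr 47 * zr 20825 :> R.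
  by have := @zr_le R (10 * 97807) (47 * 20825) isT; rewrite !zrM.
have z834 : zr 834 = 834 :> R by rewrite zrE.
have z1668 : zr 1668 = 2 * 834 :> R by rewrite -z834 -zr2 -zrM.
have z2000 : zr 2000 = 1000 * 2 :> R by rewrite zr2000 zrE.
have z10 : zr 10 = 10 :> R by rewrite zrE.
have z47 : zr 47 = 47 :> R by rewrite zrE.
have p0 : 0 < zr 97807 :> R by exact: zr_gt0.
have q0 : 0 < zr 20825 :> R by exact: zr_gt0.
have pb := @pi15_bounds R.
rewrite z10 z47 in K; rewrite z1668 z2000.
move: (zr scale) T0 (zr 97807) (zr 20825) p0 q0 K @toV hx hp => T T0 k l p0 q0 K toV hx hp.
have Tn : T != 0 by rewrite gt_eqF.
move=> H; suff : 2 * 834 * T ^+ 2 <= 1000 * 2 * (A * T ^+ 2).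
  by rewrite mulrA ler_pM2r ?exprn_gt0 //; lra.
have h0 : 0 < cos (pi / 15) :> R.
  by have := pi_gt0 R; move=> p; apply: cos_gt0_pihalf; apply/andP; split; lra.
have h1 : k * (10 * (47 * sin (pi / 15))) < k * (100 * cos (pi / 15)) by rewrite ltr_pM2l.
have h2 : 10 * k * cos (pi / 15) <= 47 * l * cos (pi / 15) by rewrite ler_pM2r.
have h4 : l * cos (pi / 15) <= l * cos d by rewrite ler_pM2l.
apply: H.
- move=> q /hx; congr U; rewrite /translate /toV /plane_rot; congr pair => /=.
    by apply: subr0_eq; transitivity ((1 - (cos a ^+ 2 + sin a ^+ 2)) * (y.1 - o.1));
      [field|rewrite cs subrr mul0r].
  by apply: subr0_eq; transitivity ((1 - (cos a ^+ 2 + sin a ^+ 2)) * (y.2 - o.2));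
      [field|rewrite cs subrr mul0r].
- move=> q /hp; rewrite bE cosD sinD.
  congr U; rewrite /translate /toV /plane_rot; congr pair => /=.
    by apply: subr0_eq; transitivity ((1 - (cos a ^+ 2 + sin a ^+ 2)) * (z.1 - o.1));
      [field|rewrite cs subrr mul0r].
  by apply: subr0_eq; transitivity ((1 - (cos a ^+ 2 + sin a ^+ 2)) * (z.2 - o.2));
      [field|rewrite cs subrr mul0r].
- have h3 : k * - sin d <= k * sin (pi / 15) by rewrite ler_pM2l.
  by lra.
- have h3 : k * sin d <= k * sin (pi / 15) by rewrite ler_pM2l.
  by lra.
Qed.

Theorem theoremS14p2 (R : realType) (R3 R5 : set (plane R))
  (hR3 : regular_reuleaux 3 R3) (hR5 : regular_reuleaux 5 R5) :
  ((834%:R / 1000%:R)%:E <= L35 R3 R5)%E.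
Proof.
apply/ereal_infP => _ [U [cptU cU dU' [g3 i3 g3U] [g5 i5 g5U]] <-].
have [ctr dU] := disk_copy dU'.
have a0 : (0 <= Defs.area U)%E by exact: measure_ge0.
(* An infinite area satisfies the bound trivially, so a real [A] remains. *)
case aU : (Defs.area U) a0 => [A| |] a0; [|by rewrite leey|by []].
rewrite lee_fin.
have [v3 [[c3 [r3 r30 [t3 v3E]]] d3 K3]] := hR3.
have [v5 [[c5 [r5 r50 [t5 v5E]]] d5 K5]] := hR5.
have [y [a ha]] := placed_reuleaux v3E K3 i3 g3U.
have [z [b hb]] := placed_reuleaux v5E K5 i5 g5U.
have h0 : 0 < 2 * (pi : R) / 15 by have := pi_gt0 R; lra.
have [m hm] := nearest_multiple (b - a) h0.
apply: (cover_area cptU cU aU dU r30 (triangle_radius v3E d3) r50 (pentagon_radius v5E d5)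
  (placed_shift (2 * m) ha) (placed_shift (3 * m) hb)).
(* 2 pi (3 m / 5 - 2 m / 3) = - m (2 pi / 15) *)
rewrite (_ : _ - _ = b - a - m%:~R * (2 * pi / 15)).
  by apply: (le_trans hm); lra.
by rewrite /vertex_angle !rmorphM /=; field.
Qed.
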